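(* Consider the sub-Riemannian structure on $M=\mathbb T_x\times\mathbb R_y\times\mathbb T_z$ for which an orthonormal basis is given by $X_1=(1,0,\tfrac{y^2}{2})=\partial_x+\tfrac{y^2}{2}\partial_z$ and $X_2=(0,1,0)=\partial_y$. Then the corresponding intrinsic sub-Riemannian Laplacian, which is given by $$\Delta_{sr}=(X_1)^2+(X_2)^2-\frac1y X_2 ,$$ with domain $C_0^\infty(M\setminus\{y=0\})$, is essentially self-adjoint on $L^2(M,d\omega)$, where $d\omega=\frac1{|y|}\,dx\,dy\,dz$ is the Popp volume.
   Context: $\mathbb T$ denotes the circle, and $C_0^\infty$ smooth compactly supported functions. Outside $\{y=0\}$ the vector fields $X_1$, $X_2$, $X_3=[X_1,X_2]$ form a frame of the tangent space; the Popp volume is the density $d\omega$ on $M\setminus\{y=0\}$ associated with the volume form $dX_1\wedge dX_2\wedge dX_3$, where $\{dX_1,dX_2,dX_3\}$ is the dual basis of $\{X_1,X_2,X_3\}$. The intrinsic sub-Riemannian Laplacian on $M\setminus\{y=0\}$ is $\Delta_{sr}\phi=\mathrm{div}(\nabla_{sr}\phi)$, where $\nabla_{sr}\phi=X_1(\phi)X_1+X_2(\phi)X_2$ is the sub-Riemannian gradient and $\mathrm{div}$ is the divergence with respect to the Popp volume $d\omega$. *)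

(* Defs.v *)
From HB Require Import structures.
From mathcomp Require Import all_boot all_order all_algebra.
From mathcomp Require Import complex.
From mathcomp Require Import all_classical all_reals all_analysis.
Set Implicit Arguments.
Unset Strict Implicit.
Unset Printing Implicit Defensive.
Import Order.TTheory GRing.Theory Num.Theory.
Import numFieldNormedType.Exports.
Local Open Scope classical_set_scope.
Local Open Scope ring_scope.

(** The manifold is M = T x R x T with T = R / 2 pi Z.  Functions and vector
    fields on M are represented by their lifts to the universal cover
    R x R x R, i.e. by maps that are 2 pi-periodic in x and z. *)

Section Geometry.
Variable R : realType.

Definition xc (p : R * R * R) : R := p.1.1.
Definition yc (p : R * R * R) : R := p.1.2.
Definition zc (p : R * R * R) : R := p.2.
Definition pcoord (i : 'I_3) (p : R * R * R) : R := [:: xc p; yc p; zc p]`_i.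
Definition evec (i : 'I_3) : R * R * R :=
  ((i == 0%N :> nat)%:R, (i == 1%N :> nat)%:R, (i == 2%N :> nat)%:R).

Definition on_M (T : Type) (f : R * R * R -> T) : Prop :=
  forall x y z, f (x + 2 * pi, y, z) = f (x, y, z) /\
                f (x, y, z + 2 * pi) = f (x, y, z).

(** A closed fundamental cell for the covering; its boundary is Lebesgue-null,
    and a closed subset of M is compact iff its lift meets the cell in a
    compact set. *)
Definition cell : set (R * R * R) :=
  [set p | 0 <= xc p <= 2 * pi /\ 0 <= zc p <= 2 * pi].

(** Real functions of class C^n, resp. C^oo, on an open set [U]. *)
Fixpoint Cn_on (n : nat) (U : set (R * R * R)) (f : R * R * R -> R) : Prop :=
  (forall p, U p -> {for p, continuous f}) /\
  (if n is m.+1 then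
     forall i, (forall p, U p -> derivable f p (evec i)) /\
               Cn_on m U (fun p => 'D_(evec i) f p)
   else True).

Definition smooth_on (U : set (R * R * R)) (f : R * R * R -> R) : Prop :=
  forall n, Cn_on n U f.

Definition vfield : Type := R * R * R -> R * R * R.

Definition vderiv (X : vfield) (f : R * R * R -> R) : R * R * R -> R :=
  fun p => 'D_(X p) f p.

Definition bracket (X Y : vfield) : vfield :=
  fun p => 'D_(X p) Y p - 'D_(Y p) X p.

(** Columns: the components of X1, X2 and X3 = [X1, X2].  The rows of the
    inverse matrix are then the components of the dual basis dX1, dX2, dX3. *)
Definition frame_mx (X1 X2 : vfield) (p : R * R * R) : 'M[R]_3 :=
  \matrix_(i, j) pcoord i ([:: X1 p; X2 p; bracket X1 X2 p]`_j).

(** Density with respect to dx dy dz of |dX1 /\ dX2 /\ dX3|. *)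
Definition popp (X1 X2 : vfield) (p : R * R * R) : R :=
  `|\det (invmx (frame_mx X1 X2 p))|.

(** Divergence of [X] with respect to the density [w dx dy dz]. *)
Definition div_wrt (w : R * R * R -> R) (X : vfield) : R * R * R -> R :=
  fun p => (w p)^-1 * \sum_(i < 3) 'D_(evec i) (fun q => w q * pcoord i (X q)) p.

Definition grad_sr (X1 X2 : vfield) (f : R * R * R -> R) : vfield :=
  fun p => vderiv X1 f p *: X1 p + vderiv X2 f p *: X2 p.

Definition lap_sr (X1 X2 : vfield) (f : R * R * R -> R) : R * R * R -> R :=
  div_wrt (popp X1 X2) (grad_sr X1 X2 f).

End Geometry.

(** Unbounded operators on the complex Hilbert space L^2(M, w dx dy dz).
    Elements of L^2 are represented by functions, two functions [f], [g]
    being identified when [L2dist2 w f g = 0]. *)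

Section Operators.
Variable R : realType.
Implicit Types (w : R * R * R -> R) (f g u v : R * R * R -> R[i]).

Definition cRe f : R * R * R -> R := fun p => complex.Re (f p).
Definition cIm f : R * R * R -> R := fun p => complex.Im (f p).

Definition complexify (A : (R * R * R -> R) -> (R * R * R -> R)) f :
    R * R * R -> R[i] :=
  fun p => Complex (A (cRe f) p) (A (cIm f) p).

Let mu := @lebesgue_measure R.
Let mR := measurableTypeR R.
Let mR3 := (mR * mR * mR)%type.
Definition leb3 : set mR3 -> \bar R := ((mu \x mu) \x mu)%E.

(** Squared L^2 norm. *)
Definition L2norm2 w f : \bar R :=
  (\int[leb3]_(p in @cell R) (((cRe f p) ^+ 2 + (cIm f p) ^+ 2) * w p)%:E)%E.

Definition L2 w f : Prop :=
  [/\ on_M f, measurable_fun [set: mR3] (cRe f), measurable_fun [set: mR3] (cIm f)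
    & (L2norm2 w f < +oo)%E].

Definition L2dist2 w f g : \bar R := L2norm2 w (fun p => f p - g p).

(** int_M f conj(g) w dx dy dz *)
Definition L2dot w f g : R[i] :=
  let h p := f p * conjc (g p) in
  Complex (Rintegral leb3 (@cell R) (fun p => cRe h p * w p))
          (Rintegral leb3 (@cell R) (fun p => cIm h p * w p)).

Definition relL2 : Type := set ((R * R * R -> R[i]) * (R * R * R -> R[i])).

Definition op_graph (D : set (R * R * R -> R[i]))
    (A : (R * R * R -> R[i]) -> (R * R * R -> R[i])) : relL2 :=
  [set ug | D ug.1 /\ ug.2 = A ug.1].

Definition dense_domain w (G : relL2) : Prop :=
  forall f, L2 w f -> exists s : nat -> (R * R * R -> R[i]),
    (forall n, exists g, G (s n, g)) /\
    (fun n => L2dist2 w (s n) f) @ \oo --> (0 : \bar R)%E.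

Definition op_adjoint w (G : relL2) : relL2 :=
  [set vg | [/\ L2 w vg.1, L2 w vg.2 &
    forall u h, G (u, h) -> L2dot w h vg.1 = L2dot w u vg.2]].

Definition op_closure w (G : relL2) : relL2 :=
  [set ug | [/\ L2 w ug.1, L2 w ug.2 &
    exists s : nat -> (R * R * R -> R[i]) * (R * R * R -> R[i]),
      [/\ forall n, G (s n),
          (fun n => L2dist2 w (s n).1 ug.1) @ \oo --> (0 : \bar R)%E &
          (fun n => L2dist2 w (s n).2 ug.2) @ \oo --> (0 : \bar R)%E]]].

Definition linear_operator w (D : set (R * R * R -> R[i]))
    (A : (R * R * R -> R[i]) -> (R * R * R -> R[i])) : Prop :=
  [/\ D (fun=> 0),
      forall c u v, D u -> D v -> D (fun p => c * u p + v p),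
      forall u, D u -> L2 w u /\ L2 w (A u),
      forall u v, D u -> D v -> L2dist2 w u v = 0%E ->
        L2dist2 w (A u) (A v) = 0%E &
      forall c u v, D u -> D v ->
        L2dist2 w (A (fun p => c * u p + v p))
                  (fun p => c * A u p + A v p) = 0%E].

Definition symmetric_op w (G : relL2) : Prop :=
  forall u h v g, G (u, h) -> G (v, g) -> L2dot w h v = L2dot w u g.

Definition self_adjoint w (G : relL2) : Prop :=
  dense_domain w G /\ op_adjoint w G = G.

(** The operator [A] with domain [D] is densely defined and symmetric, and its
    closure is self-adjoint. *)
Definition essentially_self_adjoint w (D : set (R * R * R -> R[i]))
    (A : (R * R * R -> R[i]) -> (R * R * R -> R[i])) : Prop :=
  [/\ linear_operator w D A,
      dense_domain w (op_graph D A),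
      symmetric_op w (op_graph D A) &
      self_adjoint w (op_closure w (op_graph D A))].

Definition supp f : set (R * R * R) := closure [set p | f p != 0].

(** C_0^oo(M \ Z) for a closed subset [Z] of M, its elements being extended by
    0 to M: the support is a compact subset of M disjoint from [Z]. *)
Definition Cc_smooth_off (Z : set (R * R * R)) : set (R * R * R -> R[i]) :=
  [set f | [/\ on_M f, smooth_on (~` Z) (cRe f), smooth_on (~` Z) (cIm f),
    compact (supp f `&` @cell R) &
    supp f `&` Z = set0]].

End Operators.

Section Structure.
Variable R : realType.

Definition X1 : vfield R := fun p => (1, 0, yc p ^+ 2 / 2).
Definition X2 : vfield R := fun=> (0, 1, 0).

Definition singular_set : set (R * R * R) := [set p | yc p = 0].

End Structure.

(* Main.v *)
(** Since [(Delta u, u) <= 0] on test functions, von Neumann's criterion reduces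
    essential self-adjointness to showing that the only [v] in [L^2] which is
    orthogonal to the range of [Delta - 1] is [0].  Pairing [v] with
    [h(y) cos (k x + l z)] and [h(y) sin (k x + l z)], on which [X1^2] acts as
    multiplication by [- (k + l y^2 / 2)^2], shows that each Fourier coefficient
    [phi] of [v] is a weak solution of [y (phi' / y)' = (q + 1) phi] with
    [q >= 0].  This is the system [Phi' = - |y| K], [K' = - (q + 1) / |y| Phi],
    for which [- Phi K] is nondecreasing, so that [|Phi|] is bounded below on
    one side of any point where it does not vanish; as the measure [dy / |y|] has
    infinite mass both near [0] and near infinity, this contradicts [v] in
    [L^2].  Hence every Fourier coefficient vanishes and [v = 0]. *)

Require Import Defs.
From HB Require Import structures.
From mathcomp Require Import all_boot all_order all_algebra.
From mathcomp Require Import complex ring lra.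
From mathcomp Require Import all_classical all_reals all_analysis.
From mathcomp Require Import measurable_realfun.
Import Order.TTheory GRing.Theory Num.Theory.
Import numFieldNormedType.Exports.
Local Open Scope classical_set_scope.
Local Open Scope ring_scope.
Set Implicit Arguments.
Unset Strict Implicit.
Unset Printing Implicit Defensive.

(** The Hilbert space argument uses only the real inner product [rdot], the real part of the
    hermitian one. Imaginary parts come from the same identities applied to [i f], since the
    operator acts separately on real and imaginary parts and so commutes with [i]. The triviality of
    the orthogonal complement of the range serves twice. It is the hypothesis of von Neumann's
    argument, and it also gives density of the domain: [Delta] preserves the test functions, so a
    vector orthogonal to all of them is orthogonal to the range of [Delta - 1]. No mollification on
    M is needed. Test functions vanish near [y = 0], so the half-lines [y > 0] and [y < 0] do not
    interact. A sign [s] with [s y = |y|] treats both at once, and no boundary condition at [0] ever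
    enters. A coefficient is first known only as an integrable function of [y] on compact intervals
    avoiding [0]; its regularity is extracted from the weak equation before the monotonicity
    argument can start. Uniqueness of Fourier coefficients is proved for integrable functions
    through trigonometric polynomials that approximate indicators of intervals, without summing any
    Fourier series. *)

(** * Projection and von Neumann's criterion in a real pre-Hilbert space *)

Section PreHilbert.
Variables (R : realType) (E : Type).
(* [lin a f g] stands for [a f + g]. *)
Variables (lin : R -> E -> E -> E) (L : set E) (dot : E -> E -> R).
Hypothesis linL : forall a f g, L f -> L g -> L (lin a f g).
Hypothesis dotC : forall f g, L f -> L g -> dot f g = dot g f.
Hypothesis dotl : forall a f g h, L f -> L g -> L h ->
  dot (lin a f g) h = a * dot f h + dot g h.
(** The form is only semidefinite and [E] carries no vector space axioms: its elements will be
    functions rather than classes. Everything is therefore phrased through [dot] and [sqdist], not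
    through equality in [E]. *)
Hypothesis dot_ge0 : forall f, L f -> 0 <= dot f f.

Definition sqdist f g := dot (lin (-1) g f) (lin (-1) g f).

Definition lim_to (s : nat -> E) f := (fun n => sqdist (s n) f) @ \oo --> (0 : R).

Hypothesis complete : forall s : nat -> E, (forall n, L (s n)) ->
  (forall e, 0 < e -> exists N, forall m n, (N <= m)%N -> (N <= n)%N ->
     sqdist (s m) (s n) <= e) ->
  exists g, L g /\ lim_to s g.

Local Hint Resolve linL : core.

Let dC f g : L f -> L g -> dot f g = dot g f.
Proof. exact: dotC. Qed.
Arguments dC : clear implicits.

Lemma dotr a f g h : L f -> L g -> L h ->
  dot h (lin a f g) = a * dot h f + dot h g.
Proof.
by move=> Lf Lg Lh; rewrite dotC ?dotl ?(dotC Lh Lf) ?(dotC Lh Lg); auto.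
Qed.

Lemma sqdistE f g : L f -> L g -> sqdist f g = dot f f - 2 * dot f g + dot g g.
Proof.
move=> Lf Lg; rewrite /sqdist dotl ?dotr //; auto.
by rewrite (dC g f) //; ring.
Qed.

Lemma sqdist_ge0 f g : L f -> L g -> 0 <= sqdist f g.
Proof. by move=> Lf Lg; apply: dot_ge0; exact: linL. Qed.

Lemma sqdistC f g : L f -> L g -> sqdist f g = sqdist g f.
Proof. by move=> Lf Lg; rewrite !sqdistE // (dC g f) //; ring. Qed.

(** The polynomial [|t f + g|^2] in [t] is nonnegative, in particular at its minimum. Because of
    semidefiniteness the case [dot f f = 0] is separate: there the polynomial is affine, so its
    slope must vanish. *)
Lemma cauchy_schwarz f g : L f -> L g -> dot f g ^+ 2 <= dot f f * dot g g.
Proof.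
move=> Lf Lg; have key t : 0 <= t ^+ 2 * dot f f + 2 * t * dot f g + dot g g.
  have := dot_ge0 (linL t Lf Lg); rewrite dotl ?dotr //; auto.
  rewrite (dC g f) // => h; lra.
have [f0|f0] := eqVneq (dot f f) 0.
  rewrite f0 mul0r; have [->|fg0] := eqVneq (dot f g) 0; first by rewrite expr0n.
  (* At this [t] the affine function takes the value [-1]. *)
  have := key (- (dot g g + 1) / (2 * dot f g)); rewrite f0 mulr0 add0r.
  have -> : 2 * (- (dot g g + 1) / (2 * dot f g)) * dot f g = - (dot g g + 1) by field.
  by move=> h; exfalso; lra.
have f1 : 0 < dot f f by rewrite lt_def f0 dot_ge0.
have := key (- dot f g / dot f f).
have -> : (- dot f g / dot f f) ^+ 2 * dot f f + 2 * (- dot f g / dot f f) * dot f g + dot g g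
  = (dot f f * dot g g - dot f g ^+ 2) / dot f f by field.
by rewrite pmulr_lge0 ?invr_gt0 // subr_ge0.
Qed.

(** The right side minus the left side is [|f - 2 g + h|^2]. *)
Lemma sqdist_triangle f g h : L f -> L g -> L h ->
  sqdist f h <= 2 * sqdist f g + 2 * sqdist g h.
Proof.
move=> Lf Lg Lh; rewrite !sqdistE //.
have /dot_ge0 : L (lin 1 (lin (-2) g f) h) by auto.
rewrite !(dotl, dotr) //; auto.
rewrite (dC g f) // (dC h f) // (dC h g) //.
move=> H; lra.
Qed.

Lemma lim_to_dot s f u : (forall n, L (s n)) -> L f -> L u -> lim_to s f ->
  (fun n => dot (s n) u) @ \oo --> dot f u.
Proof.
move=> Ls Lf Lu sf; apply/cvgrPdist_le => e e0.
have c0 := dot_ge0 Lu.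
(* By Cauchy-Schwarz this accuracy gives [e^2 |u|^2 / (|u|^2 + 1) <= e^2]; the added [1] covers
   [|u| = 0]. *)
have d0 : 0 < e ^+ 2 / (dot u u + 1) by rewrite divr_gt0 ?exprn_gt0 ?ltr_wpDl.
move/cvgrPdist_le : sf => /(_ _ d0); apply: filterS => n.
rewrite sub0r normrN (ger0_norm (sqdist_ge0 _ _)) // => dn.
have := cauchy_schwarz (linL (-1) Lf (Ls n)) Lu.
rewrite dotl // -/(sqdist _ _) => cs.
rewrite -ler_sqr ?nnegrE ?normr_ge0 ?(ltW e0) // real_normK ?num_real //.
have -> : (dot f u - dot (s n) u) ^+ 2 = (-1 * dot f u + dot (s n) u) ^+ 2 by ring.
apply: le_trans cs _; apply: le_trans (ler_wpM2r c0 dn) _.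
rewrite mulrAC ler_pdivrMr ?ltr_wpDl // ler_wpM2l ?sqr_ge0 //; lra.
Qed.

Lemma lim_toD a s f s' f' : (forall n, L (s n)) -> L f -> (forall n, L (s' n)) -> L f' ->
  lim_to s f -> lim_to s' f' -> lim_to (fun n => lin a (s n) (s' n)) (lin a f f').
Proof.
move=> Ls Lf Ls' Lf' sf sf'; rewrite /lim_to.
apply: (@squeeze_cvgr _ _ _ _ (fun=> 0)
  (fun n => 2 * a ^+ 2 * sqdist (s n) f + 2 * sqdist (s' n) f')).
- apply: nearW => n; rewrite sqdist_ge0 /=; auto.
  (* With [x = s n - f] and [y = s' n - f'], nonnegativity of [|y - a x|^2] amounts to
     [|a x + y|^2 <= 2 a^2 |x|^2 + 2 |y|^2]. *)
  have /dot_ge0 : L (lin (- a) (lin (-1) f (s n)) (lin (-1) f' (s' n))) by auto.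
  rewrite /sqdist !(dotl, dotr); auto.
  rewrite (dC f (s n)) // (dC f' (s n)) // (dC f' f) // (dC f' (s' n)) //.
  rewrite (dC (s' n) f) // (dC (s' n) (s n)) // (dC f (s' n)) //.
  rewrite ?(dC (s' n) f) // ?(dC f' (s' n)) // ?(dC f' f) //.
  move=> H; lra.
- exact: cvg_cst.
- rewrite -[X in _ --> X](_ : 2 * a ^+ 2 * 0 + 2 * 0 = 0 :> R); last by ring.
  by apply: cvgD; apply: cvgM => //; exact: cvg_cst.
Qed.

Lemma lim_to_cauchy s f : (forall n, L (s n)) -> L f -> lim_to s f ->
  forall e, 0 < e -> exists N, forall m n, (N <= m)%N -> (N <= n)%N ->
    sqdist (s m) (s n) <= e.
Proof.
move=> Ls Lf sf e e0; have e4 : 0 < e / 4 by lra.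
move/cvgrPdist_le : sf => /(_ _ e4)[N _ HN]; exists N => m n Nm Nn.
have dl k : (N <= k)%N -> sqdist (s k) f <= e / 4.
  by move=> /HN /=; rewrite sub0r normrN ger0_norm ?sqdist_ge0.
have := sqdist_triangle (Ls m) Lf (Ls n); rewrite (sqdistC Lf) //.
have := dl m Nm; have := dl n Nn; lra.
Qed.

(* Projection theorem: a minimizing sequence converges by the parallelogram
   identity, and the residual of its limit is orthogonal to [S]. *)
Lemma dense_of_orthogonal (S : set E) : S !=set0 -> S `<=` L ->
  (forall a f g, S f -> S g -> S (lin a f g)) ->
  (forall f, L f -> (forall u, S u -> dot u f = 0) -> dot f f = 0) ->
  forall f, L f -> exists s, (forall n, S (s n)) /\ lim_to s f.
Proof.
move=> [u0 Su0] SL Slin orth f Lf.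
pose X := [set sqdist u f | u in S].
have X0 : X !=set0 by exists (sqdist u0 f), u0.
have lbX : lbound X 0 by move=> _ [u Su <-]; apply: sqdist_ge0 => //; exact: SL.
have hlX : has_lbound X by exists 0.
have hiX : has_inf X by split.
have infX u : S u -> inf X <= sqdist u f by move=> Su; apply: ge_inf => //; exists u.
have /choice[s Hs] (n : nat) : exists u, S u /\ sqdist u f <= inf X + n.+1%:R^-1.
  have n0 : 0 < n.+1%:R^-1 :> R by rewrite invr_gt0.
  by have [_ [u Su <-] /ltW] := inf_adherent n0 hiX; exists u.
have Ss n : S (s n) by case: (Hs n).
have Ls n : L (s n) by exact/SL/Ss.
have inv_le (N n : nat) : (N <= n)%N -> n.+1%:R^-1 <= N.+1%:R^-1 :> R.
  by move=> Nn; rewrite lef_pV2 ?posrE // ler_nat ltnS.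
have [g [Lg sg]] : exists g, L g /\ lim_to s g.
  apply: complete => // e e0.
  have [N _ HN] : \forall N \near \oo, (N.+1%:R^-1 : R) <= e / 4.
    have /cvgrPdist_le/(_ (e / 4)) := @cvg_harmonic R.
    have e4 : 0 < e / 4 by lra.
    move=> /(_ e4); apply: filterS => N /=; rewrite sub0r normrN ger0_norm //.
  have {}HN := HN N (leqnn N).
  exists N => m n Nm Nn.
  (* The midpoint of [s m] and [s n] belongs to [S], so its squared distance to [f] is at least the
     infimum. *)
  have mid : S (lin (2^-1) (lin (-1) (s n) (s m)) (s n)) by auto.
  have := infX _ mid.
  have hm := le_trans (Hs m).2 (lerD (lexx _) (le_trans (inv_le _ _ Nm) HN)).
  have hn := le_trans (Hs n).2 (lerD (lexx _) (le_trans (inv_le _ _ Nn) HN)).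
  suff : sqdist (s m) (s n) = 2 * sqdist (s m) f + 2 * sqdist (s n) f -
    4 * sqdist (lin 2^-1 (lin (-1) (s n) (s m)) (s n)) f by lra.
  rewrite !sqdistE //; auto.
  rewrite !(dotl, dotr) //; auto.
  by rewrite (dC (s n) (s m)) //; field.
have Lh : L (lin (-1) g f) by auto.
have orthg u : S u -> dot u (lin (-1) g f) = 0.
  move=> Su; have Lu := SL _ Su.
  (* The limit [g] need not lie in [S], so minimality is tested on [s n + t u] with the error
     [1 / (n + 1)], and the inequality is then passed to the limit. *)
  have key t : 0 <= t ^+ 2 * dot u u - 2 * t * dot u (lin (-1) g f).
    pose c n := t ^+ 2 * dot u u - 2 * t * (dot u f - dot (s n) u) + n.+1%:R^-1.
    have cl : c @ \oo --> t ^+ 2 * dot u u - 2 * t * (dot u f - dot g u) + 0.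
      apply: cvgD; last exact: cvg_harmonic.
      apply: cvgB; first exact: cvg_cst.
      apply: cvgM; first exact: cvg_cst.
      by apply: cvgB; [exact: cvg_cst|exact: lim_to_dot].
    have -> : t ^+ 2 * dot u u - 2 * t * dot u (lin (-1) g f)
      = t ^+ 2 * dot u u - 2 * t * (dot u f - dot g u) + 0.
      by rewrite dotr // (dC g u) //; ring.
    rewrite -(cvg_lim _ cl) //; apply: limr_ge; first by apply/cvg_ex; eexists; exact: cl.
    apply: nearW => n; rewrite /c.
    have := infX _ (Slin t _ _ Su (Ss n)); have := (Hs n).2.
    rewrite !sqdistE; auto.
    rewrite !(dotl, dotr); auto.
    rewrite (dC (s n) u) //; move: (n.+1%:R^-1) => k; lra.
  set x := dot u (lin _ _ _) in key *.
  have u0' := dot_ge0 Lu.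
  (* A multiple of [x] close to the optimal [x / |u|^2], but defined also when [|u| = 0]; the value
     there is negative unless [x = 0]. *)
  have := key (x / (dot u u + 1)).
  have -> : (x / (dot u u + 1)) ^+ 2 * dot u u - 2 * (x / (dot u u + 1)) * x =
     - (x ^+ 2 * ((dot u u + 2) / (dot u u + 1) ^+ 2)).
    by field; lra.
  rewrite oppr_ge0 pmulr_lle0; last by rewrite divr_gt0 ?exprn_gt0 //; lra.
  by rewrite real_exprn_even_le0 ?num_real //= => /eqP.
have h0 := orth _ Lh orthg.
exists s; split => //.
apply: (@squeeze_cvgr _ _ _ _ (fun=> 0) (fun n => 2 * sqdist (s n) g + 2 * 0)).
- apply: nearW => n; rewrite sqdist_ge0 //=.
  have := sqdist_triangle (Ls n) Lg Lf; rewrite (sqdistC Lg) // {3}/sqdist h0.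
  by [].
- exact: cvg_cst.
- rewrite -[X in _ --> X](_ : 2 * 0 + 2 * 0 = 0 :> R); last by ring.
  by apply: cvgD; [apply: cvgM => //; exact: cvg_cst|exact: cvg_cst].
Qed.

Section Operator.
Variables (D : set E) (A : E -> E).
Hypothesis D0 : D !=set0.
Hypothesis DL : D `<=` L.
Hypothesis AL : forall u, D u -> L (A u).
Hypothesis Dlin : forall a u v, D u -> D v -> D (lin a u v).
Hypothesis Alin : forall a u v, D u -> D v -> A (lin a u v) = lin a (A u) (A v).
Hypothesis Asym : forall u v, D u -> D v -> dot (A u) v = dot u (A v).

(** Symmetry is passed to the limit in one argument at a time, the other one being kept in the
    domain meanwhile. *)
Lemma closure_symmetric s f g s' f' g' :
  (forall n, D (s n)) -> (forall n, D (s' n)) ->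
  L f -> L g -> L f' -> L g' ->
  lim_to s f -> lim_to (A \o s) g -> lim_to s' f' -> lim_to (A \o s') g' ->
  dot g f' = dot f g'.
Proof.
move=> Ds Ds' Lf Lg Lf' Lg' sf sg sf' sg'.
have step n : dot g (s' n) = dot f (A (s' n)).
  apply: (@cvg_unique _ (@Rhausdorff R) ((fun m => dot (A (s m)) (s' n)) @ \oo)).
    by apply: lim_to_dot => //; [move=> m; exact/AL|exact/DL].
  have -> : (fun m => dot (A (s m)) (s' n)) = (fun m => dot (s m) (A (s' n))).
    by apply/funext => m; rewrite Asym.
  by apply: lim_to_dot => //; [move=> m; exact/DL|exact/AL].
rewrite dotC // (dotC Lf Lg').
apply: (@cvg_unique _ (@Rhausdorff R) ((fun m => dot (s' m) g) @ \oo)).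
  by apply: lim_to_dot => // m; exact/DL.
have -> : (fun m => dot (s' m) g) = (fun m => dot ((A \o s') m) f).
  apply/funext => m /=; rewrite dotC //; last exact/DL.
  by rewrite step dotC //; exact/AL.
by apply: lim_to_dot => // m; exact/AL.
Qed.

Hypothesis Aneg : forall u, D u -> dot (A u) u <= 0.
Hypothesis Aker : forall f, L f ->
  (forall u, D u -> dot (lin (-1) u (A u)) f = 0) -> dot f f = 0.

(* Von Neumann: [A - 1] expands norms and has dense range, so that
   [(A - 1) s = g - v] is solvable in the closure; [v - s] is then orthogonal to
   the range of [A - 1]. *)
Lemma adjoint_in_closure v g : L v -> L g ->
  (forall u, D u -> dot (A u) v = dot u g) ->
  exists s, [/\ forall n, D (s n), lim_to s v & lim_to (A \o s) g].
Proof.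
move=> Lv Lg adj.
pose B u := lin (-1) u (A u).
have LB u : D u -> L (B u) by move=> Du; apply: linL; auto.
have Lgv : L (lin (-1) v g) by auto.
(* The range of [B] is enlarged by all elements having the same inner products as some [B u].
   Without axioms on [lin], a combination of values of [B] is a value of [B] only in this sense. *)
have [] := @dense_of_orthogonal [set w | exists2 u, D u &
    L w /\ forall f, L f -> dot w f = dot (B u) f] _ _ _ _ _ Lgv.
- by have [u0 Du0] := D0; exists (B u0), u0 => //; split => //; exact: LB.
- by move=> w [u _ []].
- move=> a w w' [u Du [Lw Hw]] [u' Du' [Lw' Hw']]; exists (lin a u u'); first exact: Dlin.
  split; first exact: linL.
  by move=> f Lf; rewrite dotl // Hw // Hw' // /B Alin // !dotl; auto; ring.
- move=> f Lf fo; apply: Aker => // u Du; apply: fo.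
  by exists u => //; split; auto.
move=> w [Sw wg].
have /choice[s Hs] n : exists u, [/\ D u, L (w n) & forall f, L f -> dot (w n) f = dot (B u) f].
  by have [u Du []] := Sw n; exists u.
have Ds n : D (s n) by have [] := Hs n.
have Ls n : L (s n) by exact: DL.
have LAs n : L (A (s n)) by exact: AL.
have LBs n : L (B (s n)) by exact: LB.
have Lw n : L (w n) by have [] := Hs n.
have Hw n f : L f -> dot (w n) f = dot (B (s n)) f by have [_ _] := Hs n; exact.
have dB n f : L f -> sqdist (B (s n)) f = sqdist (w n) f.
  move=> Lf; rewrite !sqdistE // -!Hw //; auto.
  by rewrite (dotC (Lw n) (LBs n)) -Hw.
have {}wg : lim_to (fun n => B (s n)) (lin (-1) v g).
  rewrite /lim_to (_ : (fun n => _) = (fun n => sqdist (w n) (lin (-1) v g))) //.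
  by apply/funext => n; rewrite dB.
(* Expanding, [|A u - u|^2 = |A u|^2 - 2 <A u, u> + |u|^2], where the middle term is nonnegative by
   [Aneg]. *)
have Bexp u : D u -> dot u u <= dot (B u) (B u).
  move=> Du; have Lu := DL Du; have LAu := AL Du.
  have := Aneg Du; have := dot_ge0 LAu.
  by rewrite /B !(dotl, dotr); auto; rewrite (dC u (A u)) //; lra.
have expand m n : sqdist (s m) (s n) <= sqdist (B (s m)) (B (s n)).
  pose u := lin (-1) (s n) (s m).
  have Du : D u by exact: Dlin.
  have Lu := DL Du; have LAu := AL Du.
  have -> : sqdist (B (s m)) (B (s n)) = dot (B u) (B u).
    rewrite /B /u Alin // /sqdist !(dotl, dotr) //; auto.
    by rewrite ?(dC (A (s n)) (s m)) // ?(dC (A (s n)) (s n)) // ?(dC (A (s m)) (s n)) //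
      ?(dC (A (s m)) (s m)) //; ring.
  exact: Bexp.
have [f [Lf sf]] : exists f, L f /\ lim_to s f.
  apply: complete => // e e0; have [N HN] := lim_to_cauchy LBs Lgv wg e0.
  by exists N => m n Nm Nn; apply: le_trans (expand m n) _; exact: HN.
(* The sequence [A (s n)] is recovered as [B (s n) + s n], which tends to [(g - v) + f]. *)
have sfA : lim_to (fun n => lin 1 (B (s n)) (s n)) (lin 1 (lin (-1) v g) f).
  exact: lim_toD.
have ortho u : D u -> dot (lin (-1) u (A u)) (lin (-1) f v) = 0.
  move=> Du; have Lu := DL Du; have LAu := AL Du; rewrite dotr //; last exact: LB.
  rewrite [dot _ v]dotl // adj //.
  suff -> : dot (lin (-1) u (A u)) f = dot u (lin (-1) v g).
    by rewrite dotr //; ring.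
  apply: (@cvg_unique _ (@Rhausdorff R) ((fun m => dot (s m) (B u)) @ \oo)).
    rewrite dotC //; last exact: LB.
    by apply: lim_to_dot => //; exact: LB.
  have -> : (fun m => dot (s m) (B u)) = (fun m => dot (B (s m)) u).
    apply/funext => m; rewrite /B dotl ?dotr //.
    by rewrite -Asym.
  by rewrite (dotC Lu) //; exact: lim_to_dot.
have /(Aker (linL (-1) Lf Lv)) fv := ortho.
(* [v] and [f] differ by a null vector, so by Cauchy-Schwarz they have the same inner products,
   which is all that [sqdist] sees. *)
have fv0 f' : L f' -> dot v f' = dot f f'.
  move=> Lf'; have := cauchy_schwarz (linL (-1) Lf Lv) Lf'.
  rewrite fv mul0r dotl // real_exprn_even_le0 ?num_real //= => /eqP; lra.
exists s; split=> //.
  rewrite /lim_to; apply: cvg_trans sf; apply: near_eq_cvg; apply: nearW => n.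
  by rewrite !sqdistE // (dotC (Ls n) Lv) !fv0 // (dotC Lf Lv) fv0 // (dotC (Ls n) Lf).
rewrite /lim_to; apply: cvg_trans sfA; apply: near_eq_cvg; apply: nearW => n.
have LAs' : L ((A \o s) n) by exact: LAs.
rewrite /B !sqdistE //; auto.
rewrite !(dotl, dotr) //; auto.
rewrite ?(dotC (Ls n) Lv) ?(dotC (LAs n) Lv) ?(dotC Lg Lv) ?fv0 //.
rewrite ?(dotC Lf Lv) ?fv0 // ?(dotC (Ls n) Lf) ?(dotC (LAs n) Lf) ?(dotC Lg Lf).
by rewrite ?(dotC (Ls n) (LAs n)) ?(dotC (Ls n) Lg) ?(dotC (LAs n) Lg); ring.
Qed.

End Operator.
End PreHilbert.

(** * Completeness of weighted real L^2 spaces *)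

Section WeightedL2.
Context d (T : measurableType d) (R : realType).
Variables (mu : {measure set T -> \bar R}) (D : set T) (w : T -> R).
Hypothesis mD : measurable D.
Hypothesis mw : measurable_fun [set: T] w.
Hypothesis w0 : forall x, 0 <= w x.

Definition wnorm2 (f : T -> R) : \bar R := (\int[mu]_(x in D) (f x ^+ 2 * w x)%:E)%E.

Let mEFin (f : T -> R) : measurable_fun [set: T] f -> measurable_fun D (EFin \o f).
Proof. by move=> mf; apply/measurable_EFinP; exact: measurable_funTS. Qed.

Let mwn (f : T -> R) : measurable_fun [set: T] f ->
  measurable_fun [set: T] (fun x => f x ^+ 2 * w x).
Proof. by move=> mf; apply: measurable_funM => //; exact: measurable_funX. Qed.

(** The increments are at most [sqrt C * 2^-j], so the telescoping series converges absolutely. *)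
Lemma fast_cvg (u : R^nat) (C : R) :
  (forall j, 4 ^+ j * (u j.+1 - u j) ^+ 2 <= C) -> cvgn u.
Proof.
move=> Hu; have -> : u = (fun n => u 0%N + series (telescope u) n).
  by apply/funext => n; exact: eq_sum_telescope.
apply: is_cvgD; first exact: is_cvg_cst.
apply: normed_cvg; apply: (@series_le_cvg _ _ (geometric (Num.sqrt C) 2^-1)) => [n|n|n|].
- exact: normr_ge0.
- by rewrite /= mulr_ge0 ?sqrtr_ge0 ?exprn_ge0.
- rewrite /= -[leRHS]ger0_norm; last by rewrite mulr_ge0 ?sqrtr_ge0 ?exprn_ge0.
  have C0 : 0 <= C by apply: (le_trans _ (Hu 0%N)); rewrite mulr_ge0 ?w0 ?sqr_ge0 ?exprn_ge0.
  rewrite -ler_sqr ?nnegrE ?normr_ge0 // !real_normK ?num_real //.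
  rewrite exprMn sqr_sqrtr // -exprM mulnC exprM exprVn.
  have -> : (2 ^+ 2 : R) = 4 by ring.
  by rewrite exprVn ler_pdivlMr ?exprn_gt0 // mulrC; exact: Hu.
- by apply: is_cvg_geometric_series; rewrite ger0_norm // invf_lt1 // ltr1n.
Qed.

Lemma limn_einf_le (u : (\bar R)^nat) (e : \bar R) N :
  (forall n, (N <= n)%N -> u n <= e)%E -> (limn_einf u <= e)%E.
Proof.
move=> H; rewrite limn_einf_lim; apply: lime_le; first exact: is_cvg_einfs.
exists N => // n /= Nn; apply: le_trans (H _ Nn).
by apply: ereal_inf_lbound; exists n => /=.
Qed.

Lemma measurable_fun_limn_einf (f : nat -> T -> \bar R) :
  (forall n, measurable_fun D (f n)) ->
  measurable_fun D (fun x => limn_einf (f ^~ x)).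
Proof.
move=> mf.
have -> : (fun x => limn_einf (f ^~ x)) = (fun x => - limn_esup (fun n => - f n x))%E.
  apply/funext => x; rewrite -limn_einfN; congr limn_einf.
  by apply/funext => n /=; rewrite oppeK.
apply: measurableT_comp => //; apply: measurable_fun_limn_esup => n.
exact: measurableT_comp.
Qed.

(** Along a subsequence [h] with squared distances at most [8^-j], the sum of
    [4^j |h (j+1) - h j|^2 w] is integrable, hence finite almost everywhere; this forces pointwise
    convergence wherever [w] does not vanish. Fatou's lemma then gives convergence of the whole
    sequence. The second clause of the conclusion lets invariances common to all [f n], such as
    periodicity, pass to the limit. *)
Lemma riesz_fischer (f : nat -> T -> R) :
  (forall n, measurable_fun [set: T] (f n)) ->
  (forall e : R, 0 < e -> exists N, forall m n, (N <= m)%N -> (N <= n)%N ->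
     (wnorm2 (fun x => f m x - f n x)%R <= e%:E)%E) ->
  exists g : T -> R, [/\ measurable_fun [set: T] g,
    forall p q, (forall n, f n p = f n q) -> g p = g q &
    forall e : R, 0 < e -> exists N, forall n, (N <= n)%N ->
     (wnorm2 (fun x => f n x - g x)%R <= e%:E)%E].
Proof.
move=> mf cauchy.
have /choice[k0 Hk0] (j : nat) : exists N, forall m n, (N <= m)%N -> (N <= n)%N ->
     (wnorm2 (fun x => f m x - f n x)%R <= ((8^-1 : R) ^+ j)%:E)%E.
  by apply: cauchy; rewrite exprn_gt0.
(* Summing the thresholds makes the indices monotone while keeping [K j] above both [k0 j] and
   [j]. *)
pose K j := (\sum_(i < j.+1) (k0 i).+1)%N.
have Kk j : (k0 j <= K j)%N by rewrite /K big_ord_recr /= (leq_trans (leqnSn _)) // leq_addl.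
have KS j : (K j <= K j.+1)%N by rewrite /K [leqRHS]big_ord_recr /= leq_addr.
have Kj j : (j <= K j)%N.
  by elim: j => // j IH; rewrite /K big_ord_recr /= addnS ltnS (leq_trans IH) // leq_addr.
pose h j := f (K j).
have mh j : measurable_fun [set: T] (h j) by exact: mf.
(* The upper limit defines [g] at every point, also where nothing converges, from the values at that
   point alone. *)
pose g p := fine (limn_esup (fun j => (h j p)%:E)).
have mg : measurable_fun [set: T] g.
  apply: measurableT_comp => //; apply: measurable_fun_limn_esup => n.
  by apply/measurable_EFinP.
have gE p : cvgn (h ^~ p) -> (h ^~ p) @ \oo --> g p.
  move=> ch; have : (EFin \o (h ^~ p)) @ \oo --> (limn (h ^~ p))%:E.
    by apply: cvg_EFin ch; exact: nearW.
  by move=> /cvg_limn_einf_sup[_ E]; rewrite /g E.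
exists g; split => //.
  by move=> p q pq; rewrite /g; congr (fine (limn_esup _)); apply/funext => j; rewrite /h pq.
pose G j x := (4 ^+ j * (h j.+1 x - h j x) ^+ 2 * w x)%:E.
have mB i j : measurable_fun [set: T] (fun x => h i x - h j x) by exact: measurable_funB.
have mG j : measurable_fun D (G j).
  apply: mEFin; apply: measurable_funM => //; apply: measurable_funM => //.
  exact: measurable_funX.
have G0 j x : (0 <= G j x)%E.
  by rewrite lee_fin; do 2?apply: mulr_ge0; rewrite ?w0 ?sqr_ge0 ?exprn_ge0 ?ler0n.
have intG : mu.-integrable D (fun x => \sum_(j <oo) G j x)%E.
  apply/integrableP; split.
    by apply: ge0_emeasurable_sum => // *.
  under eq_integral => x _.
    rewrite gee0_abs; last by apply: nneseries_ge0.
    over.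
  rewrite integral_nneseries //.
  apply: (@le_lt_trans _ _ (\sum_(j <oo) (geometric 1 (2^-1) j)%:E)%E).
    apply: lee_nneseries => [i _ _|n _]; first exact: integral_ge0.
    rewrite /G; under eq_integral do rewrite -mulrA EFinM.
    rewrite ge0_integralZl //; first last.
    - by move=> x _; rewrite lee_fin mulr_ge0 ?w0 ?sqr_ge0.
    - exact/mEFin/mwn.
    apply: (@le_trans _ _ ((4 ^+ n)%:E * ((8^-1 : R) ^+ n)%:E)%E).
      apply: lee_pmul => //; rewrite ?lee_fin ?exprn_ge0 //.
        by apply: integral_ge0 => x _; rewrite lee_fin mulr_ge0 ?w0 ?sqr_ge0.
      by apply: Hk0; [exact: leq_trans (Kk n) (KS n)|exact: Kk].
    rewrite -EFinM lee_fin -exprMn /geometric /= mul1r.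
    by rewrite (_ : 4 * 8^-1 = 2^-1 :> R) //; field.
  have half : `|2^-1 : R| < 1 by rewrite ger0_norm // invf_lt1 // ltr1n.
  rewrite (_ : (fun n => _) = EFin \o series (geometric 1 2^-1)); last first.
    by apply/funext => n; rewrite /= seriesEnat -sumEFin.
  by rewrite EFin_lim ?ltry //; exact: is_cvg_geometric_series.
move=> e e0; have [N HN] := cauchy _ e0; exists N => n Nn.
have mfg (u : T -> R) : measurable_fun [set: T] u ->
    measurable_fun D (fun x => ((f n x - u x) ^+ 2 * w x)%:E).
  by move=> mu'; apply/mEFin/mwn/measurable_funB.
(* The squared distance is rewritten as the integral of a lower limit, the form in which Fatou's
   lemma applies. *)
have -> : wnorm2 (fun x => f n x - g x) =
    (\int[mu]_(x in D) limn_einf (fun j => ((f n x - h j x) ^+ 2 * w x)%:E))%E.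
  apply: ge0_ae_eq_integral => //.
  - exact: mfg.
  - by apply: measurable_fun_limn_einf => j; exact: mfg.
  - by move=> x _; rewrite lee_fin mulr_ge0 ?w0 ?sqr_ge0.
  - move=> x _; rewrite limn_einf_lim; apply: lime_ge; first exact: is_cvg_einfs.
    apply: nearW => k; apply: le_ereal_inf_tmp => _ [j _ <-].
    by rewrite lee_fin mulr_ge0 ?w0 ?sqr_ge0.
  have := integrable_ae mD intG; apply: filterS => x Hx Dx.
  apply/esym; apply: (cvg_limn_einf_sup _).1.
  (* Where the weight vanishes both sides are zero, whatever the subsequence does. *)
  have [wx|wx] := eqVneq (w x) 0.
    by rewrite wx mulr0; under eq_fun do rewrite mulr0; exact: cvg_cst.
  have ch : (h ^~ x) @ \oo --> g x.
    apply/gE/(@fast_cvg _ (fine (\sum_(j <oo) G j x)%E / w x)) => j.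
    rewrite ler_pdivlMr ?lt_def ?wx ?w0 // -lee_fin fineK; last exact: Hx.
    have := @nneseries_lim_ge R (G ^~ x) xpredT 0 j.+1 (fun n _ _ => G0 n x).
    by apply: le_trans; rewrite big_nat_recr //= leeDr // sume_ge0.
  have c : (fun j => (f n x - h j x) ^+ 2 * w x) @ \oo --> (f n x - g x) ^+ 2 * w x.
    apply: cvgM; last exact: cvg_cst.
    have dd : (fun j => f n x - h j x) @ \oo --> f n x - g x by exact: (cvgB (cvg_cst _) ch).
    exact: (cvgM dd dd).
  by apply: cvg_EFin c; exact: nearW.
apply: le_trans (fatou _ _ _ _) _ => //.
- by move=> j; exact: mfg.
- by move=> j x _; rewrite lee_fin mulr_ge0 ?w0 ?sqr_ge0.
apply: (@limn_einf_le _ _ N) => j Nj.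
by apply: HN => //; exact: leq_trans Nj (Kj j).
Qed.
End WeightedL2.

(** * L^2 of M as a complete real inner product space *)

Section L2Space.
Variable R : realType.
Let mR := measurableTypeR R.
Let mR3 := (mR * mR * mR)%type.
Variable w : R * R * R -> R.
Hypothesis mw : measurable_fun [set: mR3] (w : mR3 -> R).
Hypothesis w0 : forall x, 0 <= w x.
Implicit Types f g h : R * R * R -> R[i].

Definition lin (a : R) f g : R * R * R -> R[i] := fun p => Complex a 0 * f p + g p.

Definition rprod f g (p : R * R * R) : R :=
  (cRe f p * cRe g p + cIm f p * cIm g p) * w p.

(** This is the real part of [L2dot]; the imaginary part of [L2dot w f g] is the same form evaluated
    at [f] and [i g]. *)
Definition rdot f g : R := Rintegral (@leb3 R) (@cell R) (rprod f g).

Lemma measurable_cell : measurable (@cell R : set mR3).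
Proof.
have -> : @cell R = (`[0, 2 * pi] `*` setT) `*` `[0, 2 * pi].
  apply/seteqP; split => -[[x y] z] /=; rewrite /cell /xc /zc /= !in_itv /=.
    by move=> [].
  by move=> [[]].
by apply: measurableX => //; exact: measurableX.
Qed.

Lemma cRe_lin a f g p : cRe (lin a f g) p = a * cRe f p + cRe g p.
Proof. by rewrite /cRe /lin; case: (f p) (g p) => [x y] [x' y'] /=; rewrite mul0r subr0. Qed.

Lemma cIm_lin a f g p : cIm (lin a f g) p = a * cIm f p + cIm g p.
Proof. by rewrite /cIm /lin; case: (f p) (g p) => [x y] [x' y'] /=; rewrite mul0r addr0. Qed.

Lemma measurable_rprod f g : L2 w f -> L2 w g -> measurable_fun [set: mR3] (rprod f g).
Proof.
move=> [_ mf1 mf2 _] [_ mg1 mg2 _].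
by apply: measurable_funM => //; apply: measurable_funD; exact: measurable_funM.
Qed.

Let mEFin (u : mR3 -> R) : measurable_fun [set: mR3] u ->
  measurable_fun (@cell R : set mR3) (EFin \o u).
Proof. by move=> mu; apply/measurable_EFinP; exact: measurable_funTS. Qed.

Lemma rprod_ge0 f p : 0 <= rprod f f p.
Proof. by apply: mulr_ge0; rewrite ?w0 // -!expr2; apply: addr_ge0; rewrite sqr_ge0. Qed.

Lemma L2norm2_rprod f : L2norm2 w f = (\int[@leb3 R]_(p in @cell R) (rprod f f p)%:E)%E.
Proof. by apply: eq_integral => p _; rewrite /rprod !expr2. Qed.

Lemma integrable_rprod_self f : L2 w f ->
  (@leb3 R).-integrable (@cell R) (EFin \o rprod f f).
Proof.
move=> Lf; apply/integrableP; split; first by apply: mEFin; exact: measurable_rprod.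
have [_ _ _] := Lf; rewrite L2norm2_rprod; congr (_ < _)%E.
by apply: eq_integral => p _; rewrite gee0_abs // lee_fin rprod_ge0.
Qed.

Lemma integrable_rprod f g : L2 w f -> L2 w g ->
  (@leb3 R).-integrable (@cell R) (EFin \o rprod f g).
Proof.
move=> Lf Lg; have If := integrable_rprod_self Lf; have Ig := integrable_rprod_self Lg.
apply: (le_integrable measurable_cell _ _ (integrableD measurable_cell If Ig)).
  by apply: mEFin; exact: measurable_rprod.
move=> p _ /=; rewrite lee_fin [leRHS]ger0_norm; last by rewrite addr_ge0 ?rprod_ge0.
rewrite /rprod normrM (ger0_norm (w0 p)) -mulrDl ler_wpM2r // ler_norml.
move: (cRe f p) (cIm f p) (cRe g p) (cIm g p) => a b c d.
have := (sqr_ge0 (a + c), sqr_ge0 (b + d), sqr_ge0 (a - c), sqr_ge0 (b - d)).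
have := (sqr_ge0 a, sqr_ge0 b, sqr_ge0 c, sqr_ge0 d).
by move=> [[[h1 h2] h3] h4] [[[h5 h6] h7] h8]; apply/andP; split; lra.
Qed.

Lemma L2norm2E f : L2 w f -> L2norm2 w f = (rdot f f)%:E.
Proof.
move=> Lf; rewrite L2norm2_rprod /rdot /Rintegral fineK //.
by apply: integrable_fin_num; [exact: measurable_cell|exact: integrable_rprod_self].
Qed.

(** A domination principle: membership of linear combinations and of limits reduces to periodicity,
    measurability and a pointwise bound. *)
Lemma L2_of_le f g h : L2 w f -> L2 w g -> on_M h ->
  measurable_fun [set: mR3] (cRe h) -> measurable_fun [set: mR3] (cIm h) ->
  (exists C, forall p, cRe h p ^+ 2 + cIm h p ^+ 2 <= C *
     (cRe f p ^+ 2 + cIm f p ^+ 2 + (cRe g p ^+ 2 + cIm g p ^+ 2))) -> L2 w h.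
Proof.
move=> Lf Lg pM m1 m2 [C HC]; split => //.
have If := integrable_rprod_self Lf; have Ig := integrable_rprod_self Lg.
have /integrableP[_] := integrableZl measurable_cell C (integrableD measurable_cell If Ig).
apply: le_lt_trans; apply: ge0_le_integral => //.
- exact: measurable_cell.
- by move=> p _; rewrite lee_fin mulr_ge0 // addr_ge0 ?sqr_ge0.
- by apply: mEFin; apply: measurable_funM => //; apply: measurable_funD; exact: measurable_funX.
- apply: measurableT_comp => //; apply: measurable_funeM; apply: emeasurable_funD;
  by [case/integrableP : If|case/integrableP : Ig].
move=> p _ /=; rewrite lee_fin; apply: le_trans (ler_norm _).
by rewrite /rprod -mulrDl mulrA ler_wpM2r // -!expr2; exact: HC.
Qed.

Lemma L2_lin (c : R[i]) f g : L2 w f -> L2 w g -> L2 w (fun p => c * f p + g p).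
Proof.
move=> Lf Lg; have [fM mf1 mf2 _] := Lf; have [gM mg1 mg2 _] := Lg.
have rE p : cRe (fun p => c * f p + g p) p =
    complex.Re c * cRe f p - complex.Im c * cIm f p + cRe g p.
  by rewrite /cRe /cIm; clear; case: c (f p) (g p) => [? ?] [? ?] [? ?].
have iE p : cIm (fun p => c * f p + g p) p =
    complex.Re c * cIm f p + complex.Im c * cRe f p + cIm g p.
  by rewrite /cRe /cIm; clear; case: c (f p) (g p) => [? ?] [? ?] [? ?].
apply: (L2_of_le Lf Lg).
- by move=> x y z; rewrite (fM x y z).1 (gM x y z).1 (fM x y z).2 (gM x y z).2.
- rewrite (funext rE); apply: measurable_funD => //; apply: measurable_funB;
  exact: measurable_funM.
- rewrite (funext iE); apply: measurable_funD => //; apply: measurable_funD;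
  exact: measurable_funM.
set a := complex.Re c in rE iE; set b := complex.Im c in rE iE.
(* The constant comes from [|c f + g|^2 <= 2 |c|^2 |f|^2 + 2 |g|^2]. *)
exists (2 * (a ^+ 2 + b ^+ 2 + 1)) => p; rewrite rE iE.
move: (cRe f p) (cIm f p) (cRe g p) (cIm g p) => x y x' y'.
rewrite -subr_ge0.
have -> : 2 * (a ^+ 2 + b ^+ 2 + 1) * (x ^+ 2 + y ^+ 2 + (x' ^+ 2 + y' ^+ 2)) -
  ((a * x - b * y + x') ^+ 2 + (a * y + b * x + y') ^+ 2) =
  (a * x - b * y - x') ^+ 2 + (a * y + b * x - y') ^+ 2 + 2 * (x ^+ 2 + y ^+ 2) +
  2 * (a ^+ 2 + b ^+ 2) * (x' ^+ 2 + y' ^+ 2) by ring.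
by do 6?[exact: sqr_ge0 | exact: ler0n | apply: addr_ge0 | apply: mulr_ge0].
Qed.

Lemma L2_rlin a f g : L2 w f -> L2 w g -> L2 w (lin a f g).
Proof. exact: L2_lin. Qed.

Lemma rdotC f g : rdot f g = rdot g f.
Proof. by rewrite /rdot; apply: eq_Rintegral => p _; rewrite /rprod; ring. Qed.

Lemma rdot_lin a f g h : L2 w f -> L2 w g -> L2 w h ->
  rdot (lin a f g) h = a * rdot f h + rdot g h.
Proof.
move=> Lf Lg Lh; rewrite /rdot -RintegralZl ?integrable_rprod //; last exact: measurable_cell.
rewrite -RintegralD //.
- by apply: eq_Rintegral => p _; rewrite /rprod cRe_lin cIm_lin; ring.
- exact: measurable_cell.
- exact: (integrableZl measurable_cell a (integrable_rprod Lf Lh)).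
- exact: integrable_rprod.
Qed.

Lemma rdot_ge0 f : 0 <= rdot f f.
Proof. by apply: Rintegral_ge0 => p _; exact: rprod_ge0. Qed.

Lemma L2dist2E f g : L2 w f -> L2 w g -> L2dist2 w f g = (sqdist lin rdot f g)%:E.
Proof.
move=> Lf Lg; rewrite /sqdist -L2norm2E; last exact: L2_rlin.
rewrite /L2dist2; congr L2norm2; apply/funext => p; rewrite /lin.
by case: (f p) (g p) => [? ?] [? ?]; apply/eqP; rewrite eq_complex /=; apply/andP; split; apply/eqP; ring.
Qed.

Lemma L2dotE f g : L2dot w f g = Complex (rdot f g) (rdot f (fun p => Complex 0 1 * g p)).
Proof.
rewrite /L2dot; congr Complex; apply: eq_Rintegral => p _; rewrite /rprod /cRe /cIm;
  by case: (f p) (g p) => [x y] [x' y'] /=; ring.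
Qed.

Lemma cReB f g : cRe (fun p => f p - g p) = (fun p => cRe f p - cRe g p).
Proof. by apply/funext => p; rewrite /cRe; case: (f p) (g p) => [? ?] [? ?]. Qed.

Lemma cImB f g : cIm (fun p => f p - g p) = (fun p => cIm f p - cIm g p).
Proof. by apply/funext => p; rewrite /cIm; case: (f p) (g p) => [? ?] [? ?]. Qed.

Lemma L2norm2_split f : measurable_fun [set: mR3] (cRe f) ->
  measurable_fun [set: mR3] (cIm f) ->
  L2norm2 w f = (wnorm2 (@leb3 R) (@cell R) w (cRe f) +
                 wnorm2 (@leb3 R) (@cell R) w (cIm f))%E.
Proof.
move=> m1 m2; have mc := measurable_cell.
have part (u : mR3 -> R) : measurable_fun [set: mR3] u ->
    measurable_fun (@cell R : set mR3) (fun p => (u p ^+ 2 * w p)%:E).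
  by move=> mu; apply: mEFin; apply: measurable_funM => //; exact: measurable_funX.
have pos (u : mR3 -> R) p : (@cell R) p -> (0 <= (u p ^+ 2 * w p)%:E)%E.
  by move=> _; rewrite lee_fin mulr_ge0 ?w0 ?sqr_ge0.
rewrite /wnorm2 -(ge0_integralD _ mc (pos _) (part _ m1) (pos _) (part _ m2)).
by apply: eq_integral => p _; rewrite mulrDl EFinD.
Qed.

(** The norm only sees [cell], yet the limits of the real and imaginary parts are given on all of
    space by a pointwise recipe, so the periodicity of the sequence is inherited. *)
Lemma L2_complete (s : nat -> R * R * R -> R[i]) : (forall n, L2 w (s n)) ->
  (forall e, 0 < e -> exists N, forall m n, (N <= m)%N -> (N <= n)%N ->
     sqdist lin rdot (s m) (s n) <= e) ->
  exists g, L2 w g /\ lim_to lin rdot s g.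
Proof.
move=> Ls cauchy.
have step (c : (R * R * R -> R[i]) -> R * R * R -> R) : (c = @cRe R \/ c = @cIm R) ->
  exists g : mR3 -> R, [/\ measurable_fun [set: mR3] g,
    forall p q, (forall n, c (s n) p = c (s n) q) -> g p = g q &
    forall e : R, 0 < e -> exists N, forall n, (N <= n)%N ->
     (wnorm2 (@leb3 R) (@cell R) w (fun x => c (s n) x - g x)%R <= e%:E)%E].
  move=> cE; have mc n : measurable_fun [set: mR3] (c (s n)).
    by have [_ ? ? _] := Ls n; case: cE => ->.
  apply: riesz_fischer => //; first exact: measurable_cell.
  move=> e e0; have [N HN] := cauchy _ e0; exists N => m n Nm Nn.
  have := HN m n Nm Nn; rewrite -lee_fin -L2dist2E //; apply: le_trans.
  have [_ a1 a2 _] := Ls m; have [_ b1 b2 _] := Ls n.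
  rewrite /L2dist2 L2norm2_split ?cReB ?cImB; try exact: measurable_funB.
  have pos u : (0 <= wnorm2 (@leb3 R) (@cell R) w u)%E.
    by apply: integral_ge0 => p _; rewrite lee_fin mulr_ge0 ?w0 ?sqr_ge0.
  by case: cE => ->; [rewrite leeDl|rewrite leeDr].
have [g1 [mg1 pg1 cg1]] := step (@cRe R) (or_introl erefl).
have [g2 [mg2 pg2 cg2]] := step (@cIm R) (or_intror erefl).
pose g : R * R * R -> R[i] := fun p => Complex (g1 p) (g2 p).
pose r n : R * R * R -> R[i] := fun p => s n p - g p.
have rr n : cRe (r n) = (fun p => cRe (s n) p - g1 p) by rewrite /r cReB.
have ri n : cIm (r n) = (fun p => cIm (s n) p - g2 p) by rewrite /r cImB.
have mrr n : measurable_fun [set: mR3] (cRe (r n)).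
  by rewrite rr; apply: measurable_funB => //; have [] := Ls n.
have mri n : measurable_fun [set: mR3] (cIm (r n)).
  by rewrite ri; apply: measurable_funB => //; have [] := Ls n.
have gM : on_M g.
  have sM n := (let: And4 a _ _ _ := Ls n in a) : on_M (s n).
  move=> x y z; rewrite /g; split; congr Complex.
  - by apply: pg1 => n; rewrite /cRe (sM n x y z).1.
  - by apply: pg2 => n; rewrite /cIm (sM n x y z).1.
  - by apply: pg1 => n; rewrite /cRe (sM n x y z).2.
  - by apply: pg2 => n; rewrite /cIm (sM n x y z).2.
have nr e : 0 < e -> exists N, forall n, (N <= n)%N -> (L2norm2 w (r n) <= e%:E)%E.
  move=> e0; have e2 : 0 < e / 2 by rewrite divr_gt0.
  have [N1 H1] := cg1 _ e2; have [N2 H2] := cg2 _ e2; exists (maxn N1 N2) => n.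
  rewrite geq_max => /andP[/H1 h1 /H2 h2].
  by rewrite L2norm2_split // rr ri [e]splitr EFinD leeD.
have [N HN] := nr _ ltr01.
have Lr : L2 w (r N).
  split => //; last by apply: le_lt_trans (HN _ (leqnn N)) _; rewrite ltry.
  have [sM _ _ _] := Ls N.
  by move=> x y z; rewrite /r (sM x y z).1 (sM x y z).2 (gM x y z).1 (gM x y z).2.
(* [g] is the difference of [s N] and the remainder [r N], both in L^2, whence the factor [2]. *)
have Lg : L2 w g.
  apply: (L2_of_le (Ls N) Lr) => //; exists 2 => p; rewrite rr ri /g [cRe _ p]/= [cIm _ p]/=.
  rewrite {1}/cRe {1}/cIm /=; move: (cRe _ _) (cIm _ _) (g1 p) (g2 p) => a b c d.
  rewrite -subr_ge0.
  have -> : 2 * (a ^+ 2 + b ^+ 2 + ((a - c) ^+ 2 + (b - d) ^+ 2)) - (c ^+ 2 + d ^+ 2) =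
    (2 * a - c) ^+ 2 + (2 * b - d) ^+ 2 by ring.
  by rewrite addr_ge0 ?sqr_ge0.
exists g; split => //; apply/cvgrPdist_le => e e0.
have [N' HN'] := nr _ e0; exists N' => // n /= /HN'.
rewrite sub0r normrN ger0_norm ?rdot_ge0 // -lee_fin; apply: le_trans.
by rewrite -L2dist2E.
Qed.

End L2Space.

(** * Rules for directional derivatives *)

Section DerivativeRules.
Variable R : realType.

Lemma is_deriveP (V : normedModType R) (f : V -> R) (a v : V) (l : R) :
  is_derive a v f l <->
  (fun h => h^-1 *: (f (h *: v + a) - f a)) @ 0^' --> l.
Proof.
split=> [[df <-]|fl]; first exact: df.
by split; [apply/cvg_ex; exists l|apply: cvg_lim].
Qed.

(** Reduces a directional derivative to a derivative at [0] of a function of one real variable, for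
    which the library chain rule is available. *)
Lemma is_derive_line (V : normedModType R) (f : V -> R) (a v : V) (l : R) :
  is_derive a v f l <-> is_derive (0 : R) (1 : R) (fun h : R => f (h *: v + a)) l.
Proof.
rewrite !is_deriveP; have -> // : (fun h => h^-1 *: (f (h *: v + a) - f a)) =
  (fun h : R => h^-1 *: (f ((h *: (1 : R) + 0) *: v + a) - f (0 *: v + a))).
by apply/funext => h; rewrite scale0r add0r addr0 [h *: 1]mulr1.
Qed.

Lemma is_derive_chain1 (f g : R -> R) (x a b : R) :
  is_derive x 1 f a -> is_derive (f x) 1 g b ->
  is_derive x 1 (fun t => g (f t)) (b * a).
Proof.
move=> [df <-] [dg <-]; apply: DeriveDef.
  by apply/derivable1_diffP/(@differentiable_comp _ _ _ _ f g); exact/derivable1_diffP.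
by rewrite -!derive1E; exact: (derive1_comp df dg).
Qed.

Lemma is_derive_chain (V : normedModType R) (f : V -> R) (g : R -> R) (x v : V) (a b : R) :
  is_derive x v f a -> is_derive (f x) 1 g b ->
  is_derive x v (fun t => g (f t)) (b * a).
Proof.
move=> /is_derive_line df dg; apply/is_derive_line.
by apply: (is_derive_chain1 df); rewrite scale0r add0r.
Qed.

Lemma is_derive_mul (V : normedModType R) (f g : V -> R) (x v : V) (a b : R) :
  is_derive x v f a -> is_derive x v g b ->
  is_derive x v (fun t => f t * g t) (a * g x + f x * b).
Proof.
move=> df dg; have := is_deriveM df dg; rewrite addrC /= => h.
by apply: is_derive_eq h _; rewrite /GRing.scale /= mulrC.
Qed.

Lemma is_derive_add (V : normedModType R) (f g : V -> R) (x v : V) (a b : R) :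
  is_derive x v f a -> is_derive x v g b ->
  is_derive x v (fun t => f t + g t) (a + b).
Proof. exact: is_deriveD. Qed.

Lemma is_derive_const (V : normedModType R) (x v : V) (c : R) :
  is_derive x v (fun _ => c) 0.
Proof. exact: is_derive_cst. Qed.

Lemma is_derive_scale (V : normedModType R) (f : V -> R) (x v : V) (a c : R) :
  is_derive x v f a -> is_derive x v (fun t => c * f t) (c * a).
Proof. exact: is_deriveZ. Qed.

Lemma is_derive_pow (V : normedModType R) (f : V -> R) (x v : V) (a : R) n :
  is_derive x v f a -> is_derive x v (fun t => f t ^+ n) (n%:R * f x ^+ n.-1 * a).
Proof.
move=> df; elim: n => [|n IH]; first by rewrite !mul0r; exact: is_derive_const.
have := is_derive_mul df IH; under eq_fun do rewrite -exprS.
move=> h; apply: is_derive_eq h _; rewrite -natr1.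
by case: n {IH} => [|n] /=; rewrite ?exprS; ring.
Qed.

Lemma is_derive_affine (a b x : R) : is_derive x 1 (fun t => a * t + b) a.
Proof.
have := is_derive_add (is_derive_scale a (is_derive_id x (1 : R))) (is_derive_const x 1 b).
by move=> h; apply: is_derive_eq h _; rewrite mulr1 addr0.
Qed.

Lemma is_derive_inv (x : R) : x != 0 -> is_derive x 1 (fun t => t^-1) (- (x ^- 2)).
Proof.
move=> x0; have := is_deriveV x0 (is_derive_id x (1 : R)).
by move=> h; apply: is_derive_eq h _; rewrite /GRing.scale /= mulr1.
Qed.

Lemma is_derive_continuous (f : R -> R) (x a : R) :
  is_derive x 1 f a -> {for x, continuous f}.
Proof. by move=> [df _]; exact/differentiable_continuous/derivable1_diffP. Qed.

End DerivativeRules.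

(** * Smooth functions of one variable and bump functions *)

Section Smooth1.
Variable R : realType.
Implicit Types f g h : R -> R.

(** The derivative is supplied as a witness, so that closure under sums, products and affine
    substitution follows by induction from explicit formulas. *)
Fixpoint Cn1 (n : nat) (f : R -> R) : Prop :=
  if n is m.+1 then exists f' : R -> R, (forall x : R, is_derive x 1 f (f' x)) /\ Cn1 m f'
  else continuous f.

Definition smooth1 f := forall n, Cn1 n f.

Lemma Cn1_continuous n f : Cn1 n f -> continuous f.
Proof. by case: n => [//|n] [f' [df _]] x; exact: is_derive_continuous (df x). Qed.

Lemma Cn1W n f : Cn1 n.+1 f -> Cn1 n f.
Proof.
elim: n f => [|n IH] f; first exact: Cn1_continuous.
by move=> [f' [df /IH Cf']]; exists f'.
Qed.

Lemma smooth1_continuous f : smooth1 f -> continuous f.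
Proof. by move=> /(_ 0%N). Qed.

Lemma smooth1P f : smooth1 f <->
  exists f' : R -> R, (forall x : R, is_derive x 1 f (f' x)) /\ smooth1 f'.
Proof.
split=> [sf|[f' [df sf']] [|n]]; last by exists f'.
  have [f' [df _]] := sf 1%N; exists f'; split => // n.
  have [g' [dg Cg]] := sf n.+1; suff -> : f' = g' by [].
  by apply/funext => x; rewrite -(@derive_val _ _ _ _ _ _ _ (df x)) (@derive_val _ _ _ _ _ _ _ (dg x)).
by move=> x; exact: is_derive_continuous (df x).
Qed.

Lemma Cn1_cst n c : Cn1 n (fun=> c).
Proof.
elim: n c => [|n IH] c; first by move=> x; exact: cvg_cst.
by exists (fun=> 0); split => // x; exact: is_derive_const.
Qed.

Lemma Cn1D n f g : Cn1 n f -> Cn1 n g -> Cn1 n (fun t => f t + g t).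
Proof.
elim: n f g => [|n IH] f g; first by move=> cf cg x; apply: cvgD; [exact: cf|exact: cg].
move=> [f' [df Cf]] [g' [dg Cg]]; exists (fun t => f' t + g' t).
by split; [move=> x; exact: is_derive_add|exact: IH].
Qed.

Lemma Cn1M n f g : Cn1 n f -> Cn1 n g -> Cn1 n (fun t => f t * g t).
Proof.
elim: n f g => [|n IH] f g; first by move=> cf cg x; apply: cvgM; [exact: cf|exact: cg].
move=> Hf Hg; have [f' [df Cf]] := Hf; have [g' [dg Cg]] := Hg.
exists (fun t => f' t * g t + f t * g' t).
split; first by move=> x; exact: is_derive_mul.
by apply: Cn1D; apply: IH => //; exact: Cn1W.
Qed.

Lemma Cn1_affine n f a b : Cn1 n f -> Cn1 n (fun t => f (a * t + b)).
Proof.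
elim: n f => [|n IH] f.
  move=> cf x; apply: (@continuous_comp _ _ _ (fun t => a * t + b) f); last exact: cf.
  exact: is_derive_continuous (is_derive_affine a b x).
move=> [f' [df Cf]]; exists (fun t => f' (a * t + b) * a); split.
  by move=> x; apply: (is_derive_chain1 (is_derive_affine a b x)); exact: df.
by apply: Cn1M; [exact: IH|exact: Cn1_cst].
Qed.

Lemma smooth1_cst c : smooth1 (fun=> c). Proof. by move=> n; exact: Cn1_cst. Qed.

Lemma smooth1D f g : smooth1 f -> smooth1 g -> smooth1 (fun t => f t + g t).
Proof. by move=> sf sg n; apply: Cn1D. Qed.

Lemma smooth1M f g : smooth1 f -> smooth1 g -> smooth1 (fun t => f t * g t).
Proof. by move=> sf sg n; apply: Cn1M. Qed.

Lemma smooth1_id : smooth1 (fun t => t).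
Proof.
apply/smooth1P; exists (fun=> 1); split; last exact: smooth1_cst.
by move=> x; exact: is_derive_id.
Qed.

(** The functions [t^-m exp (-1/t)] extended by zero. Derivatives of members are linear combinations
    of members, so smoothness is proved for all [m] by a single induction. *)
Definition expinv (m : nat) (t : R) : R :=
  if 0 < t then (t^-1) ^+ m * expR (- t^-1) else 0.

(** Follows from [u^(m+2) <= (m+2)! exp u] at [u = 1/t]. A quadratic bound at the origin gives
    differentiability there with derivative zero. *)
Lemma expinv_le (m : nat) (t : R) : `|expinv m t| <= (m.+2)`!%:R * t ^+ 2.
Proof.
rewrite /expinv; case: ltP => [t0|_]; last by rewrite normr0 mulr_ge0 ?sqr_ge0.
have u0 : 0 < t^-1 by rewrite invr_gt0.
rewrite ger0_norm ?mulr_ge0 ?exprn_ge0 ?expR_ge0 ?(ltW u0) //.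
have := @expR_ge1Dxn R (t^-1) m.+1 (ltW u0).
have fp : 0 < (m.+2)`!%:R :> R by rewrite ltr0n fact_gt0.
move=> H; have {}H : (t^-1) ^+ m.+2 <= (m.+2)`!%:R * expR (t^-1).
  by rewrite mulrC -ler_pdivrMr //; apply: le_trans H; rewrite lerDr.
rewrite expRN ler_pdivrMr ?expR_gt0 // mulrAC.
apply: le_trans (_ : ((t^-1) ^+ m.+2) * t ^+ 2 <= _); last by rewrite ler_wpM2r ?sqr_ge0.
rewrite -addn2 exprD -mulrA -exprMn mulVf ?gt_eqF //.
by rewrite expr1n mulr1.
Qed.

Lemma is_derive_expinv m (x : R) : is_derive x 1 (expinv m)
  (- m%:R * expinv m.+1 x + expinv m.+2 x).
Proof.
have [x0|x0|->] := ltgtP x 0.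
- rewrite /expinv !ltNge (ltW x0) /= mulr0 addr0.
  apply: (near_eq_is_derive _ (is_derive_const x 1 0)).
  near=> t; rewrite ltNge ltW //; near: t; exact: lt_nbhsl.
- have xn : x != 0 by rewrite gt_eqF.
  have dV := is_derive_inv xn.
  have dX := is_derive_pow m dV.
  have dE := is_derive_chain1 (is_derive_scale (-1) dV) (is_derive_expR (-1 * x^-1)).
  apply: is_derive_eq (near_eq_is_derive _ (is_derive_mul dX dE)) _.
    near=> t; rewrite /expinv.
    have -> : 0 < t by near: t; exact: lt_nbhsr.
    by rewrite mulN1r.
  rewrite /expinv x0 mulN1r.
  case: m {dX} => [|m] /=; rewrite !exprS ?expr0; field.
  + by [].
  + by [].
apply/is_deriveP; rewrite /expinv ltxx mulr0 addr0.
apply/cvgrPdist_le => e e0; near=> h; rewrite sub0r normrN addr0 subr0 normrZ.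
have h0 : h != 0 by near: h; exact: nbhs_dnbhs_neq.
rewrite [h *: 1]mulr1 normfV ler_pdivrMl ?normr_gt0 //.
apply: le_trans (expinv_le m h) _.
rewrite -(real_normK (num_real h)) expr2 mulrCA ler_wpM2l // -ler_pdivlMl ?ltr0n ?fact_gt0 //.
near: h; apply: dnbhs0_le; rewrite mulr_gt0 // invr_gt0 ltr0n fact_gt0 //.
Unshelve. all: by end_near. Qed.

Lemma Cn1_expinv n m : Cn1 n (expinv m).
Proof.
elim: n m => [|n IH] m.
  by move=> x; exact: is_derive_continuous (is_derive_expinv m x).
exists (fun x => - m%:R * expinv m.+1 x + expinv m.+2 x); split.
  by move=> x; exact: is_derive_expinv.
by apply: Cn1D => //; apply: Cn1M => //; exact: Cn1_cst.
Qed.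

(** Here [n] is a sharpness parameter: these bumps take values in [[0, 1]], vanish outside []a, b[],
    and tend pointwise to the indicator of that interval as [n] grows. *)
Definition bump (a b : R) (n : nat) (t : R) : R :=
  expinv 0 (n%:R * t - n%:R * a) * expinv 0 (- n%:R * t + n%:R * b).

Lemma smooth1_bump a b n : smooth1 (bump a b n).
Proof. by move=> k; apply: Cn1M; apply: Cn1_affine; exact: Cn1_expinv. Qed.

Lemma expinv0_itv t : 0 <= expinv 0 t <= 1.
Proof.
rewrite /expinv expr0 mul1r; case: ltP => [t0|_]; last by rewrite lexx ler01.
by rewrite expR_ge0 -expR0 ler_expR oppr_le0 invr_ge0 ltW.
Qed.

Lemma bump_itv a b n t : 0 <= bump a b n t <= 1.
Proof.
have /andP[h1 h2] := expinv0_itv (n%:R * t - n%:R * a).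
have /andP[h3 h4] := expinv0_itv (- n%:R * t + n%:R * b).
by rewrite /bump mulr_ge0 // mulr_ile1.
Qed.

Lemma bump_out a b n t : t <= a \/ b <= t -> bump a b n t = 0.
Proof.
have n0 : 0 <= n%:R :> R by [].
rewrite /bump /expinv => -[h|h].
  by rewrite ltNge -mulrBr mulr_ge0_le0 ?subr_le0 // mul0r.
by rewrite [X in _ * X]ifF ?mulr0 // ltNge mulNr addrC -mulrBr mulr_ge0_le0 ?subr_le0.
Qed.

Lemma cvg_expinv0 u : 0 < u -> (fun n => expinv 0 (n%:R * u)) @ \oo --> (1 : R).
Proof.
move=> u0; apply/cvgrPdist_le => e e0; near=> n.
have n0 : 0 < n%:R :> R by near: n; exact: nbhs_infty_gtr.
have nu : 0 < n%:R * u by rewrite mulr_gt0.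
have /andP[_ le1] := expinv0_itv (n%:R * u).
rewrite ger0_norm ?subr_ge0 // /expinv nu expr0 mul1r.
have := @expR_ge1Dx R (- (n%:R * u)^-1).
suff : (n%:R * u)^-1 <= e by move: (_^-1) (expR _) => a b; lra.
rewrite invfM mulrC ler_pdivrMr // mulrC -ler_pdivrMr //.
by near: n; exact: nbhs_infty_ger.
Unshelve. all: by end_near. Qed.

Lemma cvg_bump a b t : a < t < b -> (fun n => bump a b n t) @ \oo --> (1 : R).
Proof.
move=> /andP[at' tb]; rewrite -[X in _ --> X]mulr1.
apply: cvgM.
  have := @cvg_expinv0 (t - a); rewrite subr_gt0 => /(_ at').
  by apply: cvg_trans; apply: near_eq_cvg; apply: nearW => n; rewrite mulrBr.
have := @cvg_expinv0 (b - t); rewrite subr_gt0 => /(_ tb).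
by apply: cvg_trans; apply: near_eq_cvg; apply: nearW => n; rewrite mulrBr mulNr addrC.
Qed.

End Smooth1.

(** * Integrals over segments and the fundamental lemma of the calculus of variations *)

Lemma Rintegral_dominated_cvg d (T : measurableType d) (R : realType)
    (mu : {measure set T -> \bar R}) (D : set T) (f_ : nat -> T -> R) (f g : T -> R) :
  measurable D -> (forall n, measurable_fun D (f_ n)) -> measurable_fun D f ->
  {ae mu, forall x, D x -> f_ ^~ x @ \oo --> f x} ->
  mu.-integrable D (EFin \o g) -> (forall n x, D x -> `|f_ n x| <= g x) ->
  (fun n => Rintegral mu D (f_ n)) @ \oo --> Rintegral mu D f.
Proof.
move=> mD mf_ mf ff ig fg.
have h1 : {ae mu, forall x, D x -> (fun n => (f_ n x)%:E) @ \oo --> (f x)%:E}.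
  by apply: filterS ff => x fx /fx h; apply: cvg_EFin h; exact: nearW.
have h2 : {ae mu, forall x n, D x -> (`|(f_ n x)%:E| <= (g x)%:E)%E}.
  by apply: aeW => x n Dx; rewrite lee_fin; exact: fg.
have mEf_ n : measurable_fun D (EFin \o f_ n) by exact/measurable_EFinP.
have mEf : measurable_fun D (EFin \o f) by exact/measurable_EFinP.
have [If _ H] := dominated_convergence mD mEf_ mEf h1 ig h2.
by apply: fine_cvg; rewrite fineK //; exact: integrable_fin_num.
Qed.

Section SegmentIntegrals.
Variable R : realType.
Local Notation mu := (@lebesgue_measure R).
Implicit Types (f g h : R -> R) (a b : R).

Lemma integrable_continuous f a b : continuous f -> mu.-integrable `[a, b] (EFin \o f).
Proof.
move=> cf; apply: continuous_compact_integrable; first exact: segment_compact.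
exact: continuous_subspaceT.
Qed.

Lemma continuous_bounded h a b : continuous h ->
  exists C, 0 <= C /\ forall x, x \in `[a, b] -> `|h x| <= C.
Proof.
move=> ch; have [ab|ba] := leP a b; last first.
  by exists 0; split => // x; rewrite in_itv /= => /andP[/le_trans H /H]; rewrite leNgt ba.
have [|c _ Hc] := @EVT_max R (fun x => `|h x|) a b ab.
  by apply: continuous_subspaceT => x; apply: cvg_norm; exact: ch.
by exists `|h c|; split.
Qed.

Lemma integrable_mul_continuous h f a b : continuous h ->
  mu.-integrable `[a, b] (EFin \o f) ->
  mu.-integrable `[a, b] (EFin \o (fun x => h x * f x)).
Proof.
move=> ch If; have [C [C0 HC]] := continuous_bounded a b ch.
have mI : measurable (`[a, b]%classic : set (measurableTypeR R)) by exact: measurable_itv.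
apply: (le_integrable mI _ _ (integrableZl mI C If)).
  apply/measurable_EFinP/measurable_funM.
    by apply: measurable_funTS; exact: continuous_measurable_fun.
  by case/integrableP : If => /measurable_EFinP.
move=> x xab /=; rewrite lee_fin !normrM ler_wpM2r // (ger0_norm C0).
by apply: HC.
Qed.

Lemma integrable_itvS f a b c d : a <= c -> d <= b ->
  mu.-integrable `[a, b] (EFin \o f) -> mu.-integrable `[c, d] (EFin \o f).
Proof.
move=> ac db; apply: integrableS => // x; rewrite /= !in_itv /= => /andP[cx xd].
by rewrite (le_trans ac) // (le_trans xd).
Qed.

Definition test1 (a b : R) f := smooth1 f /\
  exists c d, [/\ a < c, d < b & forall t, t <= c \/ d <= t -> f t = 0].

Lemma test1_bump a b c d n : a < c -> d < b -> test1 a b (bump c d n).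
Proof.
move=> ac db; split; first exact: smooth1_bump.
by exists c, d; split => // t; exact: bump_out.
Qed.

Lemma Rintegral_bump_cvg f a b c d : a < c -> d < b ->
  mu.-integrable `[a, b] (EFin \o f) ->
  (fun n => \int[mu]_(x in `[a, b]) (bump c d n x * f x)) @ \oo -->
  \int[mu]_(x in `]c, d[) f x.
Proof.
move=> ac db If.
have mI : measurable (`[a, b]%classic : set (measurableTypeR R)) by exact: measurable_itv.
have mf : measurable_fun `[a, b] f by case/integrableP : If => /measurable_EFinP.
have sub : `]c, d[ `<=` `[a, b].
  move=> x; rewrite /= !in_itv /= => /andP[cx xd].
  by rewrite !ltW // ?(lt_trans ac) // (lt_trans xd).
have -> : \int[mu]_(x in `]c, d[) f x = \int[mu]_(x in `[a, b]) (f \_ `]c, d[) x.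
  by rewrite -Rintegral_mkcondr setIidr.
apply: (@Rintegral_dominated_cvg _ _ _ mu `[a, b] (fun n x => bump c d n x * f x)
  (f \_ `]c, d[) (fun x => `|f x|)) => //.
- move=> n; apply: measurable_funM => //; apply: measurable_funTS.
  by apply: continuous_measurable_fun; apply: smooth1_continuous; exact: smooth1_bump.
- by apply/measurable_restrict => //; apply: measurable_funS mf.
- apply: aeW => x _; rewrite patchE; case: ifPn => [|].
    rewrite inE /= in_itv /= => xcd; rewrite -[X in _ --> X]mul1r.
    by apply: cvgM; [exact: cvg_bump|exact: cvg_cst].
  rewrite notin_setE /= in_itv /= => /negP; rewrite negb_and -!leNgt => xcd.
  rewrite (_ : (fun n => _) = fun=> 0); first exact: cvg_cst.
  by apply/funext => n; rewrite bump_out ?mul0r //; case/orP : xcd; [left|right].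
- exact: integrable_norm.
- move=> n x _; rewrite normrM ler_piMl //.
  by have /andP[b0 b1] := bump_itv c d n x; rewrite ger0_norm.
Qed.

(** At almost every [x], [f x] is the derivative of the integral of [f] from [a] to [x] by
    Lebesgue's theorem, and near an interior point this integral is constant. *)
Lemma ae_eq0_of_itv f a b : mu.-integrable `[a, b] (EFin \o f) ->
  (forall c d, a < c -> d < b -> \int[mu]_(x in `]c, d[) f x = 0) ->
  {ae mu, forall x, x \in `[a, b] -> f x = 0}.
Proof.
move=> If H.
have mI : measurable (`[a, b]%classic : set (measurableTypeR R)) by exact: measurable_itv.
pose h := f \_ `[a, b].
have Ih y : mu.-integrable [set` Interval (BLeft a) (BRight y)] (EFin \o h).
  apply: (@integrableS _ _ _ _ setT) => //.
  by have /(integrable_mkcond _ mI) := If; rewrite restrict_EFin.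
have nset1 (c : R) : {ae mu, forall x : R, x != c}.
  exists [set c]; split=> //; first exact: lebesgue_measure_set1.
  by move=> x /= /negP; rewrite negbK => /eqP.
have ae_filter := ae_filter_ringOfSetsType mu.
have FT : {ae mu, forall x, a < x -> derivable (fun y => \int[mu]_(t in `[a, y]) h t) x 1 /\
    derive1 (fun y => \int[mu]_(t in `[a, y]) h t) x = h x}.
  by apply: filterS (FTC1 Ih (integrable_locally mI If)) => x; apply.
near=> x => xab.
have FTx : a < x -> derivable (fun y => \int[mu]_(t in `[a, y]) h t) x 1 /\
    derive1 (fun y => \int[mu]_(t in `[a, y]) h t) x = h x by near: x; exact: FT.
have xa : x != a by near: x; exact: nset1.
have xb : x != b by near: x; exact: nset1.
have /andP[ax bx] : (a < x) && (x < b).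
  by move: xab; rewrite in_itv /= !lt_neqAle (eq_sym a) xa xb.
have [] := FTx ax.
move=> _.
have -> : h x = f x by rewrite /h patchE mem_set.
(* The hypothesis covers only intervals starting strictly to the right of [a], so the primitive is
   compared with its value at an intermediate point. *)
pose c := (a + x) / 2.
have ac : a < c by rewrite /c; lra.
have cx : c < x by rewrite /c; lra.
set F := (fun y : R => _) => <-.
pose k := \int[mu]_(t in `[a, c]) h t.
have Fk : \near x, F x = cst k x.
  near=> y; have cy : c < y by near: y; exact: lt_nbhsr.
  have yb : y < b by near: y; exact: lt_nbhsl.
  apply/eqP; rewrite -subr_eq0 /F /k (Rintegral_itvB (Ih y)) ?bnd_simp ?(ltW ac) ?(ltW cy) //.
  rewrite -Rintegral_itv_bndo_bndc; last first.
    by apply: integrableS (Ih y) => // t; rewrite /= !in_itv /= => /andP[ct ty]; rewrite !ltW // (lt_trans ac).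
  rewrite -(H c y ac yb); apply/eqP; apply: eq_Rintegral => t; rewrite inE /= in_itv /= => /andP[ct ty].
  by rewrite /h patchE mem_set //= in_itv /= !ltW // ?(lt_trans ac) // (lt_trans ty).
by rewrite derive1E (near_eq_derive (1 : R) Fk) derive_cst.
Unshelve. all: by end_near. Qed.

(** Integrals of [f] against bumps converge to integrals of [f] over subintervals, which therefore
    vanish. *)
Lemma ae_eq0_of_test f a b : mu.-integrable `[a, b] (EFin \o f) ->
  (forall z, test1 a b z -> \int[mu]_(x in `[a, b]) (z x * f x) = 0) ->
  {ae mu, forall x, x \in `[a, b] -> f x = 0}.
Proof.
move=> If H; apply: ae_eq0_of_itv => // c d ac db.
have := Rintegral_bump_cvg ac db If.
have -> : (fun n => \int[mu]_(x in `[a, b]) (bump c d n x * f x)) = (fun=> 0).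
  by apply/funext => n; apply: H; exact: test1_bump.
by move=> /cvg_lim <- //; rewrite lim_cst.
Qed.

End SegmentIntegrals.

(** * Weak differentiation in one variable and the monotonicity of solutions *)

Lemma integral_EFin_Rintegral d (T : measurableType d) (R : realType)
    (mu : {measure set T -> \bar R}) (D : set T) (f : T -> R) :
  measurable D -> mu.-integrable D (EFin \o f) ->
  (\int[mu]_(x in D) (f x)%:E)%E = (Rintegral mu D f)%:E.
Proof. by move=> mD If; rewrite /Rintegral fineK //; exact: (integrable_fin_num mD If). Qed.

Section WeakODE.
Variable R : realType.
Local Notation mu := (@lebesgue_measure R).
Implicit Types (f g h : R -> R) (a b : R).

Let mitv a b : measurable (`[a, b]%classic : set (measurableTypeR R)).
Proof. exact: measurable_itv. Qed.

(** An integration by parts in which [g] is merely integrable: by Fubini both sides equal the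
    integral of [F t * g y] over the triangle [a <= t <= y <= b]. *)
Lemma Rintegral_triangle F g a b : continuous F ->
  mu.-integrable `[a, b] (EFin \o g) ->
  \int[mu]_(y in `[a, b]) ((\int[mu]_(t in `[a, y]) F t) * g y) =
  \int[mu]_(t in `[a, b]) (F t * (\int[mu]_(y in `[a, b]) g y - \int[mu]_(y in `[a, t]) g y)).
Proof.
move=> cF Ig.
have [C [C0 HC]] := continuous_bounded a b cF.
pose T := measurableTypeR R.
pose gt : T -> R := g \_ `[a, b].
pose Ft : T -> R := F \_ `[a, b].
have mg : measurable_fun [set: T] gt.
  by apply/(measurable_restrictT _ (mitv a b)); case/integrableP : Ig => /measurable_EFinP.
have mF : measurable_fun [set: T] Ft.
  apply/(measurable_restrictT _ (mitv a b)); apply: measurable_funTS.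
  exact: continuous_measurable_fun.
pose k (p : T * T) : R := if p.2 <= p.1 then gt p.1 * Ft p.2 else 0.
have mk : measurable_fun [set: T * T] (EFin \o k).
  apply/measurable_EFinP; apply: measurable_fun_ifT => //.
    by apply: measurable_fun_ler; [exact: measurable_snd|exact: measurable_fst].
  apply: measurable_funM; first exact: (measurableT_comp mg measurable_fst).
  exact: (measurableT_comp mF measurable_snd).
have gtE y : y \in `[a, b] -> gt y = g y by move=> yab; rewrite /gt patchE mem_set.
have FtE y : y \in `[a, b] -> Ft y = F y by move=> yab; rewrite /Ft patchE mem_set.
have gt0 y : y \notin `[a, b] -> gt y = 0.
  by move=> yab; rewrite /gt patchE memNset //; exact/negP.
have Ft0 y : y \notin `[a, b] -> Ft y = 0.
  by move=> yab; rewrite /Ft patchE memNset //; exact/negP.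
have Ik : (mu \x mu)%E.-integrable [set: T * T] (EFin \o k).
  apply: (integrable12ltyP mu mu mk).2.
  (* [M] bounds the integral of [|F|] over the segment, so [M |g y|] dominates the inner integrals
     and Tonelli yields integrability in the plane. *)
  pose M := C * fine (mu `[a, b]).
  have muI : mu `[a, b] \is a fin_num by rewrite lebesgue_measure_itv /=; case: ifP.
  have mMg : measurable_fun [set: T] (fun y => (M * `|gt y|)%:E).
    apply/measurable_EFinP; apply: measurable_funM => //.
    exact: measurableT_comp.
  apply: (@le_lt_trans _ _ (\int[mu]_y (M * `|gt y|)%:E)%E).
    apply: ge0_le_integral => //.
    - by move=> y _; exact: integral_ge0.
    - apply: (measurable_fun_fubini_tonelli_F (abse \o (EFin \o k)));
        by [exact: measurableT_comp|move=> x; exact: abse_ge0].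
    move=> y _; rewrite /M mulrAC EFinM fineK // -integral_cst // integral_mkcond.
    apply: ge0_le_integral => //.
    - apply/measurable_EFinP; apply: measurableT_comp => //.
      by apply/measurable_EFinP; exact: (measurableT_comp mk (pair1_measurable y)).
    - by apply/(measurable_restrictT _ (mitv a b)).
    move=> t _; rewrite patchE; case: ifPn => [|] tab; rewrite /k /=.
      case: ifP => _; last by rewrite normr0 lee_fin mulr_ge0.
      rewrite lee_fin normrM mulrC ler_wpM2r // FtE; last exact: (set_mem tab).
      exact: HC (set_mem tab).
    by rewrite Ft0 ?mulr0 ?if_same ?normr0 //; apply: contraNN tab => tab; exact: mem_set.
  have Igt : mu.-integrable [set: T] (EFin \o gt).
    by have /(integrable_mkcond _ (mitv a b)) := Ig; rewrite restrict_EFin.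
  have /integrableP[ms] := integrableZl measurableT M (integrable_norm Igt).
  apply: le_lt_trans; apply: ge0_le_integral => //.
  - by move=> y _; rewrite lee_fin mulr_ge0 // mulr_ge0 ?fine_ge0.
  all: try by [exact: measurableT_comp ms|exact: mMg].
  by move=> y _; rewrite lee_fin ler_norm.
have HL y : (\int[mu]_t (k (y, t))%:E)%E =
    (((fun y => (\int[mu]_(t in `[a, y]) F t) * g y) \_ `[a, b]) y)%:E.
  rewrite patchE; have [yab|yab] := boolP (y \in `[a, b]); last first.
    rewrite memNset; last exact/negP.
    by rewrite integral0_eq // => t _; rewrite /k /= gt0 ?mul0r ?if_same.
  rewrite mem_set // -RintegralZr //; last exact: integrable_continuous.
  rewrite -integral_EFin_Rintegral //; last first.
    have := @integrable_continuous _ (fun t => F t * g y) a y; apply.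
    by move=> x; apply: cvgM; [exact: cF|exact: cvg_cst].
  rewrite [RHS]integral_mkcond; apply: eq_integral => t _.
  rewrite patchE; have [tay|tay] := boolP (t \in `[a, y]).
    rewrite mem_set // /k /=; move: tay yab; rewrite !in_itv /= => /andP[at' ty] /andP[ay yb].
    by rewrite ty gtE ?FtE ?in_itv /= ?ay ?at' ?(le_trans ty) // mulrC.
  rewrite memNset; last exact/negP.
  rewrite /k /=; case: ifP => // ty; rewrite Ft0 ?mulr0 //.
  by apply: contraNN tay; rewrite !in_itv /= ty andbT => /andP[].
have HR t : (\int[mu]_y (k (y, t))%:E)%E =
    (((fun t => F t * (\int[mu]_(y in `[a, b]) g y - \int[mu]_(y in `[a, t]) g y)) \_ `[a, b]) t)%:E.
  rewrite patchE; have [tab|tab] := boolP (t \in `[a, b]); last first.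
    rewrite memNset; last exact/negP.
    by rewrite integral0_eq // => y _; rewrite /k /= Ft0 ?mulr0 ?if_same.
  have /andP[at' tb] : a <= t <= b by rewrite in_itv in tab.
  rewrite mem_set // (Rintegral_itvB Ig) ?bnd_simp // Rintegral_itv_obnd_cbnd; last first.
    apply: integrableS Ig => // y; rewrite /= !in_itv /= => /andP[ty yb].
    by rewrite yb andbT (le_trans at') // ltW.
  have Igt : mu.-integrable `[t, b] (EFin \o g) by exact: integrable_itvS Ig.
  rewrite -RintegralZl // -integral_EFin_Rintegral //; last first.
    exact: (integrableZl (mitv t b) (F t) Igt).
  rewrite [RHS]integral_mkcond; apply: eq_integral => y _.
  rewrite patchE; have [ytb|ytb] := boolP (y \in `[t, b]).
    rewrite mem_set // /k /=; move: ytb; rewrite in_itv /= => /andP[ty yb].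
    by rewrite ty gtE ?FtE ?in_itv /= ?(le_trans at') ?at' // mulrC.
  rewrite memNset; last exact/negP.
  rewrite /k /=; case: ifP => // ty; rewrite gt0 ?mul0r //.
  by apply: contraNN ytb; rewrite !in_itv /= ty => /andP[].
have := Fubini Ik; rewrite /fubini_F /fubini_G /=.
under eq_integral do rewrite HL; under [RHS]eq_integral do rewrite HR.
move=> /(congr1 fine) H; rewrite Rintegral_mkcond [RHS]Rintegral_mkcond; exact: H.
Qed.

Lemma test1_primitive (p k : R -> R) a b : smooth1 p -> test1 a b k ->
  \int[mu]_(t in `[a, b]) (p t * k t) = 0 ->
  test1 a b (fun y => \int[mu]_(t in `[a, y]) (p t * k t)) /\
  (forall y : R, is_derive y 1 (fun y => \int[mu]_(t in `[a, y]) (p t * k t)) (p y * k y)).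
Proof.
move=> sp [sk [c [d [ac db kz]]]] int0.
pose F t := p t * k t.
have sF : smooth1 F by exact: smooth1M.
have cF : continuous F by exact: smooth1_continuous.
have Fz t : t <= c \/ d <= t -> F t = 0 by move=> h; rewrite /F kz // mulr0.
have etal y : y <= c -> \int[mu]_(t in `[a, y]) F t = 0.
  move=> yc; rewrite (_ : Rintegral _ _ _ = \int[mu]_(t in `[a, y]) (cst 0) t).
    by rewrite Rintegral_cst // mul0r.
  apply: eq_Rintegral => t; rewrite inE /= in_itv /= => /andP[_ ty].
  by rewrite Fz //; left; exact: le_trans yc.
have etar y : d <= y -> \int[mu]_(t in `[a, y]) F t = 0.
  move=> dy; rewrite -int0 Rintegral_mkcond [RHS]Rintegral_mkcond.
  congr (Rintegral _ _ _); apply/funext => t; rewrite !patchE.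
  have [td|dt] := ltP t d; last by rewrite -/(F t) Fz; [rewrite !if_same|right].
  congr (if _ then _ else _); apply/idP/idP => /set_mem /=; rewrite in_itv /= => /andP[at' _];
  apply: mem_set => /=; rewrite in_itv /= at' /=; apply/ltW/(lt_le_trans td) => //.
  exact: ltW.
have deta (y : R) : is_derive y 1 (fun y => \int[mu]_(t in `[a, y]) F t) (F y).
  have [yc|cy] := ltP y c.
    rewrite Fz; last by left; exact: ltW.
    apply: (near_eq_is_derive _ (is_derive_const y 1 0)).
    by near=> t; rewrite etal //; apply/ltW; near: t; exact: lt_nbhsl.
  have [] := @continuous_FTC1_closed R F a y (y + 1) _ (integrable_continuous a (y + 1) cF) _ (cF y).
  - by rewrite ltrDl.
  - exact: lt_le_trans cy.
  by move=> dF E; split; [exact: dF|rewrite -derive1E E].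
split => //; split.
  by apply/smooth1P; exists F.
by exists c, d; split => // t [/etal|/etar].
Unshelve. all: by end_near. Qed.

Lemma integrable_within h a b : {within `[a, b], continuous h} ->
  mu.-integrable `[a, b] (EFin \o h).
Proof. by move=> ch; apply: continuous_compact_integrable => //; exact: segment_compact. Qed.

Lemma within_mul f h a b : {within `[a, b], continuous f} -> {within `[a, b], continuous h} ->
  {within `[a, b], continuous (fun t => f t * h t)}.
Proof.
move=> /subspace_continuousP cf /subspace_continuousP ch.
by apply/subspace_continuousP => x xab; exact: (cvgM (cf x xab) (ch x xab)).
Qed.

Lemma within_primitive g a b : a <= b -> mu.-integrable `[a, b] (EFin \o g) ->
  {within `[a, b], continuous (fun t => \int[mu]_(y in `[a, t]) g y)}.
Proof. exact: parameterized_integral_continuous. Qed.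

(* A linear functional on test functions which is known on the primitives of
   [p k] is known up to one constant. *)
Lemma dubois_reymond (p g : R -> R) (Lam : (R -> R) -> R) a b : a < b ->
  smooth1 p -> (forall t, t \in `[a, b] -> 0 < p t) ->
  mu.-integrable `[a, b] (EFin \o g) ->
  (forall c k l, test1 a b k -> test1 a b l ->
     Lam (fun t => k t + c * l t) = Lam k + c * Lam l) ->
  (forall k, test1 a b k -> \int[mu]_(t in `[a, b]) (p t * k t) = 0 ->
     Lam k = \int[mu]_(y in `[a, b]) ((\int[mu]_(t in `[a, y]) (p t * k t)) * g y)) ->
  exists c, forall k, test1 a b k ->
    Lam k = \int[mu]_(t in `[a, b]) (p t * k t * (c - \int[mu]_(y in `[a, t]) g y)).
Proof.
move=> ab sp p0 Ig linL HL.
pose G t := \int[mu]_(y in `[a, t]) g y.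
have cG := within_primitive (ltW ab) Ig.
have cp : continuous p by exact: smooth1_continuous.
have ck k : test1 a b k -> continuous k by move=> [sk _]; exact: smooth1_continuous.
have Ipk k : test1 a b k -> mu.-integrable `[a, b] (EFin \o (fun t => p t * k t)).
  by move=> tk; apply: integrable_continuous => x; apply: cvgM; [exact: cp|exact: ck].
have IpkG k : test1 a b k -> mu.-integrable `[a, b] (EFin \o (fun t => p t * k t * G t)).
  move=> tk; apply/integrable_within/within_mul => //.
  by apply: continuous_subspaceT => x; apply: cvgM; [exact: cp|exact: ck].
(* A test function of nonzero weighted mass, used for normalization. If there were none, [p] would
   vanish almost everywhere on a segment where it is positive. *)
have [B [tB m0]] : exists B, test1 a b B /\ \int[mu]_(t in `[a, b]) (p t * B t) != 0.
  apply: contrapT => H.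
  have Hz z : test1 a b z -> \int[mu]_(x in `[a, b]) (z x * p x) = 0.
    move=> tz; apply: contrapT => /eqP h; apply: H; exists z; split => //.
    by under eq_Rintegral do rewrite mulrC.
  have [A [mA A0 Asub]] := ae_eq0_of_test (integrable_continuous a b cp) Hz.
  have : (mu `[a, b] <= mu A)%E.
    apply: le_measure; [exact: mem_set (mitv a b)|exact: mem_set|].
    apply: subset_trans Asub => x xab /= h; have := h xab; have := p0 x xab.
    by move=> + E; rewrite E ltxx.
  rewrite A0 lebesgue_measure_itv /= lte_fin ab -EFinB lee_fin; lra.
set m := Rintegral _ _ _ in m0.
pose S k := \int[mu]_(t in `[a, b]) (p t * k t).
pose SG k := \int[mu]_(t in `[a, b]) (p t * k t * G t).
have lin_int (u v : R -> R) c : mu.-integrable `[a, b] (EFin \o u) ->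
    mu.-integrable `[a, b] (EFin \o v) ->
    \int[mu]_(t in `[a, b]) (u t + c * v t) =
    \int[mu]_(t in `[a, b]) u t + c * \int[mu]_(t in `[a, b]) v t.
  move=> Iu Iv; rewrite RintegralD //; first by rewrite RintegralZl.
  exact: (integrableZl (mitv a b) c Iv).
(* The constant is forced by evaluating the desired formula at [B]. *)
exists ((Lam B + SG B) / m) => k tk.
(* Subtracting the right multiple of [B] makes the weighted mass zero, so that [HL] applies to
   [k0]. *)
pose c := - S k / m; pose k0 t := k t + c * B t.
have tk0 : test1 a b k0.
  have [sk [c1 [d1 [ac1 d1b kz]]]] := tk; have [sB [c2 [d2 [ac2 d2b Bz]]]] := tB.
  split; first by apply: smooth1D => //; apply: smooth1M => //; exact: smooth1_cst.
  exists (Num.min c1 c2), (Num.max d1 d2); split.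
  - by rewrite lt_min ac1.
  - by rewrite gt_max d1b.
  move=> t h; rewrite /k0 kz ?Bz ?mulr0 ?addr0 //; case: h; rewrite ?le_min ?ge_max => /andP[]; tauto.
have Sk0 : S k0 = 0.
  rewrite /S; under eq_Rintegral do rewrite mulrDr mulrCA.
  by rewrite lin_int ?Ipk // -/(S k) -/m /c; field.
have Sg0 : SG k0 = SG k + c * SG B.
  rewrite /SG -lin_int ?IpkG //; apply: eq_Rintegral => t _; rewrite /k0; ring.
have := HL _ tk0 Sk0.
rewrite linL // (@Rintegral_triangle (fun t => p t * k0 t)) //; last first.
  by move=> x; apply: cvgM; [exact: cp|exact: ck].
have -> : \int[mu]_(t in `[a, b]) (p t * k0 t * (\int[mu]_(y in `[a, b]) g y - \int[mu]_(y in `[a, t]) g y))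
    = - SG k0.
  have := lin_int (fun t => p t * k0 t * G b) (fun t => p t * k0 t * G t) (-1) _ (IpkG _ tk0).
  rewrite RintegralZr ?Ipk // -/(S k0) Sk0 mul0r add0r mulN1r => <-.
    by apply: eq_Rintegral => t _; rewrite /G; ring.
  by apply: integrable_continuous => x; apply: cvgM; [apply: cvgM; [exact: cp|exact: ck]|exact: cvg_cst].
rewrite Sg0 => H.
have -> : \int[mu]_(t in `[a, b]) (p t * k t * ((Lam B + SG B) / m - \int[mu]_(y in `[a, t]) g y))
    = S k * ((Lam B + SG B) / m) - SG k.
  have := lin_int (fun t => p t * k t * ((Lam B + SG B) / m)) (fun t => p t * k t * G t) (-1) _ (IpkG _ tk).
  rewrite RintegralZr ?Ipk // -/(S k) mulN1r => <-.
    by apply: eq_Rintegral => t _; rewrite /G; ring.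
  by apply: integrable_continuous => x; apply: cvgM; [apply: cvgM; [exact: cp|exact: ck]|exact: cvg_cst].
have -> : Lam k = - (SG k + c * SG B) - c * Lam B by rewrite -H; ring.
by rewrite /c; field.
Qed.

(* Solutions of [(phi' / p)' = m phi] with [p, m >= 0]: the product [- phi K]
   is nondecreasing, so [phi ^+ 2] can only decrease on one side of [y0]. *)
Lemma ode_alternative (p m Phi K : R -> R) a b y0 :
  (forall y, a < y < b -> [/\ 0 <= p y, 0 <= m y,
     is_derive y 1 Phi (- (p y * K y)) & is_derive y 1 K (- (m y * Phi y))]) ->
  a < y0 < b ->
  (forall y, y0 <= y < b -> `|Phi y0| <= `|Phi y|) \/
  (forall y, a < y <= y0 -> `|Phi y0| <= `|Phi y|).
Proof.
move=> H y0ab.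
pose J y := - (Phi y * K y).
have dJ y : a < y < b -> is_derive y 1 J (p y * K y ^+ 2 + m y * Phi y ^+ 2).
  move=> /H[_ _ dP dK]; have := is_derive_scale (-1) (is_derive_mul dP dK).
  under eq_fun do rewrite mulN1r.
  by move=> h; apply: is_derive_eq h _; ring.
have dS y : a < y < b -> is_derive y 1 (fun y => Phi y ^+ 2) (2 * p y * J y).
  move=> /H[_ _ dP _]; apply: is_derive_eq (is_derive_pow 2 dP) _.
  by rewrite /J /= expr1; ring.
have mono (f df : R -> R) x y : a < x -> x <= y -> y < b ->
    (forall t, a < t < b -> is_derive t 1 f (df t)) ->
    (forall t, x <= t <= y -> 0 <= df t) -> f x <= f y.
  move=> ax xy yb dfE df0.
  have [||c cxy E] := @MVT_segment R f df x y xy.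
  - move=> t; rewrite in_itv /= => /andP[xt ty]; apply: dfE.
    by rewrite (lt_trans ax) //= (lt_trans ty).
  - apply: derivable_within_continuous => t; rewrite in_itv /= => /andP[xt ty].
    by apply: (@ex_derive _ _ _ _ _ _ _ (dfE t _)); rewrite (lt_le_trans ax) //= (le_lt_trans ty).
  rewrite -subr_ge0 E mulr_ge0 ?subr_ge0 //; apply: df0.
  by move: cxy; rewrite in_itv.
have sq (u v : R) : u ^+ 2 <= v ^+ 2 -> `|u| <= `|v|.
  by move=> h; rewrite -ler_sqr ?nnegrE // !real_normK ?num_real.
have J0 t : a < t < b -> 0 <= p t * K t ^+ 2 + m t * Phi t ^+ 2.
  by move=> /H[p0 m0 _ _]; rewrite addr_ge0 // mulr_ge0 ?sqr_ge0.
have /andP[ay0 y0b] := y0ab.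
(* As [(Phi^2)' = 2 p J] and [J] is nondecreasing, the sign of [J y0] persists to the right if
   nonnegative and to the left if negative, and this selects the side. *)
have [Jpos|Jneg] := leP 0 (J y0); [left|right] => y /andP[h1 h2]; apply: sq.
  apply: (mono (fun y => Phi y ^+ 2) (fun y => 2 * p y * J y)) => // t /andP[h3 h4].
  have tab : a < t < b by rewrite (lt_le_trans ay0) //= (le_lt_trans h4).
  have [p0 _ _ _] := H t tab.
  rewrite mulr_ge0 ?mulr_ge0 //; apply: le_trans Jpos _.
  apply: (mono J _ _ _ ay0 h3 _ dJ) => [|s /andP[h5 h6]]; first by case/andP: tab.
  by apply: J0; rewrite (lt_le_trans ay0) //= (le_lt_trans h6) //; case/andP: tab.
rewrite -lerN2.
apply: (mono (fun y => - Phi y ^+ 2) (fun y => -1 * (2 * p y * J y))) => // t.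
  move=> /dS dS'; have := is_derive_scale (-1) dS'.
  by under eq_fun do rewrite mulN1r.
move=> /andP[h3 h4].
have tab : a < t < b by rewrite (lt_le_trans h1) //= (le_lt_trans h4).
have [p0 _ _ _] := H t tab.
rewrite mulN1r oppr_ge0 mulr_ge0_le0 ?mulr_ge0 //; apply: le_trans (ltW Jneg).
apply: (mono J _ _ _ _ h4 y0b dJ) => [|s /andP[h5 h6]]; first by case/andP: tab.
by apply: J0; rewrite (lt_le_trans _ h5) /= ?(le_lt_trans h6) //; case/andP: tab.
Qed.

End WeakODE.

(** * Vanishing of weak solutions of the one-dimensional equation *)

Section WeakKernel1.
Variable R : realType.
Local Notation mu := (@lebesgue_measure R).
Implicit Types (f g h : R -> R) (a b : R).

Let mitv a b : measurable (`[a, b]%classic : set (measurableTypeR R)).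
Proof. exact: measurable_itv. Qed.

Lemma integrable_mul_within h f a b : a <= b -> {within `[a, b], continuous h} ->
  mu.-integrable `[a, b] (EFin \o f) ->
  mu.-integrable `[a, b] (EFin \o (fun x => h x * f x)).
Proof.
move=> ab ch If.
have [c _ HC] := EVT_max ab (fun x => continuous_comp (ch x) (@norm_continuous _ R (h x))).
apply: (le_integrable (mitv a b) _ _ (integrableZl (mitv a b) `|h c| If)).
  apply/measurable_EFinP/measurable_funM.
    exact: (@subspace_continuous_measurable_fun _ `[a, b]).
  by case/integrableP : If => /measurable_EFinP.
move=> x xab /=; rewrite lee_fin !normrM normr_id ler_wpM2r //.
exact: HC.
Qed.

Lemma eq_Rintegral_ae f g a b : mu.-integrable `[a, b] (EFin \o f) ->
  mu.-integrable `[a, b] (EFin \o g) ->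
  {ae mu, forall x, x \in `[a, b] -> f x = g x} ->
  \int[mu]_(x in `[a, b]) f x = \int[mu]_(x in `[a, b]) g x.
Proof.
move=> If Ig fg; rewrite /Rintegral; congr fine; apply: ae_eq_integral => //.
- by case/integrableP : If.
- by case/integrableP : Ig.
- have ? := ae_filter_ringOfSetsType mu.
  by apply: filterS fg => x H xab /=; rewrite H.
Qed.

Lemma continuous_in_itv f a b y : {within `[a, b], continuous f} -> a < y < b ->
  {for y, continuous f}.
Proof.
move=> cf /andP[ay yb]; have ab := lt_trans ay yb.
have [+ _ _] := (continuous_within_itvP f ab).1 cf.
by apply; rewrite in_itv /= ay.
Qed.

Lemma is_derive_primitive f a b y : {within `[a, b], continuous f} -> a < y < b ->
  is_derive y 1 (fun t => \int[mu]_(x in `[a, t]) f x) (f y).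
Proof.
move=> cf yab; have /andP[ay yb] := yab.
have [] := @continuous_FTC1_closed R f a y b yb (integrable_within cf) ay (continuous_in_itv cf yab).
by move=> dF E; split; [exact: dF|rewrite -derive1E E].
Qed.

Section Potential.
Variables (s : R) (q phi : R -> R).
Hypothesis s1 : s ^+ 2 = 1.
Hypothesis cq : continuous q.
Hypothesis q0 : forall y, 0 <= q y.

(** Writing [eta' = p k] with [p y = s y] turns [(eta'' - eta' / y) / p] into [k'], so the weak
    equation becomes first-order in the test function [k]. Du Bois-Reymond with weight [p] then
    produces [K], and a second use with weight [1] produces [Phi]. *)
Lemma weak_solution_regular a b : a < b -> (forall y, y \in `[a, b] -> 0 < s * y) ->
  mu.-integrable `[a, b] (EFin \o phi) ->
  (forall eta eta1 eta2 : R -> R, test1 a b eta ->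
     (forall y : R, is_derive y 1 eta (eta1 y)) ->
     (forall y : R, is_derive y 1 eta1 (eta2 y)) ->
     \int[mu]_(y in `[a, b])
       ((eta2 y - eta1 y / y - (q y + 1) * eta y) / (s * y) * phi y) = 0) ->
  exists Phi K : R -> R,
    (forall y, a < y < b ->
       is_derive y 1 Phi (- (s * y * K y)) /\
       is_derive y 1 K (- ((q y + 1) / (s * y) * Phi y))) /\
    {ae mu, forall y, y \in `[a, b] -> phi y = Phi y}.
Proof.
move=> ab sy Iphi weak.
have leab := ltW ab.
pose p y := s * y; pose r y := (q y + 1) / (s * y).
have sp : smooth1 p by apply: smooth1M; [exact: smooth1_cst|exact: smooth1_id].
have cp := smooth1_continuous sp.
have wp : {within `[a, b], continuous p} by exact: continuous_subspaceT.
have wr : {within `[a, b], continuous r}.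
  apply/subspace_continuousP => y yab; apply: cvg_within_filter.
  apply: cvgM; first by apply: cvgD; [exact: cq|exact: cvg_cst].
  by apply: cvgV; [rewrite gt_eqF //; exact: sy|exact: cp].
have Irphi := integrable_mul_within leab wr Iphi.
have test_der k : test1 a b k -> exists k', (forall y : R, is_derive y 1 k (k' y)) /\ test1 a b k'.
  move=> [/smooth1P[k' [dk sk']] [c [d [ac db kz]]]]; exists k'; split => //; split => //.
  (* The margins are halved because [k'] is shown to vanish at points near which [k] vanishes on
     both sides. *)
  exists ((a + c) / 2), ((d + b) / 2); split; [lra|lra|] => t h.
  have tn : t < c \/ d < t by case: h => h; [left|right]; lra.
  rewrite -(@derive_val _ _ _ _ _ _ _ (dk t)).
  have kn : \near t, k t = cst 0 t.
    case: tn => tn; near=> u; rewrite kz //; [left|right]; apply/ltW; near: u.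
      exact: lt_nbhsl.
    exact: lt_nbhsr.
  by rewrite (near_eq_derive (1 : R) kn) derive_cst.
have Ider k : test1 a b k -> mu.-integrable `[a, b] (EFin \o (fun y => derive1 k y * phi y)).
  move=> /test_der[k' [dk [sk' _]]]; apply: integrable_mul_continuous => //.
  rewrite (_ : derive1 k = k'); first exact: smooth1_continuous.
  by apply/funext => y; rewrite derive1E; exact: derive_val.
have [||c1 Hc1] := @dubois_reymond R p (fun y => r y * phi y)
  (fun k => \int[mu]_(y in `[a, b]) (derive1 k y * phi y)) a b ab sp sy Irphi.
- move=> c k l tk tl; have [k' [dk tk']] := test_der _ tk; have [l' [dl tl']] := test_der _ tl.
  rewrite -RintegralZl ?Ider // -RintegralD ?Ider //.
    apply: eq_Rintegral => y _; rewrite !derive1E.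
    rewrite (@derive_val _ _ _ _ _ _ _ (is_derive_add (dk y) (is_derive_scale c (dl y)))).
    by rewrite (@derive_val _ _ _ _ _ _ _ (dk y)) (@derive_val _ _ _ _ _ _ _ (dl y)); ring.
  exact: (integrableZl (mitv a b) c (Ider _ tl)).
- move=> k tk pk0; have [te de] := test1_primitive sp tk pk0.
  have [k' [dk tk']] := test_der _ tk.
  set eta := (fun y => Rintegral _ _ _) in te de *.
  have dpk (y : R) : is_derive y 1 (fun y => p y * k y) (s * k y + p y * k' y).
    apply: is_derive_mul => //.
    by apply: is_derive_eq (is_derive_scale s (is_derive_id y (1 : R))) _; rewrite mulr1.
  have := weak _ _ _ te de dpk.
  have Ie : mu.-integrable `[a, b] (EFin \o (fun y => eta y * (r y * phi y))).
    by apply: integrable_mul_continuous => //; apply: smooth1_continuous; case: te.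
  move=> H; apply/eqP; rewrite -subr_eq0; apply/eqP.
  rewrite -RintegralB ?Ider // -[RHS]H; apply: eq_Rintegral => y; rewrite inE /= => yab.
  rewrite derive1E (@derive_val _ _ _ _ _ _ _ (dk y)) -/(eta y).
  move: (eta y) => e; rewrite /p /r.
  have y0 : y != 0 by apply: contraTneq (sy y yab) => ->; rewrite mulr0 ltxx.
  have s0 : s != 0 by apply: contraTneq (sy y yab) => ->; rewrite mul0r ltxx.
  by field; rewrite y0.
pose K t := c1 - \int[mu]_(y in `[a, t]) (r y * phi y).
have wK : {within `[a, b], continuous K}.
  have := within_primitive leab Irphi; move=> /subspace_continuousP h.
  by apply/subspace_continuousP => t tab; apply: cvgB; [exact: cvg_cst|exact: h].
have wpK := within_mul wp wK.
have IpK := integrable_within wpK.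
have sone : smooth1 (fun=> 1 : R) by exact: smooth1_cst.
have [||c2 Hc2] := @dubois_reymond R (fun=> 1) (fun y => p y * K y)
  (fun k => \int[mu]_(y in `[a, b]) (k y * phi y)) a b ab sone (fun _ _ => ltr01) IpK.
- move=> c k l [sk _] [sl _].
  have Ik := integrable_mul_continuous (smooth1_continuous sk) Iphi.
  have Il := integrable_mul_continuous (smooth1_continuous sl) Iphi.
  rewrite -RintegralZl // -RintegralD //.
    by apply: eq_Rintegral => y _; ring.
  exact: (integrableZl (mitv a b) c Il).
- move=> k tk k0; have [tk1 dk1] := test1_primitive sone tk k0.
  have := Hc1 _ tk1; set k1 := (fun y => Rintegral _ _ _) in tk1 dk1 *.
  have -> : derive1 k1 = (fun y => 1 * k y).
    by apply/funext => y; rewrite derive1E; exact: derive_val.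
  under eq_Rintegral do rewrite mul1r.
  by move=> ->; apply: eq_Rintegral => t _; rewrite /K; ring.
pose Phi t := c2 - \int[mu]_(y in `[a, t]) (p y * K y).
have wPhi : {within `[a, b], continuous Phi}.
  have := within_primitive leab IpK; move=> /subspace_continuousP h.
  by apply/subspace_continuousP => t tab; apply: cvgB; [exact: cvg_cst|exact: h].
have aePhi : {ae mu, forall y, y \in `[a, b] -> phi y = Phi y}.
  have IPhi := integrable_within wPhi.
  have Idiff := integrableB (mitv a b) Iphi IPhi.
  have H z : test1 a b z -> \int[mu]_(y in `[a, b]) (z y * (phi y - Phi y)) = 0.
    move=> tz; have cz : continuous z by case: tz => sz _; exact: smooth1_continuous.
    under eq_Rintegral do rewrite mulrBr.
    rewrite RintegralB //; try exact: integrable_mul_continuous.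
    rewrite Hc2 //; apply/eqP; rewrite subr_eq0; apply/eqP.
    by apply: eq_Rintegral => t _; rewrite mul1r.
  have ? := ae_filter_ringOfSetsType mu.
  by apply: filterS (ae_eq0_of_test Idiff H) => y h yab; apply/eqP; rewrite -subr_eq0 h.
exists Phi, K; split => // y yab; split.
  have := is_derive_add (is_derive_const y (1 : R) c2) (is_derive_scale (-1) (is_derive_primitive wpK yab)).
  rewrite add0r mulN1r; under eq_fun do rewrite mulN1r; exact.
have wrPhi := within_mul wr wPhi.
(* [K] was built from the merely integrable [phi]. Replacing [phi] by [Phi] under the integral makes
   the integrand continuous, hence [K] differentiable at every interior point. *)
have KE : \near y, c1 - \int[mu]_(t in `[a, y]) (r t * Phi t) = K y.
  have /andP[ay yb] := yab.
  near=> t; rewrite /K; congr (_ - _); apply: eq_Rintegral_ae.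
  - apply: integrable_itvS (integrable_within wrPhi) => //; apply/ltW; near: t; exact: lt_nbhsl.
  - apply: integrable_itvS Irphi => //; apply/ltW; near: t; exact: lt_nbhsl.
  have tb : t < b by near: t; exact: lt_nbhsl.
  have ? := ae_filter_ringOfSetsType mu.
  apply: filterS aePhi => u h; rewrite in_itv /= => /andP[au ut]; rewrite h //.
  by rewrite in_itv /= au (le_trans ut) // ltW.
apply: near_eq_is_derive KE _.
have := is_derive_add (is_derive_const y (1 : R) c1) (is_derive_scale (-1) (is_derive_primitive wrPhi yab)).
rewrite add0r mulN1r; under eq_fun do rewrite mulN1r; exact.
Unshelve. all: by end_near. Qed.

Lemma integrable_inv_sign c d : (forall y, y \in `[c, d] -> 0 < s * y) ->
  mu.-integrable `[c, d] (EFin \o (fun y => (s * y)^-1)).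
Proof.
move=> sy; apply: integrable_within; apply/subspace_continuousP => y ycd.
apply: cvg_within_filter; apply: cvgV; first by rewrite gt_eqF //; exact: sy.
by apply: cvgM; [exact: cvg_cst|exact: cvg_id].
Qed.

(** Since [s^2 = 1], the function [s ln (s y)] is a primitive of [1 / (s y)] on either half-line. *)
Lemma Rintegral_inv_sign c d : c < d -> (forall y, y \in `[c, d] -> 0 < s * y) ->
  \int[mu]_(y in `[c, d]) (s * y)^-1 = s * (ln (s * d) - ln (s * c)).
Proof.
move=> cd sy.
have dF y : y \in `[c, d] -> is_derive y 1 (fun y => s * ln (s * y)) ((s * y)^-1).
  move=> ycd; have sy0 := sy _ ycd.
  have d1 := is_derive_scale s (is_derive_id y (1 : R)).
  apply: is_derive_eq (is_derive_scale s (is_derive_chain d1 (is_derive1_ln sy0))) _.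
  by rewrite mulr1 mulrCA -expr2 s1 mulr1.
have cdc : c \in `[c, d] by rewrite in_itv /= lexx ltW.
have cdd : d \in `[c, d] by rewrite in_itv /= lexx ltW.
rewrite /Rintegral (@continuous_FTC2 R (fun y => (s * y)^-1) (fun y => s * ln (s * y)) c d cd) //=.
- by rewrite mulrBr.
- apply/subspace_continuousP => y ycd; apply: cvg_within_filter.
  apply: cvgV; first by rewrite gt_eqF //; exact: sy.
  by apply: cvgM; [exact: cvg_cst|exact: cvg_id].
- split.
  + by move=> y /subset_itv_oo_cc /dF [].
  + by apply: cvg_at_right_filter; exact: is_derive_continuous (dF c cdc).
  + by apply: cvg_at_left_filter; exact: is_derive_continuous (dF d cdd).
- move=> y /subset_itv_oo_cc /dF H; rewrite derive1E; exact: derive_val.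
Qed.

(* A nonzero value of [Phi] would bound [Phi] from below on [[b, b e^n]] or on
   [[a e^-n, a]], both of logarithmic length [n]. *)
Lemma weak_kernel1 (C M : R) a b : 0 <= C -> 0 <= M -> a < b ->
  (forall y, y \in `[a, b] -> 0 < s * y) ->
  (forall c d, c < d -> (forall y, y \in `[c, d] -> 0 < s * y) ->
     mu.-integrable `[c, d] (EFin \o phi)) ->
  (forall c d lam, c < d -> (forall y, y \in `[c, d] -> 0 < s * y) -> 0 < lam ->
     \int[mu]_(y in `[c, d]) (`|phi y| / (s * y)) <=
       lam * C + M / lam * \int[mu]_(y in `[c, d]) (s * y)^-1) ->
  (forall c d (eta eta1 eta2 : R -> R), c < d ->
     (forall y, y \in `[c, d] -> 0 < s * y) -> test1 c d eta ->
     (forall y : R, is_derive y 1 eta (eta1 y)) ->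
     (forall y : R, is_derive y 1 eta1 (eta2 y)) ->
     \int[mu]_(y in `[c, d])
       ((eta2 y - eta1 y / y - (q y + 1) * eta y) / (s * y) * phi y) = 0) ->
  {ae mu, forall y, y \in `[a, b] -> phi y = 0}.
Proof.
move=> C0 M0 ab sy Iphi bound weak.
(* This is [e^n] on the positive half-line and [e^-n] on the negative one. In both cases [al n]
   decreases and [be n] increases, one towards [0] and the other towards infinity in absolute
   value. *)
pose u (n : nat) := expR (s * n%:R).
have u0 n : 0 < u n by exact: expR_gt0.
pose al n := a / u n; pose be n := b * u n.
have sE : s = 1 \/ s = -1.
  by move/eqP : s1; rewrite sqrf_eq1 => /orP[] /eqP; tauto.
have ss : s * s = 1 by rewrite -expr2.
have e1 : 0 < s * (expR s - 1).
  case: sE => ->; first by rewrite mul1r subr_gt0 expR_gt1.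
  by rewrite mulN1r opprB subr_gt0 expR_lt1 ltrN10.
have e2 : 0 < s * (1 - expR (- s)).
  case: sE => ->; first by rewrite mul1r subr_gt0 expR_lt1 ltrN10.
  by rewrite mulN1r opprB subr_gt0 opprK expR_gt1.
have sa : 0 < s * a by apply: sy; rewrite in_itv /= lexx ltW.
have sb : 0 < s * b by apply: sy; rewrite in_itv /= lexx ltW.
have uS n : u n.+1 = u n * expR s.
  by rewrite /u -expRD; congr expR; rewrite -natr1; ring.
have sal n : 0 < s * al n by rewrite /al mulrA divr_gt0.
have sbe n : 0 < s * be n by rewrite /be mulrA mulr_gt0.
have alS n : al n.+1 < al n.
  rewrite -subr_gt0 /al uS.
  have -> : a / u n - a / (u n * expR s) = (s * al n) * (s * (1 - expR (- s))).
    rewrite mulrACA ss mul1r /al expRN; field; apply/andP; split; apply/negP => /eqP h.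
      by have := expR_gt0 s; rewrite h ltxx.
    by have := u0 n; rewrite h ltxx.
  exact: mulr_gt0.
have beS n : be n < be n.+1.
  rewrite -subr_gt0 /be uS.
  have -> : b * (u n * expR s) - b * u n = (s * be n) * (s * (expR s - 1)).
    by rewrite mulrACA ss mul1r /be; ring.
  exact: mulr_gt0.
have ale n : al n <= a.
  elim: n => [|n IH]; first by rewrite /al /u mulr0 expR0 divr1.
  exact: le_trans (ltW (alS n)) IH.
have bge n : b <= be n.
  elim: n => [|n IH]; first by rewrite /be /u mulr0 expR0 mulr1.
  exact: le_trans IH (ltW (beS n)).
have aln n : al n.+1 < a by exact: lt_le_trans (alS n) (ale n).
have ben n : b < be n.+1 by exact: le_lt_trans (bge n) (beS n).
have lnu n : s * ln (u n) = n%:R by rewrite /u expRK mulrA ss mul1r.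
(* The inequality is [bound] with [lam = m] on an interval of logarithmic length [n + 1]. Regularity
   is invoked on the larger interval of index [n + 2], so that this interval is interior to it. *)
have step n : {ae mu, forall y, y \in `[a, b] -> forall m : nat, (0 < m)%N ->
    `|phi y| * n.+1%:R <= m%:R * C + M / m%:R * n.+1%:R}.
  have sy' y : y \in `[al n.+2, be n.+2] -> 0 < s * y.
    rewrite in_itv /= => /andP[]; have := sal n.+2; have := sbe n.+2.
    case: sE => ->; rewrite ?mul1r ?mulN1r ?oppr_gt0 => h1 h2 h3 h4.
      exact: lt_le_trans h3.
    exact: le_lt_trans h1.
  have abn : al n.+2 < be n.+2 by apply: lt_trans (aln _) (lt_trans ab (ben _)).
  have [Phi [K [ode aePhi]]] := weak_solution_regular abn sy' (Iphi _ _ abn sy')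
    (fun eta eta1 eta2 te d1 d2 => weak _ _ _ _ _ abn sy' te d1 d2).
  have ? := ae_filter_ringOfSetsType mu.
  have key c d y0 : c < d -> al n.+2 < c -> d < be n.+2 ->
      (forall y, y \in `[c, d] -> `|Phi y0| <= `|Phi y|) ->
      s * (ln (s * d) - ln (s * c)) = n.+1%:R ->
      forall m : nat, (0 < m)%N -> `|Phi y0| * n.+1%:R <= m%:R * C + M / m%:R * n.+1%:R.
    move=> cd alc dbe HPhi len m m0.
    have sy2 y : y \in `[c, d] -> 0 < s * y.
      rewrite in_itv /= => /andP[cy yd]; apply: sy'; rewrite in_itv /=.
      by rewrite ltW ?(lt_le_trans alc cy) //= ltW // (le_lt_trans yd dbe).
    have m0' : 0 < m%:R :> R by rewrite ltr0n.
    have := bound c d m%:R cd sy2 m0'.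
    rewrite Rintegral_inv_sign // len; apply: le_trans.
    rewrite -len -(Rintegral_inv_sign cd sy2) -RintegralZl //; last exact: integrable_inv_sign.
    have wsy : {within `[c, d], continuous (fun y => (s * y)^-1)}.
      apply/subspace_continuousP => y ycd; apply: cvg_within_filter.
      apply: cvgV; first by rewrite gt_eqF //; exact: sy2.
      by apply: cvgM; [exact: cvg_cst|exact: cvg_id].
    have wPhi : {within `[c, d], continuous (fun y => `|Phi y|)}.
      apply/subspace_continuousP => y; rewrite /= in_itv /= => /andP[cy yd].
      apply: cvg_within_filter; apply: cvg_norm.
      have [dP _] := ode y (introT andP (conj (lt_le_trans alc cy) (le_lt_trans yd dbe))).
      exact: is_derive_continuous dP.
    have IP := integrable_within (within_mul wPhi wsy).
    have Ip : mu.-integrable `[c, d] (EFin \o (fun y => `|phi y| / (s * y))).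
      have := integrable_mul_within (ltW cd) wsy (integrable_norm (Iphi c d cd sy2)).
      by congr (mu.-integrable _ (EFin \o _)); apply/funext => y; rewrite mulrC.
    rewrite (eq_Rintegral_ae Ip IP); last first.
      apply: filterS aePhi => y h; rewrite in_itv /= => /andP[cy yd]; rewrite h //.
      by rewrite in_itv /= ltW ?(lt_le_trans alc cy) //= ltW // (le_lt_trans yd dbe).
    apply: le_Rintegral => //.
      exact: (integrableZl (mitv c d) `|Phi y0| (integrable_inv_sign sy2)).
    by move=> y ycd; rewrite ler_wpM2r ?invr_ge0 ?(ltW (sy2 _ ycd)) //; exact: HPhi.
  apply: filterS aePhi => y HPhi yab m m0.
  have /andP[ay yb] : a <= y <= b by rewrite in_itv in yab.
  rewrite HPhi; last first.
    by rewrite in_itv /= (le_trans _ ay) ?(le_trans yb) // ltW.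
  have [] := @ode_alternative R (fun y => s * y) (fun y => (q y + 1) / (s * y)) Phi K
    (al n.+2) (be n.+2) y.
  - move=> t tab; have [d1 d2] := ode t tab.
    have st : 0 < s * t by apply: sy'; rewrite in_itv /=; case/andP: tab => h1 h2; rewrite !ltW.
    by split => //; [exact: ltW|rewrite divr_ge0 // ?addr_ge0 // ltW].
  - by rewrite (lt_le_trans (aln _) ay) (le_lt_trans yb (ben _)).
  - move=> H; apply: (key b (be n.+1)) => //.
    + exact: lt_trans (aln _) ab.
    + move=> t; rewrite in_itv /= => /andP[bt tb]; apply: H.
      by rewrite (le_trans yb bt) (le_lt_trans tb).
    + by rewrite /be mulrA lnM ?posrE // addrC addKr lnu.
  - move=> H; apply: (key (al n.+1) a) => //.
    + exact: lt_trans ab (ben _).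
    + move=> t; rewrite in_itv /= => /andP[bt tb]; apply: H.
      by rewrite (le_trans tb ay) (lt_le_trans _ bt).
    + by rewrite /al mulrA ln_div ?posrE // opprB addrC subrK lnu.
have ? := ae_filter_ringOfSetsType mu.
(* Merging countably many null sets allows [n] and [m] to depend on the point [y]. *)
apply: filterS (ae_foralln step) => y H yab.
apply/eqP; rewrite -normr_eq0; apply/eqP; apply: contrapT => /eqP t0.
have {}t0 : 0 < `|phi y| by rewrite lt_def t0 normr_ge0.
set t := `|phi y| in t0 H.
have b1 : 0 <= 2 * M / t by rewrite divr_ge0 ?mulr_ge0 // ltW.
(* First [m] is taken so large that [M / m <= t / 2], which leaves [t / 2 * (n + 1) <= m C]; then
   [n > 2 m C / t] contradicts this. *)
have := archi_boundP b1; set m := Num.bound _ => mM.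
have m0 : 0 < m%:R :> R by exact: le_lt_trans b1 mM.
have b2 : 0 <= 2 * m%:R * C / t by rewrite divr_ge0 ?mulr_ge0 // ltW.
have := archi_boundP b2; set n := Num.bound _ => nC.
have := H n yab m; rewrite -(ltr0n R) => /(_ m0).
have h1 : M / m%:R <= t / 2.
  rewrite ler_pdivrMr //; move: mM; rewrite ltr_pdivrMr // => mM; lra.
move: nC; rewrite ltr_pdivrMr // => nC.
have h2 : M / m%:R * n.+1%:R <= t / 2 * n.+1%:R by rewrite ler_wpM2r.
move: h2 nC; rewrite -natr1; move: (n%:R) (M / m%:R) => N z h2 nC h3.
suff : t / 2 * (N + 1) <= m%:R * C.
  by move: nC t0; move: (m%:R) => k; lra.
by move: h2 h3; move: (m%:R * C) => k; lra.
Qed.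

End Potential.
End WeakKernel1.

(** * Uniqueness of Fourier coefficients in one variable *)

Section FourierUniqueness.
Variable R : realType.
Local Notation mu := (@lebesgue_measure R).

Lemma bernoulli_pow (a : R) n : 0 <= a <= 1 -> 1 - n%:R * a <= (1 - a) ^+ n.
Proof.
move=> /andP[a0 a1]; elim: n => [|n IH]; first by rewrite mul0r subr0 expr0.
rewrite exprS; apply: le_trans (ler_wpM2l _ IH); last by rewrite subr_ge0.
rewrite -natr1 -subr_ge0.
rewrite (_ : _ - _ = n%:R * a ^+ 2); last by ring.
by rewrite mulr_ge0 ?sqr_ge0.
Qed.

(** Bernoulli's inequality bounds the second factor by [(1 + a)^n], and [(1 - a) (1 + a) <= 1]. *)
Lemma bernoulli_inv (a : R) n : 0 <= a <= 1 -> (1 - a) ^+ n * (1 + n%:R * a) <= 1.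
Proof.
move=> /andP[a0 a1].
have h : 1 + n%:R * a <= (1 + a) ^+ n.
  elim: n => [|n IH]; first by rewrite mul0r addr0 expr0.
  rewrite exprS; apply: le_trans (ler_wpM2l _ IH); last by rewrite addr_ge0.
  rewrite -natr1 -subr_ge0 (_ : _ - _ = n%:R * a ^+ 2); last by ring.
  by rewrite mulr_ge0 ?sqr_ge0.
apply: le_trans (ler_wpM2l _ h) _; first by rewrite exprn_ge0 ?subr_ge0.
rewrite -exprMn exprn_ile1 //.
  by rewrite mulr_ge0 ?subr_ge0 // addr_ge0.
by rewrite -subr_sqr expr1n gerBl sqr_ge0.
Qed.

(* The polynomials approximating a step function in the elementary proof of
   the Stone-Weierstrass theorem. *)
Lemma cvg_step_lt (u : R) : 0 <= u < 2^-1 ->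
  (fun n => (1 - u ^+ n) ^+ (2 ^ n)) @ \oo --> (1 : R).
Proof.
move=> /andP[u0 u1].
have uI n : 0 <= u ^+ n <= 1 by rewrite exprn_ge0 // exprn_ile1 //; lra.
apply: (@squeeze_cvgr _ _ _ _ (fun n => 1 - (2 * u) ^+ n) (fun=> 1)).
- apply: nearW => n; apply/andP; split.
    by rewrite exprMn -natrX; exact: bernoulli_pow.
  by have /andP[h1 h2] := uI n; rewrite exprn_ile1 ?subr_ge0 // gerBl.
- rewrite -[X in _ --> X]subr0; apply: cvgB; first exact: cvg_cst.
  by apply: cvg_expr; rewrite ger0_norm; lra.
- exact: cvg_cst.
Qed.

Lemma cvg_step_gt (u : R) : 2^-1 < u <= 1 ->
  (fun n => (1 - u ^+ n) ^+ (2 ^ n)) @ \oo --> (0 : R).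
Proof.
move=> /andP[u0 u1].
have uI n : 0 <= u ^+ n <= 1 by rewrite exprn_ge0 ?exprn_ile1 //; lra.
have u2 : 0 < 2 * u by lra.
apply: (@squeeze_cvgr _ _ _ _ (fun=> 0) (fun n => ((2 * u)^-1) ^+ n)).
- apply: nearW => n; have /andP[h1 h2] := uI n; rewrite exprn_ge0 ?subr_ge0 //=.
  rewrite exprVn -[leRHS]mul1r ler_pdivlMr ?exprn_gt0 //.
  apply: le_trans (bernoulli_inv (2 ^ n) (uI n)).
  by rewrite ler_wpM2l ?exprn_ge0 ?subr_ge0 // exprMn -natrX lerDr.
- exact: cvg_cst.
- by apply: cvg_expr; rewrite ger0_norm ?invr_ge0 ?ltW // invf_lt1 //; lra.
Qed.

Variable g : R -> R.
Hypothesis Ig : mu.-integrable `[0, 2 * pi] (EFin \o g).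

Let I (h : R -> R) : R := \int[mu]_(x in `[0, 2 * pi]) (h x * g x).

Hypothesis modes : forall k : int,
  I (fun x : R => cos (k%:~R * x)) = 0 /\ I (fun x : R => sin (k%:~R * x)) = 0.

Let Ilin (c : R) (h h' : R -> R) : continuous h -> continuous h' -> I (fun x => c * h x + h' x) = c * I h + I h'.
Proof.
move=> ch ch'; rewrite /I.
have I1 := integrable_mul_continuous ch Ig; have I2 := integrable_mul_continuous ch' Ig.
have mI : measurable (`[0, 2 * pi]%classic : set (measurableTypeR R)) by exact: measurable_itv.
rewrite -RintegralZl // -RintegralD //; first by apply: eq_Rintegral => x _; ring.
exact: (integrableZl mI c I1).
Qed.

(** Requiring orthogonality to [g] after multiplication by every mode, and not for [h] alone, makes
    the class stable under multiplication by [cos] and [sin]; it therefore contains all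
    trigonometric polynomials. *)
Definition annihilated (h : R -> R) := continuous h /\ forall k : int,
  I (fun x : R => cos (k%:~R * x) * h x) = 0 /\ I (fun x : R => sin (k%:~R * x) * h x) = 0.

Let ccos (k : R) : continuous (fun x => cos (k * x)).
Proof. by move=> x; exact: is_derive_continuous (is_derive_chain1 (is_derive_scale k (is_derive_id x (1 : R))) (is_derive_cos _)). Qed.

Let csin (k : R) : continuous (fun x => sin (k * x)).
Proof. by move=> x; exact: is_derive_continuous (is_derive_chain1 (is_derive_scale k (is_derive_id x (1 : R))) (is_derive_sin _)). Qed.

Let cM (h h' : R -> R) : continuous h -> continuous h' -> continuous (fun x => h x * h' x).
Proof. by move=> ch ch' x; apply: cvgM; [exact: ch|exact: ch']. Qed.

Lemma annihilated1 : annihilated (fun=> 1).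
Proof.
split=> [x|k]; first exact: cvg_cst.
by have [h1 h2] := modes k; split; [rewrite -[RHS]h1|rewrite -[RHS]h2];
  apply: eq_Rintegral => x _; rewrite mulr1.
Qed.

Lemma annihilated_lin c h h' : annihilated h -> annihilated h' ->
  annihilated (fun x => c * h x + h' x).
Proof.
move=> [ch H] [ch' H']; split.
  by move=> x; apply: cvgD; [apply: cvgM; [exact: cvg_cst|exact: ch]|exact: ch'].
move=> k; have [c1 s1] := H k; have [c2 s2] := H' k.
split; [have := Ilin c (cM (@ccos k%:~R) ch) (cM (@ccos k%:~R) ch')|
        have := Ilin c (cM (@csin k%:~R) ch) (cM (@csin k%:~R) ch')];
  rewrite ?c1 ?c2 ?s1 ?s2 mulr0 addr0 => <-; apply: eq_Rintegral => x _; ring.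
Qed.

Lemma annihilated_cos h : annihilated h -> annihilated (fun x => cos x * h x).
Proof.
move=> [ch H]; split; first by apply: cM => //; exact: continuous_cos.
move=> k; have [c1 s1] := H (k + 1); have [c2 s2] := H (k - 1).
have e1 x : (k + 1)%:~R * x = k%:~R * x + x :> R by rewrite intrD; ring.
have e2 x : (k - 1)%:~R * x = k%:~R * x - x :> R by rewrite intrD intrN; ring.
split.
  have := Ilin 1 (cM (@ccos (k + 1)%:~R) ch) (cM (@ccos (k - 1)%:~R) ch).
  rewrite c1 c2 mulr0 addr0 => E.
  suff : 1 * I (fun x : R => cos (k%:~R * x) * (cos x * h x)) + I (fun x : R => cos (k%:~R * x) * (cos x * h x)) = 0.
    move: (I _) => z; lra.
  have := Ilin 1 (cM (@ccos k%:~R) (cM (@continuous_cos R) ch)) (cM (@ccos k%:~R) (cM (@continuous_cos R) ch)).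
  move=> <-; rewrite -E.
  by apply: eq_Rintegral => x _; rewrite e1 e2 cosB cosD; ring.
have := Ilin 1 (cM (@csin (k + 1)%:~R) ch) (cM (@csin (k - 1)%:~R) ch).
rewrite s1 s2 mulr0 addr0 => E.
suff : 1 * I (fun x : R => sin (k%:~R * x) * (cos x * h x)) + I (fun x : R => sin (k%:~R * x) * (cos x * h x)) = 0.
  move: (I _) => z; lra.
have := Ilin 1 (cM (@csin k%:~R) (cM (@continuous_cos R) ch)) (cM (@csin k%:~R) (cM (@continuous_cos R) ch)).
move=> <-; rewrite -E.
by apply: eq_Rintegral => x _; rewrite e1 e2 sinB sinD; ring.
Qed.

Lemma annihilated_sin h : annihilated h -> annihilated (fun x => sin x * h x).
Proof.
move=> [ch H]; split; first by apply: cM => //; exact: continuous_sin.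
move=> k; have [c1 s1] := H (k + 1); have [c2 s2] := H (k - 1).
have e1 x : (k + 1)%:~R * x = k%:~R * x + x :> R by rewrite intrD; ring.
have e2 x : (k - 1)%:~R * x = k%:~R * x - x :> R by rewrite intrD intrN; ring.
split.
  have := Ilin (-1) (cM (@csin (k - 1)%:~R) ch) (cM (@csin (k + 1)%:~R) ch).
  rewrite s1 s2 mulr0 addr0 => E.
  suff : 1 * I (fun x : R => cos (k%:~R * x) * (sin x * h x)) + I (fun x : R => cos (k%:~R * x) * (sin x * h x)) = 0.
    move: (I _) => z; lra.
  have := Ilin 1 (cM (@ccos k%:~R) (cM (@continuous_sin R) ch)) (cM (@ccos k%:~R) (cM (@continuous_sin R) ch)).
  move=> <-; rewrite -E.
  by apply: eq_Rintegral => x _; rewrite e1 e2 sinB sinD; ring.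
have := Ilin (-1) (cM (@ccos (k + 1)%:~R) ch) (cM (@ccos (k - 1)%:~R) ch).
rewrite c1 c2 mulr0 addr0 => E.
suff : 1 * I (fun x : R => sin (k%:~R * x) * (sin x * h x)) + I (fun x : R => sin (k%:~R * x) * (sin x * h x)) = 0.
  move: (I _) => z; lra.
have := Ilin 1 (cM (@csin k%:~R) (cM (@continuous_sin R) ch)) (cM (@csin k%:~R) (cM (@continuous_sin R) ch)).
move=> <-; rewrite -E.
by apply: eq_Rintegral => x _; rewrite e1 e2 cosB cosD; ring.
Qed.

(** A trigonometric polynomial with values in [[0, 1]], below [1/2] on []0, b[] and above [1/2] on
    []b, 2 pi[]: [cos (x - b/2)] exceeds [cos (b/2)] when [x] is within [b/2] of the midpoint [b/2].
    The division by [4] keeps the range in [[0, 1]]. *)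
Let level (b x : R) : R := 2^-1 - (cos (x - b / 2) - cos (b / 2)) / 4.

Lemma annihilated_level b h : annihilated h -> annihilated (fun x => level b x * h x).
Proof.
move=> Oh; have Oc := annihilated_cos Oh; have Os := annihilated_sin Oh.
have O0 : annihilated (fun=> 0).
  have := annihilated_lin (-1) annihilated1 annihilated1.
  by rewrite (_ : (fun _ => _) = fun=> 0) //; apply/funext => x; rewrite mulr1 addNr.
have := annihilated_lin (- (cos (b / 2) / 4)) Oc (annihilated_lin (- (sin (b / 2) / 4)) Os
  (annihilated_lin (2^-1 + cos (b / 2) / 4) Oh O0)).
rewrite (_ : (fun _ => _) = fun x => level b x * h x) //.
by apply/funext => x; rewrite /level cosB; field.
Qed.

Lemma annihilated_step b n N : annihilated (fun x => (1 - level b x ^+ n) ^+ N).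
Proof.
elim: N => [|N IH]; first exact: annihilated1.
have OX h m : annihilated h -> annihilated (fun x => level b x ^+ m * h x).
  elim: m => [|m IHm] Oh.
    by rewrite (_ : (fun _ => _) = h) //; apply/funext => x; rewrite expr0 mul1r.
  rewrite (_ : (fun _ => _) = (fun x => level b x * (level b x ^+ m * h x))).
    by apply: annihilated_level; exact: IHm.
  by apply/funext => x; rewrite exprS mulrA.
have := annihilated_lin (-1) (OX _ n IH) IH.
rewrite (_ : (fun _ => _) = fun x => (1 - level b x ^+ n) ^+ N.+1) //.
by apply/funext => x; rewrite exprS; ring.
Qed.

Lemma cos_diff_gt0 (b x : R) : 0 < x < b -> b < 2 * pi -> cos (b / 2) < cos (x - b / 2).
Proof.
move=> /andP[x0 xb] b2.
have -> : x - b / 2 = x / 2 - (b - x) / 2 by field.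
have -> : b / 2 = x / 2 + (b - x) / 2 by field.
rewrite cosB cosD -subr_gt0.
rewrite (_ : _ - _ = 2 * (sin (x / 2) * sin ((b - x) / 2))); last by ring.
rewrite !mulr_gt0 // sin_gt0_pi //; apply/andP; split; lra.
Qed.

Lemma cos_diff_lt0 (b x : R) : 0 < b < x -> x < 2 * pi -> cos (x - b / 2) < cos (b / 2).
Proof.
move=> /andP[b0 bx] x2.
have -> : x - b / 2 = x / 2 + (x - b) / 2 by field.
have -> : b / 2 = x / 2 - (x - b) / 2 by field.
rewrite cosB cosD -subr_gt0.
rewrite (_ : _ - _ = 2 * (sin (x / 2) * sin ((x - b) / 2))); last by ring.
rewrite !mulr_gt0 // sin_gt0_pi //; apply/andP; split; lra.
Qed.

(** The polynomials [(1 - level^n)^(2^n)] tend to the indicator of []0, b[] except at [0], [b] and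
    [2 pi]. They are annihilated and take values in [[0, 1]], so dominated convergence applies. *)
Lemma Rintegral_itv0 b : 0 < b < 2 * pi -> \int[mu]_(x in `]0, b[) g x = 0.
Proof.
move=> /andP[b0 b2].
have mI : measurable (`[0, 2 * pi]%classic : set (measurableTypeR R)) by exact: measurable_itv.
have mg : measurable_fun `[0, 2 * pi] g by case/integrableP : Ig => /measurable_EFinP.
pose P n x := (1 - level b x ^+ n) ^+ (2 ^ n).
have P0 n : \int[mu]_(x in `[0, 2 * pi]) (P n x * g x) = 0.
  have [_ H] := annihilated_step b n (2 ^ n); have [E _] := H 0.
  by rewrite -[RHS]E; apply: eq_Rintegral => x _; rewrite mul0r cos0 mul1r.
have lI x : 0 <= level b x <= 1.
  have := cos_le1 (x - b / 2); have := cos_geN1 (x - b / 2).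
  have := cos_le1 (b / 2); have := cos_geN1 (b / 2).
  by rewrite /level => h1 h2 h3 h4; apply/andP; split; lra.
have lX n x : 0 <= level b x ^+ n <= 1.
  by have /andP[h1 h2] := lI x; rewrite exprn_ge0 ?exprn_ile1.
have PI n x : 0 <= P n x <= 1.
  have /andP[h1 h2] := lX n x.
  by rewrite /P exprn_ge0 ?exprn_ile1 ?subr_ge0 // gerBl.
have sub : `]0, b[ `<=` `[0, 2 * pi].
  by move=> x; rewrite /= !in_itv /= => /andP[x0 xb]; rewrite !ltW // (lt_trans xb).
have nset1 (c : R) : {ae mu, forall x : R, x != c}.
  exists [set c]; split=> //; first exact: lebesgue_measure_set1.
  by move=> x /= /negP; rewrite negbK => /eqP.
have := @Rintegral_dominated_cvg _ _ R mu `[0, 2 * pi] (fun n x => P n x * g x) (g \_ `]0, b[) (fun x => `|g x|) mI.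
have -> : (fun n => \int[mu]_(x in `[0, 2 * pi]) (P n x * g x)) = fun=> 0 by apply/funext.
rewrite -Rintegral_mkcondr setIidr // => H.
apply/esym; apply: (@cvg_unique _ (@Rhausdorff R) ((fun=> 0 : R) @ \oo)); first exact: cvg_cst.
have cl : continuous (level b).
  move=> x; apply: cvgB; first exact: cvg_cst.
  apply: cvgM; last exact: cvg_cst.
  apply: cvgB; last exact: cvg_cst.
  apply: (@continuous_comp _ _ _ (fun x : R => x - b / 2) (@cos R)); last exact: continuous_cos.
  by apply: cvgB; [exact: cvg_id|exact: cvg_cst].
have cP n : continuous (P n).
  have cX (f : R -> R) m : continuous f -> continuous (fun x => f x ^+ m).
    move=> cf x; apply: (@continuous_comp _ _ _ f (fun t : R => t ^+ m)); first exact: cf.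
    exact: exprn_continuous.
  by apply: (cX (fun x => 1 - level b x ^+ n)) => x; apply: cvgB; [exact: cvg_cst|exact: cX].
apply: H.
- move=> n; apply: measurable_funM => //; apply: measurable_funTS.
  exact: continuous_measurable_fun.
- by apply/measurable_restrict => //; apply: measurable_funS mg.
- have ? := ae_filter_ringOfSetsType mu.
  near=> x => xI.
  have x0 : x != 0 by near: x; exact: nset1.
  have xb : x != b by near: x; exact: nset1.
  have x2 : x != 2 * pi by near: x; exact: nset1.
  have /andP[h0 h2] : (0 < x) && (x < 2 * pi).
    by move: xI; rewrite /= in_itv /= !lt_neqAle (eq_sym 0) x0 x2.
  have /andP[l0 l1] := lI x.
  rewrite patchE; have [xlb|bx|E] := ltgtP x b; last by rewrite E eqxx in xb.
    rewrite mem_set /= ?in_itv /= ?h0 // -[X in _ --> X]mul1r.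
    apply: cvgM; last exact: cvg_cst.
    apply: cvg_step_lt; rewrite l0 /= /level.
    by have := @cos_diff_gt0 b x; rewrite h0 xlb => /(_ isT b2); lra.
  rewrite memNset; last by rewrite /= in_itv /= => /andP[_]; rewrite ltNge (ltW bx).
  rewrite -[X in _ --> X](mul0r (g x)); apply: cvgM; last exact: cvg_cst.
  apply: cvg_step_gt; rewrite l1 andbT /level.
  by have := @cos_diff_lt0 b x; rewrite b0 bx => /(_ isT h2); lra.
- exact: integrable_norm.
- move=> n x _; have /andP[h1 h2] := PI n x.
  by rewrite normrM ler_piMl // ger0_norm.
Unshelve. all: by end_near. Qed.

Lemma fourier_unique : {ae mu, forall x, x \in `[0, 2 * pi] -> g x = 0}.
Proof.
apply: ae_eq0_of_itv => // c d c0 d2.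
have [cd|dc] := ltP c d; last by rewrite set_itv_ge ?Rintegral_set0 // bnd_simp -leNgt.
have I0d : mu.-integrable `]0, d[ (EFin \o g).
  apply: integrableS Ig => // x; rewrite /= !in_itv /= => /andP[x0 xd].
  by rewrite !ltW // (lt_trans xd).
have d0 : 0 < d by exact: lt_trans cd.
have := @Rintegral_itvB R g (BRight 0) (BLeft d) c I0d.
rewrite !bnd_simp (ltW c0) cd => /(_ isT isT) <-.
rewrite Rintegral_itv0 ?d0 // -Rintegral_itv_bndo_bndc.
  by rewrite Rintegral_itv0 ?subrr // c0 (lt_trans cd).
apply: integrableS I0d => // x; rewrite /= !in_itv /= => /andP[x0 xc].
by rewrite x0 (lt_trans xc).
Qed.

End FourierUniqueness.

(** * Joint measurability of functions continuous in one variable *)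

Section CaratheodoryFunctions.
Context d (T : measurableType d) (R : realType).
Let mR := measurableTypeR R.

Let grid (n : nat) (r : R) : R := (Num.floor (r * n.+1%:R))%:~R / n.+1%:R.

Lemma cvg_grid (r : R) : (fun n => grid n r) @ \oo --> r.
Proof.
apply: (@squeeze_cvgr _ _ _ _ (fun n => r - n.+1%:R^-1) (fun=> r)).
- apply: nearW => n; have n0 : 0 < n.+1%:R :> R by rewrite ltr0n.
  have /andP[h1 h2] := mem_rg1_floor (r * n.+1%:R).
  rewrite /grid ler_pdivlMr // ler_pdivrMr // mulrBl mulVf ?gt_eqF //.
  by apply/andP; split; [rewrite lerBlDr ltW|].
- rewrite -[X in _ --> X]subr0; apply: cvgB; first exact: cvg_cst.
  exact: cvg_harmonic.
- exact: cvg_cst.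
Qed.

(** Rounding the second variable down to a grid of step [1 / (n + 1)] makes preimages countable
    unions of measurable rectangles; continuity in that variable recovers [f] as a pointwise
    limit. *)
Lemma measurable_caratheodory (f : T * mR -> R) :
  (forall r : R, measurable_fun [set: T] (fun t => f (t, r))) ->
  (forall t, continuous (fun r : R => f (t, r))) ->
  measurable_fun [set: T * mR] f.
Proof.
move=> mf cf.
apply: (@measurable_fun_cvg _ _ _ _ (fun n p => f (p.1, grid n p.2))) => [n|[t r] _]; last first.
  exact: (cvg_comp _ _ (@cvg_grid r) (cf t r)).
move=> _ B mB; rewrite setTI.
have n0 : 0 < n.+1%:R :> R by rewrite ltr0n.
have -> : (fun p : T * mR => f (p.1, grid n p.2)) @^-1` B =
  \bigcup_(k in [set: int]) (((fun t => f (t, k%:~R / n.+1%:R)) @^-1` B) `*`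
     [set` `[k%:~R / n.+1%:R, (k + 1)%:~R / n.+1%:R[ ]).
  apply/seteqP; split => [[t r] /= Br|[t r] [k _ [/= Bk]]].
    exists (Num.floor (r * n.+1%:R)) => //; split => //=.
    have /andP[h1 h2] := mem_rg1_floor (r * n.+1%:R).
    by rewrite in_itv /= ler_pdivrMr // ltr_pdivlMr // h1 intrD.
  rewrite in_itv /= ler_pdivrMr // ltr_pdivlMr // => kr.
  by rewrite /grid (floor_def kr).
apply: countable_bigcupT_measurable; first exact: countableP.
move=> k; apply: measurableX; last exact: measurable_itv.
by rewrite -[X in measurable X]setTI; exact: mf.
Qed.

End CaratheodoryFunctions.

(** * Measure theory on three-space with [y] as outer variable *)

Section Space.
Variable R : realType.
Local Notation mu := (@lebesgue_measure R).
Let mR := measurableTypeR R.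
Let mR3 := (mR * mR * mR)%type.

(** The sigma-algebra is the iterated product one, so measurability is obtained one coordinate at a
    time from separate continuity. *)
Lemma continuous_measurable3 (f : R * R * R -> R) : continuous f ->
  measurable_fun [set: mR3] f.
Proof.
move=> cf; have c1 (y z : R) : continuous (fun x : R => f (x, y, z)).
  move=> x; apply: (@continuous_comp _ _ _ (fun x : R => (x, y, z)) f); last exact: cf.
  exact: (cvg_pair (cvg_pair cvg_id (cvg_cst _)) (cvg_cst _)).
have c2 (x z : R) : continuous (fun y : R => f (x, y, z)).
  move=> y; apply: (@continuous_comp _ _ _ (fun y : R => (x, y, z)) f); last exact: cf.
  exact: (cvg_pair (cvg_pair (cvg_cst _) cvg_id) (cvg_cst _)).
have c3 (p : R * R) : continuous (fun z : R => f (p, z)).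
  move=> z; apply: (@continuous_comp _ _ _ (fun z : R => (p, z)) f); last exact: cf.
  exact: (cvg_pair (cvg_cst _) cvg_id).
apply: measurable_caratheodory => [z|p]; last exact: c3.
apply: (@measurable_caratheodory _ mR R (fun p : mR * mR => f (p, z))) => [y|x]; last exact: c2.
exact: continuous_measurable_fun.
Qed.

(** Brings [y] to the outside, so that sections at fixed [y] are functions on the torus of
    [(x, z)]. *)
Definition swap_xy (q : R * (R * R)) : R * R * R := ((q.2.1, q.1), q.2.2).

Let sig : mR * (mR * mR) -> mR3 := swap_xy.

Lemma measurable_swap_xy : measurable_fun [set: mR * (mR * mR)] sig.
Proof.
apply: measurable_fun_pair; last exact: (measurableT_comp measurable_snd measurable_snd).
apply: measurable_fun_pair; last exact: measurable_fst.
exact: (measurableT_comp measurable_fst measurable_snd).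
Qed.

Definition leb2 : set (mR * mR)%type -> \bar R := (mu \x mu)%E.

HB.instance Definition _ := Measure.on leb2.

Let leb2_sigma_finite : sigma_finite [set: mR * mR] leb2.
Proof.
have /sigma_finiteP[F [TF ndF Foo]] := sigma_finiteT mu.
exists (fun n => F n `*` F n).
  apply/seteqP; split=> // -[x y] _.
  have : [set: R] x by []. have : [set: R] y by [].
  rewrite TF => -[k _ Fy] [n _ Fx]; exists (maxn n k) => //; split.
    by move: x Fx; exact/subsetPset/ndF/leq_maxl.
  by move: y Fy; exact/subsetPset/ndF/leq_maxr.
move=> k; have [mF Fk] := Foo k.
split; first exact: measurableX.
by rewrite /leb2 product_measure1E // lte_mul_pinfty // ge0_fin_numE.
Qed.

HB.instance Definition _ := Measure_isSigmaFinite.Build _ _ _ leb2 leb2_sigma_finite.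

Definition nu : set (mR * (mR * mR))%type -> \bar R := (mu \x leb2)%E.

HB.instance Definition _ := Measure.on nu.

(** Both sides are unfolded by Tonelli into iterated integrals in which [y] is integrated after [x]
    and [z]. *)
Lemma tonelli_swap_xy (f : mR3 -> \bar R) : (forall p, 0 <= f p)%E ->
  measurable_fun [set: mR3] f ->
  (\int[@leb3 R]_p f p = \int[nu]_q f (swap_xy q))%E.
Proof.
move=> f0 mf.
have mfs : measurable_fun [set: mR * (mR * mR)] (fun q => f (swap_xy q)).
  exact: (measurableT_comp mf measurable_swap_xy).
have mF := @measurable_fun_fubini_tonelli_F _ _ _ _ R mu f mf f0.
have F0 p : (0 <= fubini_F mu f p)%E by exact: integral_ge0.
transitivity (\int[leb2]_p fubini_F mu f p)%E.
  exact: (@fubini_tonelli1 _ _ _ _ R leb2 mu f mf f0).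
transitivity (\int[mu]_y \int[mu]_x fubini_F mu f (x, y))%E.
  exact: (@fubini_tonelli2 _ _ _ _ R mu mu _ mF F0).
transitivity (\int[mu]_y \int[leb2]_r f (swap_xy (y, r)))%E; last first.
  by apply/esym; exact: (@fubini_tonelli1 _ _ _ _ R mu leb2 (fun q => f (swap_xy q)) mfs (fun q => f0 _)).
apply: eq_integral => y _; apply/esym.
apply: (@fubini_tonelli1 _ _ _ _ R mu mu (fun q => f (swap_xy (y, q))) _ (fun q => f0 _)).
exact: (measurableT_comp mfs (pair1_measurable y)).
Qed.

Lemma integrable_swap_xy (f : mR3 -> \bar R) : measurable_fun [set: mR3] f ->
  (@leb3 R).-integrable [set: mR3] f <->
  nu.-integrable [set: mR * (mR * mR)] (fun q => f (swap_xy q)).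
Proof.
move=> mf.
have mfs : measurable_fun [set: mR * (mR * mR)] (fun q => f (swap_xy q)).
  exact: (measurableT_comp mf measurable_swap_xy).
have E : (\int[@leb3 R]_p `|f p| = \int[nu]_q `|f (swap_xy q)|)%E.
  by rewrite tonelli_swap_xy //; exact: measurableT_comp.
by split => /integrableP[_ h]; apply/integrableP; split => //; rewrite ?E // -E.
Qed.

Lemma integral_swap_xy (f : mR3 -> \bar R) : measurable_fun [set: mR3] f ->
  (\int[@leb3 R]_p f p = \int[nu]_q f (swap_xy q))%E.
Proof.
move=> mf.
have pos : (\int[@leb3 R]_p f^\+ p = \int[nu]_q (fun q => f (swap_xy q))^\+ q)%E.
  rewrite (tonelli_swap_xy (@funepos_ge0 _ _ f) (measurable_funepos mf)).
  by apply: eq_integral => q _; rewrite !unlock.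
have neg : (\int[@leb3 R]_p f^\- p = \int[nu]_q (fun q => f (swap_xy q))^\- q)%E.
  rewrite (tonelli_swap_xy (@funeneg_ge0 _ _ f) (measurable_funeneg mf)).
  by apply: eq_integral => q _; rewrite !unlock.
by rewrite integralE pos neg -integralE.
Qed.

End Space.

(** * Partial derivatives and functions of class C^n on open sets *)

Section Calculus3.
Variable R : realType.
Implicit Types (f g : R * R * R -> R) (p q v : R * R * R) (U : set (R * R * R)).

Definition ix : 'I_3 := @Ordinal 3 0 isT.
Definition iy : 'I_3 := @Ordinal 3 1 isT.
Definition iz : 'I_3 := @Ordinal 3 2 isT.

Definition pd (i : 'I_3) f : R * R * R -> R := fun p => 'D_(evec R i) f p.

Lemma ord3P (P : 'I_3 -> Prop) : P ix -> P iy -> P iz -> forall i, P i.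
Proof.
move=> Px Py Pz [[|[|[|//]]] H]; [rewrite (_ : Ordinal H = ix)|
  rewrite (_ : Ordinal H = iy)|rewrite (_ : Ordinal H = iz)] => //; exact: val_inj.
Qed.

Lemma is_derive_xc p v : is_derive p v (@xc R) (xc v).
Proof.
apply/is_deriveP/cvgrPdist_le => e e0; near=> h; rewrite /xc /=.
have h0 : h != 0 by near: h; exact: nbhs_dnbhs_neq.
by rewrite addrK /GRing.scale /= mulKf // subrr normr0 ltW.
Unshelve. all: by end_near. Qed.

Lemma is_derive_yc p v : is_derive p v (@yc R) (yc v).
Proof.
apply/is_deriveP/cvgrPdist_le => e e0; near=> h; rewrite /yc /=.
have h0 : h != 0 by near: h; exact: nbhs_dnbhs_neq.
by rewrite addrK /GRing.scale /= mulKf // subrr normr0 ltW.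
Unshelve. all: by end_near. Qed.

Lemma is_derive_zc p v : is_derive p v (@zc R) (zc v).
Proof.
apply/is_deriveP/cvgrPdist_le => e e0; near=> h; rewrite /zc /=.
have h0 : h != 0 by near: h; exact: nbhs_dnbhs_neq.
by rewrite addrK /GRing.scale /= mulKf // subrr normr0 ltW.
Unshelve. all: by end_near. Qed.

Lemma is_derive_slice f (x y z l : R) :
  (is_derive (x, y, z) (evec R ix) f l <-> is_derive x 1 (fun t => f (t, y, z)) l) *
  ((is_derive (x, y, z) (evec R iy) f l <-> is_derive y 1 (fun t => f (x, t, z)) l) *
  (is_derive (x, y, z) (evec R iz) f l <-> is_derive z 1 (fun t => f (x, y, t)) l)).
Proof.
have E (F G : R -> R) : F =1 G -> F @ 0^' --> l <-> G @ 0^' --> l by move=> /funext ->.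
have s1 (h u : R) : h *: (1 : R) + u = h + u by rewrite [h *: 1]mulr1.
have s0 (h u : R) : h *: (0 : R) + u = u by rewrite scaler0 add0r.
have ev (h : R) i : h *: evec R i + (x, y, z) =
    (h *: ((i == 0%N :> nat)%:R : R) + x, h *: ((i == 1%N :> nat)%:R : R) + y, h *: ((i == 2%N :> nat)%:R : R) + z) by [].
split; [|split]; rewrite !is_deriveP; apply: E => h; rewrite ev /= !s1 !s0 //.
Qed.

Lemma pdE f p i l : is_derive p (evec R i) f l -> pd i f p = l.
Proof. by move=> d; exact: derive_val. Qed.

Lemma is_derive_pd f p i : derivable f p (evec R i) -> is_derive p (evec R i) f (pd i f p).
Proof. by move=> d; split. Qed.

Lemma Cn_on_continuous n U f p : Cn_on n U f -> U p -> {for p, continuous f}.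
Proof. by case: n => [|n] [cf _] Up; exact: cf. Qed.

Lemma Cn_on_derive n U f p i : Cn_on n.+1 U f -> U p ->
  is_derive p (evec R i) f (pd i f p).
Proof. by move=> [_ /(_ i) [d _]] Up; apply: is_derive_pd; exact: d. Qed.

Lemma Cn_on_pd n U f i : Cn_on n.+1 U f -> Cn_on n U (pd i f).
Proof. by move=> [_ /(_ i) []]. Qed.

Lemma Cn_onW n U f : Cn_on n.+1 U f -> Cn_on n U f.
Proof.
elim: n f => [|n IH] f; first by move=> [cf _]; split.
by move=> [cf df]; split => // i; have [d C] := df i; split => //; exact: IH.
Qed.

Lemma near_open U p : open U -> U p -> \forall q \near p, U q.
Proof. by move=> oU Up; exact: open_nbhs_nbhs. Qed.

Lemma Cn_on_ext n U f g : open U -> (forall p, U p -> f p = g p) -> Cn_on n U f -> Cn_on n U g.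
Proof.
move=> oU; elim: n f g => [|n IH] f g fg [cf df].
  split => // p Up; suff : g @ p --> f p by rewrite (fg p Up).
  apply: cvg_trans (cf p Up); apply: near_eq_cvg.
  by apply: filterS (near_open oU Up) => q; exact: fg.
have fgn p : U p -> \near p, f p = g p.
  by move=> Up; apply: filterS (near_open oU Up) => q; exact: fg.
split.
  move=> p Up; suff : g @ p --> f p by rewrite (fg p Up).
  by apply: cvg_trans (cf p Up); apply: near_eq_cvg; exact: fgn.
move=> i; have [d C] := df i; split.
  by move=> p Up; exact: near_eq_derivable (fgn p Up) (d p Up).
by apply: IH C => p Up; apply: near_eq_derive; exact: fgn.
Qed.

(** Introduction rule with explicit candidates for the partial derivatives, which need to be correct
    only on [U]. *)
Lemma Cn_onI n U f (f' : 'I_3 -> R * R * R -> R) : open U ->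
  (forall p, U p -> {for p, continuous f}) ->
  (forall i p, U p -> is_derive p (evec R i) f (f' i p)) ->
  (forall i, Cn_on n U (f' i)) -> Cn_on n.+1 U f.
Proof.
move=> oU cf df Cf'; split => // i; split; first by move=> p /(df i) [].
by apply: (Cn_on_ext oU) (Cf' i) => p Up; rewrite -(pdE (df i p Up)).
Qed.

Lemma Cn_on_cst n U c : open U -> Cn_on n U (fun=> c).
Proof.
move=> oU; elim: n c => [|n IH] c; first by split => // p _; exact: cvg_cst.
apply: (Cn_onI (f' := fun _ => fun=> 0) oU) => //; first by move=> p _; exact: cvg_cst.
Qed.

Lemma Cn_onD n U f g : open U -> Cn_on n U f -> Cn_on n U g ->
  Cn_on n U (fun p => f p + g p).
Proof.
move=> oU; elim: n f g => [|n IH] f g Cf Cg.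
  by split => // p Up; apply: cvgD; [exact: Cn_on_continuous Cf Up|exact: Cn_on_continuous Cg Up].
apply: (Cn_onI (f' := fun i p => pd i f p + pd i g p) oU).
- by move=> p Up; apply: cvgD; [exact: Cn_on_continuous Cf Up|exact: Cn_on_continuous Cg Up].
- by move=> i p Up; apply: is_derive_add; [exact: Cn_on_derive Cf Up|exact: Cn_on_derive Cg Up].
- by move=> i; apply: IH; exact: Cn_on_pd.
Qed.

Lemma Cn_onM n U f g : open U -> Cn_on n U f -> Cn_on n U g ->
  Cn_on n U (fun p => f p * g p).
Proof.
move=> oU; elim: n f g => [|n IH] f g Cf Cg.
  by split => // p Up; apply: cvgM; [exact: Cn_on_continuous Cf Up|exact: Cn_on_continuous Cg Up].
apply: (Cn_onI (f' := fun i p => pd i f p * g p + f p * pd i g p) oU).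
- by move=> p Up; apply: cvgM; [exact: Cn_on_continuous Cf Up|exact: Cn_on_continuous Cg Up].
- by move=> i p Up; apply: is_derive_mul; [exact: Cn_on_derive Cf Up|exact: Cn_on_derive Cg Up].
- by move=> i; apply: (Cn_onD oU); apply: IH; try exact: Cn_on_pd; exact: Cn_onW.
Qed.

(** A form of the mean value theorem that does not depend on the sign of the increment. *)
Lemma MVT_abs (phi : R -> R) (dphi : R -> R) (a h : R) :
  (forall t, `|t - a| <= `|h| -> is_derive t 1 phi (dphi t)) ->
  exists2 c, `|c - a| <= `|h| & phi (h + a) - phi a = dphi c * h.
Proof.
move=> H; have [h0|h0] := leP 0 h.
  have [|||c] := @MVT_segment R phi dphi a (h + a).
  - by rewrite lerDr.
  - move=> t; rewrite in_itv /= => /andP[at' th]; apply: H.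
    rewrite (ger0_norm h0) ger0_norm; lra.
  - apply: derivable_within_continuous => t; rewrite in_itv /= => /andP[at' th].
    have [|//] := H t _; rewrite (ger0_norm h0) ger0_norm; lra.
  rewrite in_itv /= => /andP[ac ch] E; exists c; last by rewrite E addrK.
  by rewrite (ger0_norm h0) ger0_norm; lra.
have [|||c] := @MVT_segment R phi dphi (h + a) a.
- by rewrite gerDr ltW.
- move=> t; rewrite in_itv /= => /andP[at' th]; apply: H.
  rewrite (ltr0_norm h0) ler0_norm; lra.
- apply: derivable_within_continuous => t; rewrite in_itv /= => /andP[at' th].
  have [|//] := H t _; rewrite (ltr0_norm h0) ler0_norm; lra.
rewrite in_itv /= => /andP[hc ca] E; exists c.
  by rewrite (ltr0_norm h0) ler0_norm; lra.
by rewrite -opprB E; ring.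
Qed.

(** The derivative along [X1] is taken in an oblique direction, whereas [Cn_on] speaks of partial
    derivatives. The increment is split into a step along [x], controlled by the mean value theorem
    and the continuity of [pd ix f], and a step along [z], where the one-variable chain rule
    suffices. *)
Lemma is_derive_dir U f (x y z c : R) : open U -> Cn_on 1 U f -> U (x, y, z) ->
  is_derive (x, y, z) (1, 0, c) f (pd ix f (x, y, z) + c * pd iz f (x, y, z)).
Proof.
move=> oU Cf Up.
have dz := (is_derive_slice f x y z _).2.2.1 (Cn_on_derive iz Cf Up).
have dB : is_derive (0 : R) 1 (fun h : R => f (x, y, c * h + z)) (pd iz f (x, y, z) * c).
  have := is_derive_chain1 (g := fun t => f (x, y, t)) (is_derive_affine c z 0).
  by rewrite mulr0 add0r; apply.
apply/is_deriveP.
have -> : (fun h : R => h^-1 *: (f (h *: ((1, 0, c) : R * R * R) + (x, y, z)) - f (x, y, z))) =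
  (fun h => h^-1 * (f (h + x, y, c * h + z) - f (x, y, c * h + z)) +
            h^-1 *: (f (x, y, c * (h *: (1 : R) + 0) + z) - f (x, y, c * 0 + z))).
  apply/funext => h; rewrite [h *: (1 : R)]mulr1 addr0 mulr0 add0r.
  rewrite (_ : h *: ((1, 0, c) : R * R * R) + (x, y, z) = (h + x, y, c * h + z)); last first.
    congr (_, _, _); [exact: (congr1 (+%R^~ x) (mulr1 h))|exact: (etrans (congr1 (+%R^~ y) (mulr0 h)) (add0r y))|].
    exact: (congr1 (+%R^~ z) (mulrC h c)).
  by rewrite /GRing.scale /= -mulrDr; congr (_ * _); ring.
rewrite [X in _ --> X](_ : _ = pd ix f (x, y, z) + pd iz f (x, y, z) * c); last by rewrite mulrC.
apply: cvgD; last by move/is_deriveP : dB.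
have cx : {for (x, y, z), continuous (pd ix f)} := Cn_on_continuous (Cn_on_pd ix Cf) Up.
apply/cvgrPdist_le => e e0.
move/cvgrPdist_le : cx => /(_ e e0) cx.
have /nbhs_ballP[r /= r0 Hr] : nbhs (x, y, z) [set q | U q /\ `|pd ix f (x, y, z) - pd ix f q| <= e].
  by apply: filterI; [exact: near_open|exact: cx].
near=> h.
have h0 : h != 0 by near: h; exact: nbhs_dnbhs_neq.
have hr : `|h| < r by near: h; exact: dnbhs0_lt.
have hcr : `|c * h| < r.
  rewrite normrM; apply: (@le_lt_trans _ _ ((`|c| + 1) * `|h|)); first by rewrite ler_wpM2r // lerDl.
  rewrite mulrC -ltr_pdivlMr ?ltr_wpDl //; near: h; apply: dnbhs0_lt.
  by rewrite divr_gt0 // ltr_wpDl.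
have inb t : `|t - x| <= `|h| -> ball (x, y, z) r (t, y, c * h + z).
  move=> th; split => /=; last by rewrite /ball /= opprD addrCA subrr addr0 normrN.
  split; last exact: ballxx.
  by rewrite /ball /= distrC (le_lt_trans th).
have [|t th E] := @MVT_abs (fun t => f (t, y, c * h + z)) (fun t => pd ix f (t, y, c * h + z)) x h.
  move=> t th; have [Ut _] := Hr _ (inb t th).
  exact: (is_derive_slice f t y (c * h + z) _).1.1 (Cn_on_derive ix Cf Ut).
rewrite E mulrCA mulVf // mulr1.
by have [_] := Hr _ (inb t th).
Unshelve. all: by end_near. Qed.

End Calculus3.

(** * The frame, its bracket and the Popp density *)

Section Frame.
Variable R : realType.
Implicit Types (f g : R * R * R -> R) (p q v : R * R * R) (U : set (R * R * R)).

Definition off0 : set (R * R * R) := [set p | yc p != 0].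

Lemma off0E : ~` @singular_set R = off0.
Proof. by apply/seteqP; split => p /=; rewrite /singular_set /= => /eqP. Qed.

Lemma continuous_yc : continuous (@yc R).
Proof. by move=> p; apply: (@continuous_comp _ _ _ fst snd); [exact: cvg_fst|exact: cvg_snd]. Qed.

Lemma open_off0 : open off0.
Proof.
rewrite (_ : off0 = @yc R @^-1` [set y | y != 0]).
  by apply: open_comp; [move=> p _; exact: continuous_yc|exact: open_neq].
by [].
Qed.

Lemma Cn_on_subset n U V f : V `<=` U -> Cn_on n U f -> Cn_on n V f.
Proof.
move=> VU; elim: n f => [|n IH] f [cf df]; first by split=> // p /VU; exact: cf.
split; first by move=> p /VU; exact: cf.
by move=> i; have [d C] := df i; split; [move=> p /VU; exact: d|exact: IH].
Qed.

Lemma Cn_on_setU n U V f : Cn_on n U f -> Cn_on n V f -> Cn_on n (U `|` V) f.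
Proof.
elim: n f => [|n IH] f [cU dU] [cV dV].
  by split => // p [/cU|/cV].
split; first by move=> p [/cU|/cV].
move=> i; have [d C] := dU i; have [d' C'] := dV i.
by split; [move=> p [/d|/d']|exact: IH].
Qed.

Lemma is_derive_comp_yc (h : R -> R) l p i : is_derive (yc p) 1 h l ->
  is_derive p (evec R i) (fun q => h (yc q)) ((i == iy)%:R * l).
Proof.
move=> dh; have dc := is_derive_chain (is_derive_yc p (evec R i)) dh.
by apply: is_derive_eq dc _; rewrite mulrC.
Qed.

Lemma Cn_on_comp_yc n (h : R -> R) : Cn1 n h -> Cn_on n setT (fun p => h (yc p)).
Proof.
elim: n h => [|n IH] h.
  move=> ch; split => // p _.
  by apply: (@continuous_comp _ _ _ (@yc R) h); [exact: continuous_yc|exact: ch].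
move=> Ch; have [h1 [dh Ch1]] := Ch.
apply: (@Cn_onI _ _ _ _ (fun i p => (i == iy)%:R * h1 (yc p)) openT).
- move=> p _; apply: (@continuous_comp _ _ _ (@yc R) h); first exact: continuous_yc.
  exact: is_derive_continuous (dh _).
- by move=> i p _; exact: is_derive_comp_yc.
- by move=> i; apply: (Cn_onM openT); [exact: Cn_on_cst openT|exact: IH].
Qed.

Definition sy p : R := yc p ^+ 2 / 2.

Lemma smooth1_sq : smooth1 (fun y : R => y ^+ 2 / 2).
Proof.
by move=> n; apply: Cn1M; [apply: Cn1M; exact: smooth1_id|exact: Cn1_cst].
Qed.

Lemma Cn_on_sy n : Cn_on n setT sy.
Proof.
by apply: (@Cn_on_comp_yc n (fun y => y ^+ 2 / 2)); exact: smooth1_sq.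
Qed.

Lemma continuous_inv_yc p : off0 p -> {for p, continuous (fun q => (yc q)^-1)}.
Proof. by move=> p0; apply: cvgV => //; exact: continuous_yc. Qed.

Lemma Cn_on_inv_yc n : Cn_on n off0 (fun p => (yc p)^-1).
Proof.
elim: n => [|n IH]; first by split=> // p; exact: continuous_inv_yc.
apply: (@Cn_onI _ _ _ _ (fun i p => (i == iy)%:R * (-1 * ((yc p)^-1 * (yc p)^-1))) open_off0).
- by move=> p; exact: continuous_inv_yc.
- move=> i p p0; have := is_derive_comp_yc i (is_derive_inv p0).
  by move=> h; apply: is_derive_eq h _; rewrite expr2 invfM mulN1r.
- move=> i; apply: (Cn_onM open_off0); first exact: Cn_on_cst open_off0.
  by apply: (Cn_onM open_off0); [exact: Cn_on_cst open_off0|exact: (Cn_onM open_off0)].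
Qed.

(** The Popp density; it takes the value [0] on [y = 0], as the inverse of zero is zero. *)
Definition wy p : R := `|yc p|^-1.

Lemma is_derive_wy p i : off0 p ->
  is_derive p (evec R i) wy ((i == iy)%:R * (- (wy p * (yc p)^-1))).
Proof.
rewrite /off0 /wy => /= p0.
apply: (@is_derive_comp_yc (fun y => `|y|^-1)); have [y0|y0] := ltP (yc p) 0.
  have := is_derive_scale (-1) (is_derive_inv p0).
  move=> h; apply: is_derive_eq (near_eq_is_derive _ h) _.
    by apply: filterS (lt_nbhsl y0) => y yn; rewrite ltr0_norm // invrN mulN1r.
  by rewrite ltr0_norm //; field.
have {}y0 : 0 < yc p by rewrite lt_def p0.
move: (is_derive_inv p0) => h; apply: is_derive_eq (near_eq_is_derive _ h) _.
  by apply: filterS (lt_nbhsr y0) => y yn; rewrite gtr0_norm.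
by rewrite gtr0_norm //; field.
Qed.

Lemma Cn_on_wy n : Cn_on n off0 wy.
Proof.
have cw p : off0 p -> {for p, continuous wy}.
  move=> p0; apply: cvgV; first by rewrite normr_eq0.
  by apply: (@continuous_comp _ _ _ (@yc R) Num.norm); [exact: continuous_yc|exact: norm_continuous].
elim: n => [|n IH]; first by split=> // p; exact: cw.
apply: (@Cn_onI _ _ _ _ (fun i p => (i == iy)%:R * (-1 * (wy p * (yc p)^-1))) open_off0).
- exact: cw.
- move=> i p p0; apply: is_derive_eq (is_derive_wy i p0) _.
  by rewrite mulN1r.
- move=> i; apply: (Cn_onM open_off0); first exact: Cn_on_cst open_off0.
  by apply: (Cn_onM open_off0); [exact: Cn_on_cst open_off0|apply: (Cn_onM open_off0) => //; exact: Cn_on_inv_yc].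
Qed.

Lemma bracketE p : bracket (@X1 R) (@X2 R) p = (0, 0, - yc p).
Proof.
rewrite /bracket.
have -> : 'D_(@X1 R p) (@X2 R) p = 0 by exact: derive_cst.
have -> : 'D_(@X2 R p) (@X1 R) p = (0, 0, yc p).
  case: p => -[x y] z; rewrite /yc /=.
  have dh : (fun h : R => h^-1 * ((h + y) ^+ 2 / 2 - y ^+ 2 / 2)) @ 0^' --> y.
    have : is_derive y 1 (fun t => 2^-1 * t ^+ 2) y.
      apply: is_derive_eq (is_derive_scale 2^-1 (is_derive_pow 2 (is_derive_id y (1 : R)))) _.
      by rewrite /= mulr1 expr1; field.
    move=> /is_deriveP; apply: cvg_trans; apply: near_eq_cvg; apply: nearW => h.
    by rewrite [h *: 1]mulr1 ![2^-1 * _]mulrC.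
  pose W : normedModType R := (R * R * R)%type.
  suff : (fun h : R => h^-1 *: ((@X1 R) (h *: ((0, 1, 0) : W) + (x, y, z)) - (@X1 R) (x, y, z)) : W) @ 0^' --> ((0, 0, y) : W).
    exact: (@cvg_lim W (@norm_hausdorff _ W)).
  rewrite (_ : (fun h : R => _ *: _) = (fun h : R => (0, 0, h^-1 * ((h + y) ^+ 2 / 2 - y ^+ 2 / 2)) : R * R * R)).
    exact: (cvg_pair (cvg_pair (cvg_cst _) (cvg_cst _)) dh).
  apply/funext => h; rewrite /X1 /yc /=.
  have e : h *: (1 : R) = h := mulr1 h.
  by congr (_, _, _); rewrite /= ?e ?subrr ?scaler0.
by congr (_, _, _); rewrite /= ?sub0r ?oppr0.
Qed.

Lemma poppE p : popp (@X1 R) (@X2 R) p = wy p.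
Proof.
rewrite /popp det_inv normfV /wy; congr (_^-1).
suff -> : \det (frame_mx (@X1 R) (@X2 R) p) = - yc p by rewrite normrN.
(* The frame matrix is lower triangular with diagonal [1], [1], [- y]. *)
rewrite det_trig; last first.
  by apply/is_trig_mxP; apply: ord3P; apply: ord3P => //; rewrite !mxE ?bracketE.
by rewrite !big_ord_recl big_ord0 !mxE bracketE /pcoord /= !mul1r mulr1.
Qed.

End Frame.

(** * The sub-Laplacian in coordinates *)

Section Laplacian.
Variable R : realType.
Implicit Types (f g : R * R * R -> R) (p q v : R * R * R) (U : set (R * R * R)).

(** [X1] expressed through partial derivatives: it agrees with [vderiv X1] where [f] is of class
    C^1, and it can be iterated inside the calculus of [pd]. *)
Definition Xd f p := pd ix f p + sy p * pd iz f p.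

Lemma Cn_on_Xd n U f : open U -> Cn_on n.+1 U f -> Cn_on n U (Xd f).
Proof.
move=> oU Cf; apply: (Cn_onD oU); first exact: Cn_on_pd.
apply: (Cn_onM oU); last exact: Cn_on_pd.
by apply: Cn_on_subset (@Cn_on_sy R n).
Qed.

Lemma vderivX1E U f p : open U -> Cn_on 1 U f -> U p -> vderiv (@X1 R) f p = Xd f p.
Proof.
case: p => -[x y] z oU Cf Up.
exact: (@derive_val _ _ _ _ _ _ _ (is_derive_dir (y ^+ 2 / 2) oU Cf Up)).
Qed.

Lemma vderivX2E f p : vderiv (@X2 R) f p = pd iy f p.
Proof. by []. Qed.

Lemma vderivX1XE U f p : open U -> Cn_on 2 U f -> U p ->
  vderiv (@X1 R) (vderiv (@X1 R) f) p = Xd (Xd f) p.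
Proof.
move=> oU Cf Up; rewrite -(vderivX1E oU (Cn_on_Xd oU Cf) Up).
apply: near_eq_derive; apply: filterS (near_open oU Up) => q Uq.
by rewrite (vderivX1E oU (Cn_onW Cf)).
Qed.

(** The density depends on [y] alone and has logarithmic derivative [- 1 / y], the source of the
    first-order term. The coefficient [sy] does not depend on [z], so [X1] contributes no such
    term. *)
Lemma lap_srE f p : Cn_on 2 (@off0 R) f -> off0 p ->
  lap_sr (@X1 R) (@X2 R) f p =
  Xd (Xd f) p + pd iy (pd iy f) p - (yc p)^-1 * pd iy f p.
Proof.
move=> Cf p0; have oU := @open_off0 R.
have w0 : wy p != 0 by rewrite invr_eq0 normr_eq0.
have C1 := Cn_onW Cf; have CX := Cn_on_Xd oU Cf.
have dX i := Cn_on_derive i CX p0; have dY := Cn_on_derive iy (Cn_on_pd iy Cf) p0.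
have dw i := is_derive_wy i p0.
have ds : is_derive p (evec R iz) (@sy R) 0.
  have [h1 [dh _]] := @smooth1_sq R 1%N.
  by apply: is_derive_eq (is_derive_comp_yc iz (dh (yc p))) _; rewrite mul0r.
have near0 := near_open oU p0.
rewrite /lap_sr /div_wrt (_ : popp _ _ = @wy R); last by apply/funext => q; exact: poppE.
have gradE q : off0 q -> grad_sr (@X1 R) (@X2 R) f q = (Xd f q, pd iy f q, sy q * Xd f q).
  move=> q0; rewrite /grad_sr (vderivX1E oU C1 q0) vderivX2E.
  have e (a b : R) : a *: (b : R) = a * b by [].
  by congr (_, _, _); rewrite /= !e ?mulr1 ?mulr0 ?addr0 ?add0r // mulrC.
(* The formula for the gradient holds only off [y = 0], so it is substituted under the derivative
   locally around [p]. *)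
have E i l g : (forall q, off0 q -> pcoord i (grad_sr (@X1 R) (@X2 R) f q) = g q) ->
    is_derive p (evec R i) (fun q => wy q * g q) l ->
    'D_(evec R i) (fun q => wy q * pcoord i (grad_sr (@X1 R) (@X2 R) f q)) p = l.
  move=> gE dg; apply: derive_val; apply: near_eq_is_derive dg.
  by apply: filterS near0 => q q0; rewrite gE.
rewrite !big_ord_recl big_ord0 addr0.
rewrite (E ix _ (Xd f) _ (is_derive_mul (dw ix) (dX ix))); last by move=> q q0; rewrite gradE.
rewrite (E iy _ (pd iy f) _ (is_derive_mul (dw iy) dY)); last by move=> q q0; rewrite gradE.
rewrite (E iz _ (fun q => sy q * Xd f q) _ (is_derive_mul (dw iz) (is_derive_mul ds (dX iz)))); last by move=> q q0; rewrite gradE.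
rewrite (_ : (ix == iy) = false) // (_ : (iz == iy) = false) // eqxx [Xd (Xd f) p]/Xd.
move: (pd ix _ p) (pd iy _ p) (pd iz _ p) => a b c.
move: (pd iy f p) (Xd f p) (sy p) (yc p)^-1 (wy p) w0 => d e s y w w0.
by rewrite /nat_of_bool; field.
Qed.

End Laplacian.

(** * Real test functions supported away from the singular set *)

Section TestFunctions.
Variable R : realType.
Implicit Types (f g u v : R * R * R -> R) (p q : R * R * R) (U : set (R * R * R)).

Lemma on_MP (T : Type) (f : R * R * R -> T) : on_M f <->
  forall p, f (p + (2 * pi, 0, 0)) = f p /\ f (p + (0, 0, 2 * pi)) = f p.
Proof.
have e x y z a b : ((x, y, z) : R * R * R) + (a, 0, b) = (x + a, y, z + b).
  by congr (_, _, _); rewrite /= ?addr0.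
split=> [H [[x y] z]|H x y z]; first by rewrite !e !addr0; exact: H.
by have := H (x, y, z); rewrite !e !addr0.
Qed.

Lemma derive_shift f (v p t : R * R * R) : (forall q, f (q + t) = f q) -> 'D_v f (p + t) = 'D_v f p.
Proof.
move=> ft; rewrite /derive; set F := (X in fmap X); set G := (X in _ = lim (fmap X _)).
suff -> : F = G by [].
by apply/funext => h; rewrite /F /G /= addrA !ft.
Qed.

Lemma on_M_pd f i : on_M f -> on_M (pd i f).
Proof.
move=> /on_MP Mf; apply/on_MP => p.
by split; apply: derive_shift => q; have [] := Mf q.
Qed.

(* Real [C^oo] functions on [M] with compact support off [{y = 0}]. *)
Definition Ccinf u := [/\ on_M u, forall n, Cn_on n setT u &
  exists d C, 0 < d /\ forall p, u p != 0 -> d <= `|yc p| <= C].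

Lemma Ccinf_lin a u v : Ccinf u -> Ccinf v -> Ccinf (fun p => a * u p + v p).
Proof.
move=> [Mu Su [d [C [d0 Bu]]]] [Mv Sv [d' [C' [d'0 Bv]]]]; split.
- by move=> x y z; have [-> ->] := Mu x y z; have [-> ->] := Mv x y z.
- move=> n; apply: (Cn_onD openT) (Sv n); exact: (Cn_onM openT (Cn_on_cst n a openT) (Su n)).
exists (Num.min d d'), (Num.max C C'); split; first by rewrite lt_min d0.
move=> p; have [u0|/Bu /andP[h1 h2] _] := eqVneq (u p) 0; last by rewrite ge_min le_max h1 h2.
by rewrite u0 mulr0 add0r => /Bv/andP[h1 h2]; rewrite ge_min le_max h1 h2 !orbT.
Qed.

Lemma continuous_norm_yc : continuous (fun p => `|yc p| : R).
Proof.
move=> p; apply: (@continuous_comp _ _ _ (@yc R) Num.norm); first exact: continuous_yc.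
exact: norm_continuous.
Qed.

Lemma Ccinf_near0 u p d C : (forall p, u p != 0 -> d <= `|yc p| <= C) ->
  ~~ (d <= `|yc p| <= C) -> \near p, u p = 0.
Proof.
move=> Bu pB.
pose F : set (R * R * R) := (fun p => `|yc p|) @^-1` `[d, C].
have cF : closed F.
  have cD : closed (`[d, C]%classic : set R) by exact: interval_closed.
  apply: (@preimage_closed _ R (fun p : R * R * R => `|yc p|) _ _ cD) => q _; exact: continuous_norm_yc.
apply: filterS (near_open (closed_openC cF) _); last by rewrite /F /= in_itv /=; exact/negP.
by move=> q; apply: contra_notP => /eqP/Bu; rewrite /F /= in_itv.
Qed.

Lemma Ccinf_pd i u : Ccinf u -> Ccinf (pd i u).
Proof.
move=> [Mu Su [d [C [d0 Bu]]]]; split; [exact: on_M_pd|by move=> n; exact: Cn_on_pd|].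
exists d, C; split => // p; apply: contraNT => /(Ccinf_near0 Bu) near0.
apply/eqP; rewrite (pdE (near_eq_is_derive _ (is_derive_const p (evec R i) 0))) //.
by apply: filterS near0 => q ->.
Qed.

(** Such a function vanishes for [|y| < d], so its smoothness off [y = 0] glues with that of the
    zero function. *)
Lemma Ccinf_of_off0 u (d C : R) : on_M u -> (forall n, Cn_on n (@off0 R) u) -> 0 < d ->
  (forall p, u p != 0 -> d <= `|yc p| <= C) -> Ccinf u.
Proof.
move=> Mu Su d0 Bu; split => //; last by exists d, C.
move=> n; pose V : set (R * R * R) := [set p | `|yc p| < d].
have oV : open V.
  rewrite (_ : V = (fun p => `|yc p|) @^-1` [set y | y < d]); last by [].
  apply: open_comp; last exact: open_lt.
  by move=> q _; exact: continuous_norm_yc.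
have C2 : Cn_on n V u.
  apply: (Cn_on_ext oV) (Cn_on_cst n 0 oV) => p; rewrite /V /= => pd.
  have [->//|/Bu/andP[]] := eqVneq (u p) 0.
  by rewrite leNgt pd.
apply: Cn_on_subset (Cn_on_setU (Su n) C2) => p _.
have [y0|y0] := eqVneq (yc p) 0; [right|by left].
by rewrite /V /= y0 normr0.
Qed.

(** The factor [g] may be singular on [y = 0], as are [wy] and the inverse of [yc]; the support of
    [u] absorbs this. *)
Lemma Ccinf_mul g u : on_M g -> (forall n, Cn_on n (@off0 R) g) -> Ccinf u ->
  Ccinf (fun p => g p * u p).
Proof.
move=> Mg Sg [Mu Su [d [C [d0 Bu]]]]; apply: (@Ccinf_of_off0 _ d C) => //.
- by move=> x y z; have [-> ->] := Mu x y z; have [-> ->] := Mg x y z.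
- by move=> n; apply: (Cn_onM (@open_off0 R)) => //; exact: Cn_on_subset (Su n).
- by move=> p; rewrite mulf_eq0 negb_or => /andP[_]; exact: Bu.
Qed.

Lemma Ccinf_continuous u : Ccinf u -> continuous u.
Proof. by move=> [_ /(_ 0%N) [cu _] _] p; exact: cu. Qed.

Lemma Ccinf_derive u i p : Ccinf u -> is_derive p (evec R i) u (pd i u p).
Proof. by move=> [_ Su _]; exact: (Cn_on_derive i (Su 1%N) (I : setT p)). Qed.

Lemma Ccinf_Xd u : Ccinf u -> Ccinf (Xd u).
Proof.
move=> Cu; have C1 := Ccinf_pd ix Cu; have C2 := Ccinf_pd iz Cu.
rewrite (_ : Xd u = fun p => 1 * pd ix u p + sy p * pd iz u p); last first.
  by apply/funext => p; rewrite mul1r.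
apply: Ccinf_lin => //; apply: Ccinf_mul => //.
by move=> n; apply: Cn_on_subset (@Cn_on_sy R n).
Qed.

Definition lapR u p := Xd (Xd u) p + pd iy (pd iy u) p - (yc p)^-1 * pd iy u p.

Lemma Ccinf_lap u : Ccinf u -> Ccinf (lapR u).
Proof.
move=> Cu; have CX := Ccinf_Xd (Ccinf_Xd Cu); have CY := Ccinf_pd iy Cu.
have C3 : Ccinf (fun p => (yc p)^-1 * pd iy u p).
  by apply: Ccinf_mul => // n; exact: Cn_on_inv_yc.
rewrite (_ : lapR u = fun p => 1 * Xd (Xd u) p + (-1 * ((yc p)^-1 * pd iy u p) + pd iy (pd iy u) p)).
  exact: (Ccinf_lin 1 CX (Ccinf_lin (-1) C3 (Ccinf_pd iy CY))).
by apply/funext => p; rewrite /lapR mul1r mulN1r [X in _ = _ + X]addrC addrA.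
Qed.

(** Off [y = 0] this is the coordinate formula. On [y = 0] both sides vanish: the left one because
    the inverse of the density is zero there by convention, the right one by its support. *)
Lemma lap_lapR u : Ccinf u -> lap_sr (@X1 R) (@X2 R) u = lapR u.
Proof.
move=> Cu; have [_ Su _] := Cu; apply/funext => p.
have [y0|y0] := eqVneq (yc p) 0; last first.
  by rewrite lap_srE //; exact: Cn_on_subset (Su 2).
have [_ _ [d [C [d0 /(_ p) Bu]]]] := Ccinf_lap Cu.
rewrite /lap_sr /div_wrt poppE /wy y0 normr0 invr0 invr0 mul0r; apply/esym/eqP.
by apply: contraTT isT => /Bu; rewrite y0 normr0 leNgt d0.
Qed.

End TestFunctions.

(** * Integrals of partial derivatives of test functions *)

Section Integration.
Variable R : realType.
Local Notation mu := (@lebesgue_measure R).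
Let mR := measurableTypeR R.
Let mR3 := (mR * mR * mR)%type.
Implicit Types (f g u v F G : R * R * R -> R) (p q : R * R * R).

Lemma integrable_cell F (C : R) : continuous F -> (forall p, F p != 0 -> `|yc p| <= C) ->
  (@leb3 R).-integrable (@cell R) (EFin \o F).
Proof.
move=> cF BF; pose box := (`[0, 2 * pi] `*` `[-C, C]) `*` `[0, 2 * pi] : set (R * R * R).
have mbox : measurable (box : set mR3) by apply: measurableX => //; exact: measurableX.
have cbox : compact box.
  by apply: compact_setX; [apply: compact_setX|]; exact: segment_compact.
have -> : (@leb3 R).-integrable (@cell R) (EFin \o F) = (@leb3 R).-integrable box (EFin \o F).
  have E : (EFin \o F) \_ (@cell R) = (EFin \o F) \_ box.
    apply/funext => p; rewrite !patchE.
    have [F0|/BF yC] := eqVneq (F p) 0; first by rewrite /= F0; do 2 case: ifP.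
    have -> // : (p \in box) = (p \in @cell R).
    move: p yC => [[x y] z] /= yC; apply/idP/idP => /set_mem h; apply/mem_set.
      by case: h => -[/= h1 _] h2; rewrite /cell /xc /zc /=; move: h1 h2; rewrite !in_itv.
    case: h; rewrite /xc /zc /= => h1 h2; rewrite /box /= !in_itv /= -ler_norml.
    by split; first split.
  have mc : measurable (@cell R : set mR3) by exact: measurable_cell.
  by apply/idP/idP => /integrable_mkcond h; apply/integrable_mkcond => //; [rewrite -E|rewrite E]; exact: h.
apply: (@measurable_bounded_integrable _ _ _ (@leb3 R) F box mbox).
- have mi a b : measurable (`[a, b]%classic : set mR) by exact: measurable_itv.
  rewrite [X in (X < _)%E](@product_measure1E _ _ _ _ R (@leb2 R) mu _ _ (measurableX (mi 0 (2 * pi)) (mi (- C) C)) (mi 0 (2 * pi))).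
  rewrite [X in (X * _)%E](@product_measure1E _ _ _ _ R mu mu _ _ (mi 0 (2 * pi)) (mi (- C) C)).
  have fin a b : (mu `[a, b] < +oo)%E by rewrite -ge0_fin_numE // lebesgue_measure_itv /=; case: ifP.
  have finE a b : mu `[a, b] \is a fin_num by rewrite ge0_fin_numE.
  apply: lte_mul_pinfty; [by apply: mule_ge0; exact: measure_ge0|exact: (fin_numM (finE _ _) (finE _ _))|exact: fin].
- by apply: measurable_funTS; exact: continuous_measurable3.
- have := compact_bounded (continuous_compact (continuous_subspaceT cF) cbox).
  move=> [M [Mr HM]]; exists M; split => // x Mx p bp; apply: (HM x Mx).
  by exists p.
Qed.

Lemma Ccinf_integrable u : Ccinf u -> (@leb3 R).-integrable (@cell R) (EFin \o u).
Proof.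
move=> Cu; have [_ _ [d [C [_ Bu]]]] := Cu.
by apply: (@integrable_cell u C); [exact: Ccinf_continuous|move=> p /Bu/andP[]].
Qed.

Lemma integral_derive (f f' : R -> R) (a b : R) : a < b -> continuous f' ->
  (forall t : R, is_derive t 1 f (f' t)) ->
  (\int[mu]_(t in `[a, b]) (f' t)%:E = (f b - f a)%:E)%E.
Proof.
move=> ab cf' df.
have cf : continuous f by move=> t; exact: is_derive_continuous (df t).
rewrite (@continuous_FTC2 R f' f a b ab) //=.
- exact: continuous_subspaceT.
- split; first by move=> t _; have [] := df t.
  + exact: cvg_at_right_filter (cf a).
  + exact: cvg_at_left_filter (cf b).
- by move=> t _; rewrite derive1E; have [_] := df t.
Qed.

Lemma integral_derive_support (f f' : R -> R) (C : R) : continuous f' ->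
  (forall t : R, is_derive t 1 f (f' t)) ->
  (forall t, f t != 0 -> `|t| <= C) -> (forall t, f' t != 0 -> `|t| <= C) ->
  (\int[mu]_t (f' t)%:E = 0)%E.
Proof.
move=> cf' df Bf Bf'; pose c : R := `|C| + 1.
have cC : C < c by rewrite ltr_pwDr // ler_norm.
have c0 : 0 < c by rewrite ltr_wpDl.
have fc t : c <= `|t| -> f t = 0.
  by move=> tc; apply/eqP; apply: contraT => /Bf; rewrite leNgt (lt_le_trans cC).
transitivity (\int[mu]_(t in `[(- c)%R, c]) (f' t)%:E)%E; last first.
  rewrite (integral_derive _ cf' df); last by lra.
  by rewrite !fc ?subrr ?normrN ?ger0_norm // ltW.
rewrite [RHS]integral_mkcond; apply: eq_integral => t _; rewrite patchE; case: ifPn => // /negP tc.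
have [->//|/Bf' tC] := eqVneq (f' t) 0.
exfalso; apply: tc; apply/mem_set; rewrite /= in_itv /= -ler_norml.
exact: le_trans tC (ltW cC).
Qed.

Let cellE p : (p \in @cell R) = (xc p \in `[0, 2 * pi]%classic) && (zc p \in `[0, 2 * pi]%classic).
Proof.
apply/idP/andP => [/set_mem [h1 h2]|[/set_mem h1 /set_mem h2]].
  by split; apply/mem_set; rewrite /= in_itv.
by apply/mem_set; split; [move: h1|move: h2]; rewrite /= in_itv.
Qed.

(** Fubini with the chosen variable innermost. For [x] and [y] it is used twice, the second time
    only on the sections in [z] that are integrable, which are almost all of them. *)
Lemma integral3_eq0 (g : mR3 -> \bar R) (i : 'I_3) :
  (@leb3 R).-integrable [set: mR3] g ->
  match val i with
  | 0%N => forall y z, (\int[mu]_x g (x, y, z) = 0)%E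
  | 1%N => forall x z, (\int[mu]_y g (x, y, z) = 0)%E
  | _ => forall x y, (\int[mu]_z g (x, y, z) = 0)%E
  end -> (\int[@leb3 R]_p g p = 0)%E.
Proof.
move=> Ig; have aeF := ae_filter_ringOfSetsType mu.
have slices : {ae mu, forall z, (@leb2 R).-integrable [set: mR * mR] (fun q : mR * mR => g (q, z))}.
  exact: (@ae_integrable2 _ _ _ _ R (@leb2 R) mu g Ig).
have finish : {ae mu, forall z, (\int[@leb2 R]_(q in [set: mR * mR]) g (q, z) = 0)%E} -> (\int[@leb3 R]_p g p = 0)%E.
  move=> H; rewrite -(@integral21_prod_meas1 _ _ _ _ R (@leb2 R) mu g Ig).
  rewrite (ae_eq_integral (cst 0%E)) ?integral0 //.
    exact: (@measurable_fubini_G _ _ _ _ R (@leb2 R) mu g Ig).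
  by apply: filterS H => z.
move: i; apply: ord3P => /= sec.
- apply: finish; apply: filterS slices => z Iz.
  rewrite -(@integral21_prod_meas1 _ _ _ _ R mu mu _ Iz).
  by rewrite (eq_integral (cst 0%E)) ?integral0 // => y _; exact: sec.
- apply: finish; apply: filterS slices => z Iz.
  rewrite -(@integral12_prod_meas1 _ _ _ _ R mu mu _ Iz).
  by rewrite (eq_integral (cst 0%E)) ?integral0 // => x _; exact: sec.
- rewrite -(@integral12_prod_meas1 _ _ _ _ R (@leb2 R) mu g Ig).
  by rewrite (eq_integral (cst 0%E)) ?integral0 // => -[x y] _; exact: sec.
Qed.

(** In [x] and [z] the boundary terms cancel by periodicity; in [y] they vanish by compact
    support. *)
Lemma Ccinf_section_integrals u i : Ccinf u ->
  let g := (EFin \o pd i u) \_ (@cell R) in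
  match val i with
  | 0%N => forall y z, (\int[mu]_x g (x, y, z) = 0)%E
  | 1%N => forall x z, (\int[mu]_y g (x, y, z) = 0)%E
  | _ => forall x y, (\int[mu]_z g (x, y, z) = 0)%E
  end.
Proof.
move=> Cu; have [Mu _ [d [C [d0 Bu]]]] := Cu; have C1 i' := Ccinf_pd i' Cu.
have c1 i' := Ccinf_continuous (C1 i').
have pi0 : 0 < 2 * pi :> R by rewrite mulr_gt0 // pi_gt0.
move: i; apply: ord3P => /= a b.
- have -> : (fun x => ((EFin \o pd ix u) \_ (@cell R)) (x, a, b)) =
    (if b \in `[0, 2 * pi]%classic then (fun x => (pd ix u (x, a, b))%:E) \_ `[0, 2 * pi] else cst 0%E).
    apply/funext => x; rewrite patchE cellE /xc /zc /= andbC; by case: (b \in _).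
  case: ifP => _; last exact: integral0.
  have cs : continuous (fun x : R => pd ix u (x, a, b)).
    move=> x; apply: (@continuous_comp _ _ _ (fun x : R => (x, a, b)) (pd ix u)); last exact: c1.
    exact: (cvg_pair (cvg_pair cvg_id (cvg_cst _)) (cvg_cst _)).
  have ds (x : R) : is_derive x 1 (fun x : R => u (x, a, b)) (pd ix u (x, a, b)).
    by apply: (is_derive_slice u x a b _).1.1; exact: Ccinf_derive.
  rewrite -integral_mkcond (integral_derive pi0 cs ds).
  by have [+ _] := Mu 0 a b; rewrite add0r => ->; rewrite subrr.
- have -> : (fun y => ((EFin \o pd iy u) \_ (@cell R)) (a, y, b)) =
    (if (a \in `[0, 2 * pi]%classic) && (b \in `[0, 2 * pi]%classic) then (fun y => (pd iy u (a, y, b))%:E) else cst 0%E).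
    by apply/funext => y; rewrite patchE cellE /xc /zc /=; case: ifP.
  case: ifP => _; last exact: integral0.
  apply: (integral_derive_support (f := fun y => u (a, y, b)) (C := C)).
  + move=> y; apply: (@continuous_comp _ _ _ (fun y : R => (a, y, b)) (pd iy u)); last exact: c1.
    exact: (cvg_pair (cvg_pair (cvg_cst _) cvg_id) (cvg_cst _)).
  + by move=> y; apply: (is_derive_slice u a y b _).2.1.1; exact: Ccinf_derive.
  + by move=> y /Bu/andP[].
  + move=> y; apply: contraNT => yC; have := Ccinf_near0 (p := (a, y, b)) Bu.
    rewrite negb_and [X in _ || X](_ : _ = true) ?orbT // => /(_ isT) near0.
    rewrite (pdE (near_eq_is_derive _ (is_derive_const _ _ 0))) //.
    by apply: filterS near0 => q ->.
- have -> : (fun z => ((EFin \o pd iz u) \_ (@cell R)) (a, b, z)) =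
    (if a \in `[0, 2 * pi]%classic then (fun z => (pd iz u (a, b, z))%:E) \_ `[0, 2 * pi] else cst 0%E).
    apply/funext => z; rewrite patchE cellE /xc /zc /=; by case: (a \in _).
  case: ifP => _; last exact: integral0.
  have cs : continuous (fun z : R => pd iz u (a, b, z)).
    move=> z; apply: (@continuous_comp _ _ _ (fun z : R => (a, b, z)) (pd iz u)); last exact: c1.
    exact: (cvg_pair (cvg_cst _) cvg_id).
  have ds (z : R) : is_derive z 1 (fun z : R => u (a, b, z)) (pd iz u (a, b, z)).
    by apply: (is_derive_slice u a b z _).2.2.1; exact: Ccinf_derive.
  rewrite -integral_mkcond (integral_derive pi0 cs ds).
  by have [_ +] := Mu a b 0; rewrite add0r => ->; rewrite subrr.
Qed.

Lemma Ccinf_integral_pd i u : Ccinf u -> Rintegral (@leb3 R) (@cell R) (pd i u) = 0.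
Proof.
move=> Cu; have mc : measurable (@cell R : set mR3) by exact: measurable_cell.
pose g : mR3 -> \bar R := (EFin \o pd i u) \_ (@cell R).
have Ig : (@leb3 R).-integrable [set: mR3] g.
  by apply/(integrable_mkcond _ mc); exact/Ccinf_integrable/Ccinf_pd.
have sec := Ccinf_section_integrals i Cu.
by rewrite /Rintegral integral_mkcond (integral3_eq0 Ig sec).
Qed.

End Integration.

(** * Green's formula for the sub-Laplacian *)

Section Green.
Variable R : realType.
Local Notation mu := (@lebesgue_measure R).
Let mR := measurableTypeR R.
Let mR3 := (mR * mR * mR)%type.
Implicit Types (u v : R * R * R -> R) (p q : R * R * R) (f g : R * R * R -> R[i]).
Local Notation cint := (Rintegral (@leb3 R) (@cell R)).

Lemma Ccinf_prod u v : Ccinf u -> Ccinf v -> Ccinf (fun p => u p * v p).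
Proof.
move=> [Mu Su _] Cv; apply: Ccinf_mul => // n; exact: Cn_on_subset (Su n).
Qed.

Lemma Ccinf_wy u : Ccinf u -> Ccinf (fun p => wy p * u p).
Proof. by move=> Cu; apply: Ccinf_mul => // n; exact: Cn_on_wy. Qed.

Lemma Ccinf_sy u : Ccinf u -> Ccinf (fun p => sy p * u p).
Proof. by move=> Cu; apply: Ccinf_mul => // n; exact: Cn_on_subset (@Cn_on_sy R n). Qed.

Lemma Ccinf_zero u p : Ccinf u -> yc p = 0 -> u p = 0.
Proof.
move=> [_ _ [d [C [d0 Bu]]]] y0; apply/eqP; apply: contraT => /Bu.
by rewrite y0 normr0 leNgt d0.
Qed.

(** The integrand of the Dirichlet form, including the Popp density. *)
Definition energy u v p := wy p * (Xd u p * Xd v p + pd iy u p * pd iy v p).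

Lemma Ccinf_energy u v : Ccinf u -> Ccinf v -> Ccinf (energy u v).
Proof.
move=> Cu Cv; apply: Ccinf_wy.
have -> : (fun p => Xd u p * Xd v p + pd iy u p * pd iy v p) =
  (fun p => 1 * (Xd u p * Xd v p) + pd iy u p * pd iy v p) by apply/funext => p; rewrite mul1r.
by apply: Ccinf_lin; apply: Ccinf_prod; try exact: Ccinf_Xd; exact: Ccinf_pd.
Qed.

(** The left side is the Euclidean divergence of the field [w v] times the gradient of [u], whose
    third component is [sy] times the first; this is the product rule for the divergence. The
    factors [1] match the shape expected by [cint_lin]. *)
Lemma Ccinf_lap_div u v p : Ccinf u -> Ccinf v ->
  let J := fun q => wy q * (v q * Xd u q) in
  1 * pd ix J p + (1 * pd iy (fun q => wy q * (v q * pd iy u q)) p + pd iz (fun q => sy q * J q) p) =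
  1 * (wy p * (lapR u p * v p)) + energy u v p.
Proof.
move=> Cu Cv J; have CX := Ccinf_Xd Cu; have CY := Ccinf_pd iy Cu.
have CJ : Ccinf J by apply: Ccinf_wy; exact: Ccinf_prod.
have CJY : Ccinf (fun q => wy q * (v q * pd iy u q)) by apply: Ccinf_wy; exact: Ccinf_prod.
have [y0|y0] := eqVneq (yc p) 0.
  have z u' : Ccinf u' -> u' p = 0 by move=> Cu'; exact: Ccinf_zero Cu' y0.
  rewrite (z _ (Ccinf_pd ix CJ)) (z _ (Ccinf_pd iy CJY)) (z _ (Ccinf_pd iz (Ccinf_sy CJ))).
  by rewrite (z _ Cv) (z _ (Ccinf_energy Cu Cv)) !(mulr0, addr0).
have dw i := is_derive_wy i y0.
have dv i := Ccinf_derive i p Cv; have dX i := Ccinf_derive i p CX; have dY := Ccinf_derive iy p CY.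
have ds : is_derive p (evec R iz) (@sy R) 0.
  have [h1 [dh _]] := @smooth1_sq R 1%N.
  by apply: is_derive_eq (is_derive_comp_yc iz (dh (yc p))) _; rewrite mul0r.
rewrite (pdE (is_derive_mul (dw ix) (is_derive_mul (dv ix) (dX ix)))).
rewrite (pdE (is_derive_mul (dw iy) (is_derive_mul (dv iy) dY))).
rewrite (pdE (is_derive_mul ds (is_derive_mul (dw iz) (is_derive_mul (dv iz) (dX iz))))).
rewrite (_ : (ix == iy) = false) // (_ : (iz == iy) = false) // eqxx /energy /lapR.
rewrite [Xd (Xd u) p]/Xd [Xd v p]/Xd /nat_of_bool.
move: (pd ix (Xd u) p) (pd iy (pd iy u) p) (pd iz (Xd u) p) (pd ix v p) (pd iy v p) (pd iz v p).
move: (pd iy u p) (Xd u p) (sy p) (yc p)^-1 (wy p) (v p) (J p) => d e s y w r j a b c a' b' c'.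
by ring.
Qed.

Let mc : measurable (@cell R : set mR3). Proof. exact: measurable_cell. Qed.

Lemma cint_lin a u v : (@leb3 R).-integrable (@cell R) (EFin \o u) ->
  (@leb3 R).-integrable (@cell R) (EFin \o v) ->
  cint (fun p => a * u p + v p) = a * cint u + cint v.
Proof.
move=> Iu Iv; rewrite RintegralD // ?RintegralZl //.
exact: (integrableZl mc a Iu).
Qed.

Lemma green u v : Ccinf u -> Ccinf v ->
  cint (fun p => wy p * (lapR u p * v p)) = - cint (energy u v).
Proof.
move=> Cu Cv; have CX := Ccinf_Xd Cu; have CY := Ccinf_pd iy Cu.
pose J := fun q => wy q * (v q * Xd u q).
have CJ : Ccinf J by apply: Ccinf_wy; exact: Ccinf_prod.
have CJY : Ccinf (fun q => wy q * (v q * pd iy u q)) by apply: Ccinf_wy; exact: Ccinf_prod.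
have CJs := Ccinf_sy CJ.
have CL : Ccinf (fun p => wy p * (lapR u p * v p)).
  by apply: Ccinf_wy; apply: Ccinf_prod => //; exact: Ccinf_lap.
have C1 := Ccinf_integrable (Ccinf_pd ix CJ).
have C2 := Ccinf_integrable (Ccinf_pd iy CJY).
have C3 := Ccinf_integrable (Ccinf_pd iz CJs).
have C4 := Ccinf_integrable (Ccinf_lin 1 (Ccinf_pd iy CJY) (Ccinf_pd iz CJs)).
have := cint_lin 1 (Ccinf_integrable CL) (Ccinf_integrable (Ccinf_energy Cu Cv)).
rewrite -(funext (fun p => Ccinf_lap_div p Cu Cv)).
rewrite (cint_lin 1 C1 C4) (cint_lin 1 C2 C3) !Ccinf_integral_pd // !mul1r !addr0 => /esym/eqP.
by rewrite addr_eq0 => /eqP.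
Qed.

Lemma measurable_invr : measurable_fun [set: mR] (fun y : R => y^-1).
Proof.
rewrite -(setvU [set (0 : R)]); apply/measurable_funU => //; first exact: measurableC.
split; last exact: measurable_fun_set1.
apply: open_continuous_measurable_fun; first by rewrite openC; exact: closed_eq.
by move=> y; rewrite inE /= => /eqP y0; apply: cvgV => //; exact: cvg_id.
Qed.

Lemma measurable_wy : measurable_fun [set: mR3] (@wy R : mR3 -> R).
Proof.
by apply: (measurableT_comp measurable_invr); apply: continuous_measurable3; exact: continuous_norm_yc.
Qed.

Lemma wy_ge0 p : 0 <= wy p. Proof. by rewrite invr_ge0. Qed.

End Green.

(** * The operator domain in terms of real test functions *)

Section Domain.
Variable R : realType.
Local Notation mu := (@lebesgue_measure R).
Let mR := measurableTypeR R.
Let mR3 := (mR * mR * mR)%type.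
Implicit Types (u v : R * R * R -> R) (p q : R * R * R) (f g : R * R * R -> R[i]).
Local Notation D := (Cc_smooth_off (@singular_set R)).

Lemma periodic_int (T : Type) (h : R -> T) (P : R) : (forall x, h (x + P) = h x) ->
  forall (k : int) x, h (x + k%:~R * P) = h x.
Proof.
move=> hP; have hn (n : nat) x : h (x + n%:R * P) = h x.
  by elim: n x => [|n IH] x; rewrite ?mul0r ?addr0 // -natr1 mulrDl mul1r addrA hP.
move=> [n|n] x; first by rewrite hn.
by rewrite NegzE mulrNz mulNr -(hn n.+1 (x - _)) subrK.
Qed.

Lemma on_M_cell (T : Type) (h : R * R * R -> T) p : on_M h ->
  exists q, [/\ cell q, yc q = yc p & h q = h p].
Proof.
case: p => -[x y] z Mh; have pi2 : 0 < 2 * pi :> R by rewrite mulr_gt0 // pi_gt0.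
have red (t : R) : 0 <= t + (- Num.floor (t / (2 * pi)))%:~R * (2 * pi) <= 2 * pi.
  move: (2 * pi) pi2 => P P0; have /andP[h1 h2] := mem_rg1_floor (t / P).
  rewrite mulrNz mulNr; move: h1 h2; rewrite ler_pdivlMr // ltr_pdivrMr // mulrDl mul1r.
  by move=> h1 h2; apply/andP; split; lra.
have hx := periodic_int (fun x => (Mh x y z).1).
exists (x + (- Num.floor (x / (2 * pi)))%:~R * (2 * pi), y, z + (- Num.floor (z / (2 * pi)))%:~R * (2 * pi)).
split => //; first by split; exact: red.
rewrite (periodic_int (h := fun t => h (_, y, t))); last by move=> t; have [] := Mh (x + (- Num.floor (x / (2 * pi)))%:~R * (2 * pi)) y t.
by rewrite (periodic_int (h := fun t => h (t, y, z))) // => t; have [] := Mh t y z.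
Qed.

(** The image under [yc] of the support in the cell is compact and misses [0]. By periodicity every
    point where [f] is nonzero has a translate in the cell at the same height. *)
Lemma compact_supp_band f : on_M f -> compact (supp f `&` @cell R) ->
  supp f `&` @singular_set R = set0 ->
  exists d C, 0 < d /\ forall p, f p != 0 -> d <= `|yc p| <= C.
Proof.
move=> Mf cf f0; pose K := @yc R @` (supp f `&` @cell R).
have cK : compact K.
  by apply: continuous_compact => //; apply: continuous_subspaceT; exact: continuous_yc.
have inK p : f p != 0 -> K (yc p).
  move=> fp; have [q [cq yq hq]] := on_M_cell p Mf.
  by exists q => //; split => //; apply: subset_closure; rewrite /= hq.
have K0 : ~ K 0.
  move=> [p [sp _] yp]; suff : set0 p by [].
  by rewrite -f0; split.
have oK : open (~` K) by apply: closed_openC; exact: compact_closed (@norm_hausdorff _ _) cK.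
have /nbhs_ballP[d /= d0 Hd] : nbhs (0 : R) (~` K) by exact: open_nbhs_nbhs.
have [M [Mr HM]] := compact_bounded cK.
exists d, (M + 1); split => // p /inK Kp; rewrite (HM (M + 1)) ?ltrDl // andbT leNgt.
by apply/negP => yd; apply: Hd Kp; rewrite /ball /= sub0r normrN.
Qed.

Lemma complex_eq0 (z : R[i]) : (z == 0) = (complex.Re z == 0) && (complex.Im z == 0).
Proof. by case: z => a b; rewrite eq_complex. Qed.

(** Trades topological conditions on the support for a band [d <= |y| <= C] on each component, a
    condition that passes easily to derivatives, sums and products. *)
Lemma CcinfP f : D f <-> Ccinf (cRe f) /\ Ccinf (cIm f).
Proof.
split=> [[Mf S1 S2 cf f0]|[[M1 S1 [d [C [d0 B1]]]] [M2 S2 [d' [C' [d'0 B2]]]]]].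
  have [d [C [d0 B]]] := compact_supp_band Mf cf f0; rewrite off0E in S1 S2.
  split; apply: (Ccinf_of_off0 _ _ d0) => //.
  - by move=> x y z; rewrite /cRe (Mf x y z).1 (Mf x y z).2.
  - by move=> p fp; apply: B; rewrite complex_eq0 negb_and fp.
  - by move=> x y z; rewrite /cIm (Mf x y z).1 (Mf x y z).2.
  - by move=> p fp; apply: B; rewrite complex_eq0 negb_and fp orbT.
pose F (a c : R) : set (R * R * R) := (fun p => `|yc p|) @^-1` `[a, c]%classic.
have cF a c : closed (F a c).
  have cD : closed (`[a, c]%classic : set R) by exact: interval_closed.
  apply: (@preimage_closed _ R (fun p : R * R * R => `|yc p|) _ _ cD) => q _; exact: continuous_norm_yc.
have sF : supp f `<=` F (Num.min d d') (Num.max C C').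
  have -> : F (Num.min d d') (Num.max C C') = closure (F (Num.min d d') (Num.max C C')).
    exact/closure_id.
  apply: closure_subset => p /=; rewrite complex_eq0 negb_and /F /= in_itv /= ge_min le_max.
  by move=> /orP[/B1|/B2]/andP[-> ->]; rewrite ?orbT.
split.
- move=> x y z; have := M1 x y z; have := M2 x y z; rewrite /cRe /cIm.
  move=> [i1 i2] [r1 r2]; split; apply/eqP; rewrite eq_complex.
    by rewrite r1 i1 !eqxx.
  by rewrite r2 i2 !eqxx.
- by rewrite off0E => n; exact: Cn_on_subset (S1 n).
- by rewrite off0E => n; exact: Cn_on_subset (S2 n).
- pose M := Num.max C C'.
  pose box := (`[0, 2 * pi] `*` `[- M, M]) `*` `[0, 2 * pi] : set (R * R * R).
  have cbox : compact box.
    by apply: compact_setX; [apply: compact_setX|]; exact: segment_compact.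
  have -> : supp f `&` @cell R = supp f `&` box.
    apply/seteqP; split => -[[x y] z] /= [sp].
      move=> [h1 h2]; split => //; move: h1 h2; rewrite /xc /zc /box /= !in_itv /= => h1 h2.
      split; [split|] => //.
      by have := sF _ sp; rewrite /F /= in_itv /= -ler_norml => /andP[].
    by move=> [[h1 _] h2]; split => //; split; move: h1 h2; rewrite /box /= !in_itv.
  rewrite setIC; apply: compact_closedI => //; exact: closed_closure.
- apply/seteqP; split => // p [/sF]; rewrite /F /= in_itv /= => /andP[h _]; rewrite /singular_set /= => y0.
  by move: h; rewrite y0 normr0 leNgt lt_min d0 d'0.
Qed.

End Domain.

(** * Linearity, symmetry and negativity on the domain *)

Section SubLaplacian.
Variable R : realType.
Local Notation mu := (@lebesgue_measure R).
Let mR := measurableTypeR R.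
Let mR3 := (mR * mR * mR)%type.
Implicit Types (u v : R * R * R -> R) (p q : R * R * R) (f g : R * R * R -> R[i]).
Local Notation D := (Cc_smooth_off (@singular_set R)).
Local Notation A := (complexify (lap_sr (@X1 R) (@X2 R))).
Local Notation w := (@wy R).

Lemma pd_lin i a u v p : Ccinf u -> Ccinf v ->
  pd i (fun q => a * u q + v q) p = a * pd i u p + pd i v p.
Proof.
move=> Cu Cv; apply: pdE.
exact: is_derive_add (is_derive_scale a (Ccinf_derive i p Cu)) (Ccinf_derive i p Cv).
Qed.

Lemma Xd_lin a u v p : Ccinf u -> Ccinf v ->
  Xd (fun q => a * u q + v q) p = a * Xd u p + Xd v p.
Proof. by move=> Cu Cv; rewrite /Xd !pd_lin //; ring. Qed.

Lemma lapR_lin a u v p : Ccinf u -> Ccinf v ->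
  lapR (fun q => a * u q + v q) p = a * lapR u p + lapR v p.
Proof.
move=> Cu Cv; rewrite /lapR.
have -> : Xd (fun q => a * u q + v q) = fun q => a * Xd u q + Xd v q.
  by apply/funext => q; exact: Xd_lin.
have -> : pd iy (fun q => a * u q + v q) = fun q => a * pd iy u q + pd iy v q.
  by apply/funext => q; exact: pd_lin.
rewrite Xd_lin; [|exact: Ccinf_Xd|exact: Ccinf_Xd].
rewrite pd_lin; [|exact: Ccinf_pd|exact: Ccinf_pd].
move: (Xd _ p) (Xd _ p) (pd iy (pd iy u) p) (pd iy (pd iy v) p) => x1 x2 y1 y2.
move: (pd iy u p) (pd iy v p) (yc p)^-1 => z1 z2 y.
by ring.
Qed.

Lemma cRe_clin (c : R[i]) f g : cRe (fun p => c * f p + g p) =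
  (fun p => complex.Re c * cRe f p + (- complex.Im c * cIm f p + cRe g p)).
Proof.
by apply/funext => p; rewrite /cRe /cIm; case: c (f p) (g p) => [a b] [x y] [x' y'] /=; ring.
Qed.

Lemma cIm_clin (c : R[i]) f g : cIm (fun p => c * f p + g p) =
  (fun p => complex.Re c * cIm f p + (complex.Im c * cRe f p + cIm g p)).
Proof.
by apply/funext => p; rewrite /cRe /cIm; case: c (f p) (g p) => [a b] [x y] [x' y'] /=; ring.
Qed.

Lemma D_clin (c : R[i]) f g : D f -> D g -> D (fun p => c * f p + g p).
Proof.
move=> /CcinfP[f1 f2] /CcinfP[g1 g2]; apply/CcinfP; rewrite cRe_clin cIm_clin.
by split; apply: Ccinf_lin => //; exact: Ccinf_lin.
Qed.

Lemma lapE f : D f -> A f = fun p => Complex (lapR (cRe f) p) (lapR (cIm f) p).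
Proof. by move=> /CcinfP[f1 f2]; apply/funext => p; rewrite /complexify !lap_lapR. Qed.

Lemma A_clin (c : R[i]) f g : D f -> D g ->
  A (fun p => c * f p + g p) = (fun p => c * A f p + A g p).
Proof.
move=> Df Dg; have [f1 f2] := (CcinfP f).1 Df; have [g1 g2] := (CcinfP g).1 Dg.
rewrite !lapE //; last exact: D_clin.
have L2 a b u v v' p : Ccinf u -> Ccinf v -> Ccinf v' ->
    lapR (fun q => a * u q + (b * v q + v' q)) p = a * lapR u p + (b * lapR v p + lapR v' p).
  by move=> Cu Cv Cv'; rewrite (lapR_lin a p Cu (Ccinf_lin b Cv Cv')) (lapR_lin b p Cv Cv').
rewrite cRe_clin cIm_clin; apply/funext => p; rewrite !L2 //.
move: (lapR (cRe f) p) (lapR (cIm f) p) (lapR (cRe g) p) (lapR (cIm g) p) => x1 x2 y1 y2.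
case: c => a b; apply/eqP; rewrite eq_complex /=.
by apply/andP; split; apply/eqP; ring.
Qed.

Lemma D_A f : D f -> D (A f).
Proof.
move=> Df; have [f1 f2] := (CcinfP f).1 Df; apply/CcinfP; rewrite lapE //.
by split; exact: Ccinf_lap.
Qed.

Lemma D_L2 f : D f -> L2 w f.
Proof.
move=> Df; have [f1 f2] := (CcinfP f).1 Df; split.
- by case: Df.
- by apply: continuous_measurable3; exact: Ccinf_continuous.
- by apply: continuous_measurable3; exact: Ccinf_continuous.
- have C1 : Ccinf (fun p => wy p * (1 * (cRe f p * cRe f p) + cIm f p * cIm f p)).
    by apply: Ccinf_wy; apply: Ccinf_lin; exact: Ccinf_prod.
  have /integrableP[_] := Ccinf_integrable C1; apply: le_lt_trans.
  rewrite /L2norm2 le_eqVlt; apply/orP; left; apply/eqP; apply: eq_integral => p _.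
  rewrite gee0_abs; first by rewrite /= mul1r !expr2 mulrC.
  by rewrite lee_fin mulr_ge0 ?wy_ge0 // mul1r -!expr2 addr_ge0 ?sqr_ge0.
Qed.

Lemma D0 : D (fun=> 0).
Proof.
suff C0 : Ccinf (fun=> 0 : R) by apply/CcinfP; split.
split => //; first by move=> n; exact: Cn_on_cst openT.
by exists 1, 1; split => // p; rewrite eqxx.
Qed.

Lemma energyC u v p : energy u v p = energy v u p.
Proof.
by rewrite /energy (mulrC (Xd u p)) (mulrC (pd iy u p)).
Qed.

Lemma rdot_A f g : D f -> D g -> rdot w (A f) g =
  - Rintegral (@leb3 R) (@cell R) (fun p => 1 * energy (cRe f) (cRe g) p + energy (cIm f) (cIm g) p).
Proof.
move=> Df Dg; have [f1 f2] := (CcinfP f).1 Df; have [g1 g2] := (CcinfP g).1 Dg.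
have I u v : Ccinf u -> Ccinf v -> (@leb3 R).-integrable (@cell R) (EFin \o (fun p => wy p * (lapR u p * v p))).
  by move=> Cu Cv; apply: Ccinf_integrable; exact: (Ccinf_wy (Ccinf_prod (Ccinf_lap Cu) Cv)).
have E u v : Ccinf u -> Ccinf v -> (@leb3 R).-integrable (@cell R) (EFin \o energy u v).
  by move=> Cu Cv; apply: Ccinf_integrable; exact: Ccinf_energy.
have e1 := cint_lin 1 (E _ _ f1 g1) (E _ _ f2 g2).
have e2 := cint_lin 1 (I _ _ f1 g1) (I _ _ f2 g2).
rewrite (green f1 g1) (green f2 g2) in e2.
transitivity (Rintegral (@leb3 R) (@cell R) (fun p => 1 * (wy p * (lapR (cRe f) p * cRe g p)) + wy p * (lapR (cIm f) p * cIm g p))).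
  apply: eq_Rintegral => p _; rewrite /rprod lapE // [cRe (fun _ => _) _]/= [cIm (fun _ => _) _]/=.
  by rewrite mul1r mulrC mulrDr.
by rewrite e1 e2 !mul1r opprD.
Qed.

Lemma A_sym f g : D f -> D g -> rdot w (A f) g = rdot w f (A g).
Proof.
move=> Df Dg; apply: etrans (rdot_A Df Dg) _.
apply: etrans _ (etrans (esym (rdot_A Dg Df)) (rdotC w (A g) f)).
apply: (congr1 -%R).
apply: eq_Rintegral => p _.
by rewrite (energyC (cRe f)) (energyC (cIm f)).
Qed.

Lemma A_neg f : D f -> rdot w (A f) f <= 0.
Proof.
move=> Df; rewrite (rdot_A Df Df) oppr_le0; apply: Rintegral_ge0 => p _.
by rewrite mul1r /energy; apply: addr_ge0; apply: mulr_ge0; rewrite ?wy_ge0 // -!expr2 addr_ge0 ?sqr_ge0.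
Qed.

End SubLaplacian.

(** * Sections of integrable functions on a product *)

Lemma integrable_mul_bounded d (T : measurableType d) (R : realType)
    (m : {measure set T -> \bar R}) (D : set T) (e f : T -> R) (K : R) :
  measurable D -> measurable_fun D e -> (forall x, D x -> `|e x| <= K) ->
  m.-integrable D (EFin \o f) -> m.-integrable D (EFin \o (fun x => e x * f x)).
Proof.
move=> mD me eK If; have := integrableZl mD K If; apply: le_integrable => //.
  apply/measurable_EFinP; apply: measurable_funM => //.
  by case/integrableP : If => /measurable_EFinP.
move=> x /eK ex; rewrite lee_fin !normrM ler_wpM2r //.
by apply: le_trans ex _; exact: ler_norm.
Qed.

Lemma ae_forall_count d (T : measurableType d) (R : realType)
    (m : {measure set T -> \bar R}) (I : countType) (P : I -> T -> Prop) :
  (forall i, {ae m, forall x, P i x}) -> {ae m, forall x, forall i, P i x}.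
Proof.
move=> H; have aeF := ae_filter_ringOfSetsType m.
have : {ae m, forall x, forall n i, unpickle n = Some i -> P i x}.
  apply: ae_foralln => n; case E : (unpickle n : option I) => [i|].
    by apply: filterS (H i) => x Px i' [<-].
  by apply: aeW.
by apply: filterS => x Hx i; apply: (Hx (pickle i)); exact: pickleK.
Qed.

Section ProductSections.
Context d1 d2 (T1 : measurableType d1) (T2 : measurableType d2) (R : realType).
Variables (m1 : {sigma_finite_measure set T1 -> \bar R}) (m2 : {sigma_finite_measure set T2 -> \bar R}).
Variables (A : set T1) (B : set T2).
Hypotheses (mA : measurable A) (mB : measurable B).
Variable F : T1 * T2 -> R.
Hypothesis IF : (m1 \x m2)%E.-integrable (A `*` B) (EFin \o F).

Let mAB : measurable (A `*` B). Proof. exact: measurableX. Qed.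

Let G := (EFin \o F) \_ (A `*` B).

Let IG : (m1 \x m2)%E.-integrable [set: T1 * T2] G.
Proof. exact/(integrable_mkcond _ mAB). Qed.

Let GA y : y \in A -> (fun q => G (y, q)) = (EFin \o (fun q => F (y, q))) \_ B.
Proof.
move=> yA; apply/funext => q; rewrite /G !patchE.
by rewrite (_ : ((y, q) \in A `*` B) = (q \in B)) // in_setX yA.
Qed.

Let GnA y : y \notin A -> (fun q => G (y, q)) = cst 0%E.
Proof. by move=> yA; apply/funext => q; rewrite /G patchE in_setX (negbTE yA). Qed.

Lemma ae_section_integrable :
  {ae m1, forall y, y \in A -> m2.-integrable B (EFin \o (fun q => F (y, q)))}.
Proof.
have aeF := ae_filter_ringOfSetsType m1.
apply: filterS (@ae_integrable1 _ _ _ _ R m1 m2 G IG) => y Iy yA.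
by apply/(integrable_mkcond _ mB); rewrite -GA.
Qed.

Let Fub : {ae m1, forall y, (\int[m2]_q G (y, q) =
  ((fun y => (Rintegral m2 B (fun q => F (y, q)))%:E) \_ A) y)%E}.
Proof.
have aeF := ae_filter_ringOfSetsType m1.
apply: filterS ae_section_integrable => y Iy; rewrite patchE; case: ifPn => yA.
  by rewrite GA // -integral_mkcond integral_EFin_Rintegral //; exact: Iy.
by rewrite GnA // integral0.
Qed.

Lemma measurable_section_Rintegral :
  measurable_fun A (fun y => Rintegral m2 B (fun q => F (y, q))).
Proof.
have mF := @measurable_fubini_F _ _ _ _ R m1 m2 G IG.
have mF2 := measurable_funTS mF : measurable_fun A (fubini_F m2 G).
have := measurableT_comp (@fine_measurable R _ measurableT) mF2.
apply: eq_measurable_fun => y yA /=.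
by rewrite /fubini_F GA // -integral_mkcond.
Qed.

Lemma integrable_section_Rintegral :
  m1.-integrable A (EFin \o (fun y => Rintegral m2 B (fun q => F (y, q)))).
Proof.
have := integrableS measurableT mA (@subsetT _ _) (@integrable_fubini_F _ _ _ _ R m1 m2 G IG).
apply: le_integrable => //; first by apply/measurable_EFinP; exact: measurable_section_Rintegral.
move=> y /mem_set yA; rewrite /fubini_F GA // -integral_mkcond /= /Rintegral.
by case: (integral _ _ _) => [r| |] //=; rewrite normr0 leey.
Qed.

Lemma Rintegral_section :
  Rintegral m1 A (fun y => Rintegral m2 B (fun q => F (y, q))) =
  Rintegral (m1 \x m2)%E (A `*` B) F.
Proof.
rewrite /Rintegral integral_mkcond [in RHS]integral_mkcond; congr fine.
rewrite -(@integral12_prod_meas1 _ _ _ _ R m1 m2 G IG).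
apply/esym/ae_eq_integral => //.
- exact: (@measurable_fubini_F _ _ _ _ R m1 m2 G IG).
- apply/(measurable_restrictT _ mA); apply/measurable_EFinP; exact: measurable_section_Rintegral.
- by have aeF := ae_filter_ringOfSetsType m1; apply: filterS Fub => y h _.
Qed.

End ProductSections.

(** Tests a partial integral against a bounded function of the outer variable. As sections are
    integrable only almost everywhere, moving [e y] inside the inner integral is an
    almost-everywhere identity. *)
Lemma Rintegral_section_mul d1 d2 (T1 : measurableType d1) (T2 : measurableType d2) (R : realType)
  (m1 : {sigma_finite_measure set T1 -> \bar R}) (m2 : {sigma_finite_measure set T2 -> \bar R})
  (A : set T1) (B : set T2) (F : T1 * T2 -> R) (e : T1 -> R) (K : R) :
  measurable A -> measurable B ->
  (m1 \x m2)%E.-integrable (A `*` B) (EFin \o F) ->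
  measurable_fun A e -> (forall y, A y -> `|e y| <= K) ->
  m1.-integrable A (EFin \o (fun y => e y * Rintegral m2 B (fun q => F (y, q)))) /\
  Rintegral m1 A (fun y => e y * Rintegral m2 B (fun q => F (y, q))) =
  Rintegral (m1 \x m2)%E (A `*` B) (fun p => e p.1 * F p).
Proof.
move=> mA mB IF me eK; 
have IeF : (m1 \x m2)%E.-integrable (A `*` B) (EFin \o (fun p => e p.1 * F p)).
  apply: (@integrable_mul_bounded _ _ _ _ _ _ _ K _ _ _ IF); first exact: measurableX.
    apply: (measurable_comp mA _ me); first by move=> _ [p [Ap _] <-].
    exact: measurable_funTS measurable_fst.
  by move=> p [/eK].
have aeF := ae_filter_ringOfSetsType m1.
have I1 : m1.-integrable A (EFin \o (fun y => e y * Rintegral m2 B (fun q => F (y, q)))).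
  apply: (@integrable_mul_bounded _ _ _ _ _ _ _ K _ _ eK) => //.
  exact: integrable_section_Rintegral.
split => //; rewrite -(Rintegral_section mA mB IeF); apply: (congr1 fine).
apply: ae_eq_integral => //.
- by case/integrableP : I1.
- by case/integrableP : (integrable_section_Rintegral mA mB IeF).
apply: filterS (ae_section_integrable mA mB IF) => y Iy /mem_set /Iy {}Iy.
by rewrite /= RintegralZl.
Qed.

Lemma le_Rintegral_section d1 d2 (T1 : measurableType d1) (T2 : measurableType d2) (R : realType)
  (m1 : {sigma_finite_measure set T1 -> \bar R}) (m2 : {sigma_finite_measure set T2 -> \bar R})
  (A : set T1) (B : set T2) (F : T1 * T2 -> R) (e : T1 -> R) (K : R) :
  measurable A -> measurable B ->
  (m1 \x m2)%E.-integrable (A `*` B) (EFin \o F) ->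
  measurable_fun A e -> (forall y, A y -> 0 <= e y <= K) ->
  Rintegral m1 A (fun y => e y * `|Rintegral m2 B (fun q => F (y, q))|) <=
  Rintegral (m1 \x m2)%E (A `*` B) (fun p => e p.1 * `|F p|).
Proof.
move=> mA mB IF me eK; have aeF := ae_filter_ringOfSetsType m1.
have eK' y : A y -> `|e y| <= K by move=> /eK/andP[e0 ?]; rewrite ger0_norm.
have IaF : (m1 \x m2)%E.-integrable (A `*` B) (EFin \o (fun p => `|F p|)) by exact: integrable_norm IF.
have [I1 <-] := Rintegral_section_mul mA mB IaF me eK'.
have [I0 _] := Rintegral_section_mul mA mB IF me eK'.
have I2 : m1.-integrable A (EFin \o (fun y => e y * `|Rintegral m2 B (fun q => F (y, q))|)).
  apply: (@integrable_mul_bounded _ _ _ _ _ _ _ K mA me eK').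
  exact: integrable_norm (integrable_section_Rintegral mA mB IF).
apply: fine_le; [exact: integrable_fin_num I2|exact: integrable_fin_num I1|].
apply: ae_ge0_le_integral => //.
- by move=> y /eK/andP[e0 _]; rewrite lee_fin mulr_ge0.
- by case/integrableP : I2.
- move=> y /eK/andP[e0 _]; rewrite lee_fin mulr_ge0 //.
  by apply: Rintegral_ge0 => q _.
- by case/integrableP : I1.
apply: filterS (ae_section_integrable mA mB IF) => y Iy Ay.
have /andP[e0 _] := eK _ Ay; rewrite lee_fin ler_wpM2l //.
by apply: le_normr_Rintegral => //; apply: Iy; rewrite inE.
Qed.

(** * Uniqueness of Fourier coefficients on the two-dimensional torus *)

Section FourierUniqueness2.
Variable R : realType.
Local Notation mu := (@lebesgue_measure R).
Let mR := measurableTypeR R.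

(** The boolean index treats both real modes at once; differentiation negates it up to the sign
    [sgb]. *)
Definition trig (b : bool) (t : R) : R := if b then sin t else cos t.

Lemma trig_le1 b t : `|trig b t| <= 1.
Proof.
by case: b; rewrite /trig ler_norml; [rewrite sin_geN1 sin_le1|rewrite cos_geN1 cos_le1].
Qed.

Lemma continuous_trig b : continuous (trig b).
Proof. by case: b; [exact: continuous_sin|exact: continuous_cos]. Qed.

Definition square : set (R * R) := `[0, 2 * pi] `*` `[0, 2 * pi].

Lemma measurable_square : measurable (square : set (mR * mR)).
Proof. by apply: measurableX; exact: measurable_itv. Qed.

Lemma measurable_trig2 b (k l : R) :
  measurable_fun [set: mR * mR] (fun q : mR * mR => trig b (k * q.1 + l * q.2)).
Proof.
apply: (measurableT_comp (continuous_measurable_fun (@continuous_trig b))).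
by apply: measurable_funD; apply: measurable_funM.
Qed.

(** Product-to-sum formulas express products of modes in [x] and in [z] through modes in
    [k x + l z]. The one-dimensional theorem in [x] kills the coefficients in [z] for almost every
    [x], simultaneously because there are countably many, and then it applies in [z]. *)
Lemma fourier_unique2 (g : R * R -> R) :
  (@leb2 R).-integrable (square : set (mR * mR)) (EFin \o g) ->
  (forall (k l : int) b, Rintegral (@leb2 R) square (fun q => trig b (k%:~R * q.1 + l%:~R * q.2) * g q) = 0) ->
  (\int[@leb2 R]_(q in square) `|g q|%:E = 0)%E.
Proof.
move=> Ig modes; have ms := measurable_square.
have aeF := ae_filter_ringOfSetsType mu.
have mi : measurable (`[0, 2 * pi]%classic : set mR) by exact: measurable_itv.
have It b (k l : R) : (@leb2 R).-integrable (square : set (mR * mR)) (EFin \o (fun q => trig b (k * q.1 + l * q.2) * g q)).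
  apply: (@integrable_mul_bounded _ _ _ _ _ _ _ 1 _ _ _ Ig) => //.
    by apply: measurable_funTS; exact: measurable_trig2.
  by move=> q _; exact: trig_le1.
have prod0 a b (k l : int) : Rintegral (@leb2 R) square (fun q => trig a (k%:~R * q.1) * (trig b (l%:~R * q.2) * g q)) = 0.
  have [c1 [c2 [d E]]] : exists c1 c2 : R, exists d, forall x z, trig a x * trig b z =
      c1 * trig d (x + z) + c2 * trig d (x - z).
    by clear; case: a b => -[]; [exists (- 2^-1), 2^-1, false|exists 2^-1, 2^-1, true|exists 2^-1, (- 2^-1), true|exists 2^-1, 2^-1, false];
      move=> x z; rewrite /trig ?cosD ?sinD ?cosN ?sinN; field.
  transitivity (Rintegral (@leb2 R) square (fun q => c1 * (trig d (k%:~R * q.1 + l%:~R * q.2) * g q) +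
      c2 * (trig d (k%:~R * q.1 + (- l)%:~R * q.2) * g q))).
    by apply: eq_Rintegral => q _; rewrite mulrA E mulrNz mulNr; ring.
  rewrite RintegralD //; [|exact: (integrableZl ms c1 (It _ _ _))|exact: (integrableZl ms c2 (It _ _ _))].
  by rewrite !RintegralZl // !modes !mulr0 addr0.
have Ilz b (l : int) : (mu \x mu)%E.-integrable (`[0, 2 * pi] `*` `[0, 2 * pi] : set (mR * mR)) (EFin \o (fun q => trig b (l%:~R * q.2) * g q)).
  apply: eq_integrable (It b 0 l%:~R) => //; last by move=> q _; rewrite /= mul0r add0r.
have mtrig b : measurable_fun [set: mR] (trig b) := continuous_measurable_fun (@continuous_trig b).
have sec0 (bl : bool * int) : {ae mu, forall x : R, x \in `[0, 2 * pi] ->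
    \int[mu]_(z in `[0, 2 * pi]) (trig bl.1 (bl.2%:~R * z) * g (x, z)) = 0}.
  case: bl => b l; apply: fourier_unique; first exact: (integrable_section_Rintegral mi mi (Ilz b l)).
  move=> k; have key a : \int[mu]_(x in `[0, 2 * pi]) (trig a (k%:~R * x) *
      \int[mu]_(z in `[0, 2 * pi]) (trig b (l%:~R * z) * g (x, z))) = 0.
    have [||_ ->] := @Rintegral_section_mul _ _ mR mR R mu mu _ _ _ (fun x : R => trig a (k%:~R * x)) 1 mi mi (Ilz b l).
    - by apply: measurable_funTS; apply: (measurableT_comp (mtrig a)); exact: measurable_funM.
    - by move=> y _; exact: trig_le1.
    - exact: prod0.
  by split; [exact: (key false)|exact: (key true)].
have Ig' : (mu \x mu)%E.-integrable (`[0, 2 * pi] `*` `[0, 2 * pi] : set (mR * mR)) (EFin \o g) by [].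
have Iabs : (mu \x mu)%E.-integrable (`[0, 2 * pi] `*` `[0, 2 * pi] : set (mR * mR)) (EFin \o (fun q => `|g q|)).
  exact: integrable_norm Ig'.
have secg := ae_section_integrable mi mi Ig'.
rewrite (integral_EFin_Rintegral ms Iabs) -(Rintegral_section mi mi Iabs).
have Is := integrable_section_Rintegral mi mi Iabs.
rewrite (eq_Rintegral_ae Is (g := fun=> 0)).
- by rewrite Rintegral_cst ?mul0r.
- exact: integrable0.
apply: filterS (filterI secg (ae_forall_count sec0)) => x [Ix sx] xi.
have /Ix {}Ix : x \in `[0, 2 * pi]%classic by rewrite inE.
have z0 := fourier_unique Ix _.
have /z0 {}z0 : forall k : int, \int[mu]_(z in `[0, 2 * pi]) (cos (k%:~R * z) * g (x, z)) = 0 /\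
   \int[mu]_(z in `[0, 2 * pi]) (sin (k%:~R * z) * g (x, z)) = 0.
  by move=> k; split; [exact: (sx (false, k) xi)|exact: (sx (true, k) xi)].
rewrite (eq_Rintegral_ae (integrable_norm Ix) (g := fun=> 0)).
- by rewrite Rintegral_cst ?mul0r.
- exact: integrable0.
- by apply: filterS z0 => z zz zi; rewrite /= zz // normr0.
Qed.

End FourierUniqueness2.

(** * Separated test functions *)

Section Modes.
Variable R : realType.
Implicit Types (h : R -> R) (p : R * R * R).

Definition sgb (b : bool) : R := if b then 1 else -1.

Lemma is_derive_trig b (t : R) : is_derive t 1 (trig b) (sgb b * trig (~~ b) t).
Proof.
case: b; rewrite /sgb /trig /=; first by rewrite mul1r; exact: is_derive_sin.
by rewrite mulN1r; exact: is_derive_cos.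
Qed.

Definition phase (k l : R) p : R := k * xc p + l * zc p.

Definition mode h (k l : R) b p : R := h (yc p) * trig b (phase k l p).

Definition slope (k l : R) (i : 'I_3) : R := (i == ix)%:R * k + (i == iz)%:R * l.

Lemma is_derive_phase k l b p i : is_derive p (evec R i) (fun q => trig b (phase k l q))
  (slope k l i * sgb b * trig (~~ b) (phase k l p)).
Proof.
have d := is_derive_add (is_derive_scale k (is_derive_xc p (evec R i))) (is_derive_scale l (is_derive_zc p (evec R i))).
apply: is_derive_eq (is_derive_chain d (is_derive_trig b _)) _.
rewrite /slope mulrC mulrA; congr (_ * _ * _).
by move: i {d}; apply: ord3P; rewrite /xc /zc /= /nat_of_bool !(mulr1, mulr0, mul0r, mul1r, addr0, add0r).
Qed.

Lemma continuous_phase k l b : continuous (fun p => trig b (phase k l p)).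
Proof.
move=> p; apply: (@continuous_comp _ _ _ (phase k l) (trig b)); last exact: continuous_trig.
apply: cvgD; apply: cvgM; try exact: cvg_cst.
  by apply: (@continuous_comp _ _ _ fst fst); [exact: cvg_fst|exact: cvg_fst].
exact: cvg_snd.
Qed.

Lemma Cn_on_phase n k l b : Cn_on n setT (fun p => trig b (phase k l p)).
Proof.
elim: n b => [|n IH] b; first by split => // p _; exact: continuous_phase.
apply: (@Cn_onI _ _ _ _ (fun i p => slope k l i * sgb b * trig (~~ b) (phase k l p)) openT).
- by move=> p _; exact: continuous_phase.
- by move=> i p _; exact: is_derive_phase.
- by move=> i; apply: (Cn_onM openT) (IH (~~ b)); exact: Cn_on_cst openT.
Qed.

Lemma on_M_phase (k l : int) b : on_M (fun p => trig b (phase k%:~R l%:~R p)).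
Proof.
have T (j : int) (t : R) : trig b (t + j%:~R * (2 * pi)) = trig b t.
  apply: periodic_int => x.
  by rewrite mulr_natl; case: b; rewrite /trig; [exact: sinD2pi|exact: cosD2pi].
move=> x y z; rewrite /phase /xc /zc /=; split.
  by rewrite -[RHS](T k); congr (trig b _); ring.
by rewrite -[RHS](T l); congr (trig b _); ring.
Qed.

Definition off0_supported h := exists d C, 0 < d /\ forall y, h y != 0 -> d <= `|y| <= C.

Lemma Ccinf_mode h (k l : int) b : smooth1 h -> off0_supported h ->
  Ccinf (mode h k%:~R l%:~R b).
Proof.
move=> sh [d [C [d0 B]]]; have Mp := on_M_phase k l b; split.
- by move=> x y z; rewrite /mode (Mp x y z).1 (Mp x y z).2.
- by move=> n; apply: (Cn_onM openT); [exact: Cn_on_comp_yc|exact: Cn_on_phase].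
- by exists d, C; split => // p; rewrite /mode mulf_eq0 negb_or => /andP[/B].
Qed.

(** Each use of [X1] multiplies by [k + l y^2 / 2], a function of [y] alone, and exchanges sine and
    cosine with a sign; the two signs multiply to [-1]. *)
Lemma lapR_mode h h1 h2 k l b p : (forall y : R, is_derive y 1 h (h1 y)) ->
  (forall y : R, is_derive y 1 h1 (h2 y)) ->
  lapR (mode h k l b) p =
  (h2 (yc p) - h1 (yc p) / yc p - (k + l * (yc p ^+ 2 / 2)) ^+ 2 * h (yc p)) * trig b (phase k l p).
Proof.
move=> dh dh1; have dm i (g g1 : R -> R) c q : (forall y : R, is_derive y 1 g (g1 y)) ->
    is_derive q (evec R i) (mode g k l c) ((i == iy)%:R * g1 (yc q) * trig c (phase k l q) +
      g (yc q) * (slope k l i * sgb c * trig (~~ c) (phase k l q))).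
  by move=> dg; exact: is_derive_mul (is_derive_comp_yc i (dg _)) (is_derive_phase _ _ _ _ _).
have sx : slope k l ix = k by rewrite /slope /= !(mulr1, mulr0, mul0r, mul1r, addr0, add0r).
have s_y : slope k l iy = 0 by rewrite /slope /= !(mulr1, mulr0, mul0r, mul1r, addr0, add0r).
have sz : slope k l iz = l by rewrite /slope /= !(mulr1, mulr0, mul0r, mul1r, addr0, add0r).
have XE (g g1 : R -> R) c : (forall y : R, is_derive y 1 g (g1 y)) ->
    Xd (mode g k l c) = mode (fun y => (k + l * (y ^+ 2 / 2)) * sgb c * g y) k l (~~ c).
  move=> dg; apply/funext => q; rewrite /Xd (pdE (dm ix _ _ _ _ dg)) (pdE (dm iz _ _ _ _ dg)) sx sz.
  rewrite (_ : (ix == iy) = false) // (_ : (iz == iy) = false) // /mode /sy !mul0r !add0r; ring.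
have YE (g g1 : R -> R) c : (forall y : R, is_derive y 1 g (g1 y)) ->
    pd iy (mode g k l c) = mode g1 k l c.
  move=> dg; apply/funext => q; rewrite (pdE (dm iy _ _ _ _ dg)) s_y eqxx /mode.
  by rewrite !mul0r mulr0 addr0 mul1r.
rewrite /lapR (XE _ _ _ dh) (YE _ _ _ dh) (YE _ _ _ dh1).
have [e [de _]] := @smooth1_sq R 1%N.
have dg (y : R) : is_derive y 1 (fun y => (k + l * (y ^+ 2 / 2)) * sgb b * h y)
    ((0 + l * e y) * sgb b * h y + (k + l * (y ^+ 2 / 2)) * sgb b * h1 y).
  apply: is_derive_eq (is_derive_mul (is_derive_mul (is_derive_add (is_derive_const y 1 k) (is_derive_scale l (de y))) (is_derive_const y 1 (sgb b))) (dh y)) _.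
  by rewrite mulr0 addr0.
rewrite (XE _ _ _ dg) /mode negbK /sgb.
move: (phase k l p) (h (yc p)) (h1 (yc p)) (h2 (yc p)) (yc p) => f x x1 x2 y.
by move: (y^-1) => y'; case: b {dg}; rewrite /=; ring.
Qed.

End Modes.

(** * Fourier coefficients in [(x, z)] and vanishing of the weak kernel *)

Section Kernel.
Variable R : realType.
Local Notation mu := (@lebesgue_measure R).
Let mR := measurableTypeR R.
Let mR2 := (mR * mR)%type.
Let mR3 := (mR * mR * mR)%type.
Local Notation leb2 := (@leb2 R).
Local Notation nu := (@nu R).
Local Notation Q := (@square R : set mR2).
Local Notation cint := (Rintegral (@leb3 R) (@cell R)).
Local Notation slab c d := (`[c, d]%classic `*` Q : set (mR * mR2)).

Let mQ : measurable Q. Proof. exact: measurable_square. Qed.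
Let mi c d : measurable (`[c, d]%classic : set mR). Proof. exact: measurable_itv. Qed.
Let mslab c d : measurable (slab c d). Proof. exact: measurableX. Qed.

Let swap_cell (c d y : R) (q : R * R) : y \in `[c, d] -> 
  (swap_xy (y, q) \in @cell R) = ((y, q) \in slab c d).
Proof.
case: q => x z yi; apply/idP/idP => /set_mem h; apply/mem_set.
  case: h => h1 h2; split; first exact: yi.
  by split; rewrite /= in_itv.
by case: h => _ [/= h1 h2]; split; [move: h1|move: h2]; rewrite /= in_itv.
Qed.

Lemma lebQ_fin : (leb2 Q < +oo)%E.
Proof.
rewrite [X in (X < _)%E](@product_measure1E _ _ _ _ R mu mu _ _ (mi 0 (2 * pi)) (mi 0 (2 * pi))).
have fin a b : (mu `[a, b] < +oo)%E by rewrite -ge0_fin_numE // lebesgue_measure_itv /=; case: ifP.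
have finE a b : mu `[a, b] \is a fin_num by rewrite ge0_fin_numE.
by apply: lte_mul_pinfty; [exact: measure_ge0|exact: finE|exact: fin].
Qed.

Lemma slab_fin c d : (nu (slab c d) < +oo)%E.
Proof.
rewrite [X in (X < _)%E](@product_measure1E _ _ _ _ R mu leb2 _ _ (mi c d) mQ).
have fin a b : (mu `[a, b] < +oo)%E by rewrite -ge0_fin_numE // lebesgue_measure_itv /=; case: ifP.
have finE a b : mu `[a, b] \is a fin_num by rewrite ge0_fin_numE.
by apply: lte_mul_pinfty; [exact: measure_ge0|exact: finE|exact: lebQ_fin].
Qed.

Lemma integrable_cst_fin d (T : measurableType d) (m : {measure set T -> \bar R}) (D : set T) (K : R) :
  measurable D -> (m D < +oo)%E -> m.-integrable D (EFin \o fun=> K).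
Proof.
move=> mD fD; apply: measurable_bounded_integrable => //.
by exists `|K|; split; rewrite ?num_real // => M /ltW KM x _.
Qed.

(** Moves an integral over the cell to a slab with [y] outermost, the setting in which Fourier
    coefficients are sections. *)
Lemma cint_slab (U : R * R * R -> R) c d : measurable_fun [set: mR3] (U : mR3 -> R) ->
  (forall p, U p != 0 -> c <= yc p <= d) ->
  cint U = Rintegral nu (slab c d) (fun yq => U (swap_xy yq)).
Proof.
move=> mU Ucd; have mc : measurable (@cell R : set mR3) by exact: measurable_cell.
rewrite /Rintegral integral_mkcond [in RHS]integral_mkcond; apply: (congr1 fine).
rewrite integral_swap_xy; last first.
  apply/(measurable_restrictT _ mc); apply/measurable_EFinP; exact: measurable_funTS.
apply: eq_integral => -[y q] _; rewrite !patchE.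
have [U0|/Ucd ycd] := eqVneq (U (swap_xy (y, q))) 0.
  by rewrite U0; do 2 case: ifP.
by rewrite (@swap_cell c d).
Qed.

Variable V : R * R * R -> R.
Hypothesis mV : measurable_fun [set: mR3] (V : mR3 -> R).
Hypothesis IV : (@leb3 R).-integrable (@cell R) (EFin \o (fun p => V p ^+ 2 * wy p)).

Local Notation Vs yq := (V (swap_xy yq)).

Let mVs : measurable_fun [set: mR * mR2] (fun yq => Vs yq : R).
Proof. exact: (measurableT_comp mV (@measurable_swap_xy R)). Qed.

Let mw : measurable_fun [set: mR] (fun y : R => `|y|^-1).
Proof. exact: (measurableT_comp (@measurable_invr R) (@normr_measurable R setT)). Qed.

Let W := ((EFin \o (fun p => V p ^+ 2 * wy p)) \_ (@cell R) : mR3 -> \bar R).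

Let mW : measurable_fun [set: mR3] W.
Proof.
have mc : measurable (@cell R : set mR3) by exact: measurable_cell.
by apply/(measurable_restrictT _ mc); case/integrableP : IV.
Qed.

Let IW : nu.-integrable [set: mR * mR2] (fun yq => W (swap_xy yq)).
Proof.
have mc : measurable (@cell R : set mR3) by exact: measurable_cell.
by apply/(integrable_swap_xy mW); apply/(integrable_mkcond _ mc).
Qed.

Let WE c d yq : yq \in slab c d -> W (swap_xy yq) = (Vs yq ^+ 2 * `|yq.1|^-1)%:E.
Proof.
case: yq => y q yqs; rewrite /W patchE (@swap_cell c d) ?yqs //.
by case/set_mem : yqs.
Qed.

Let ISw c d : nu.-integrable (slab c d) (EFin \o (fun yq => Vs yq ^+ 2 * `|yq.1|^-1)).
Proof.
apply: eq_integrable (integrableS measurableT (mslab c d) (@subsetT _ _) IW) => //.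
by move=> yq /WE.
Qed.

(** The inequality [|V| <= V^2 / |y| + |y|] turns weighted square integrability into plain
    integrability on slabs that avoid [y = 0]. *)
Let ISV c d : ~~ (c <= 0 <= d) -> nu.-integrable (slab c d) (EFin \o (fun yq => Vs yq)).
Proof.
move=> cd0; pose M := `|c| + `|d|.
have := integrableD (mslab c d) (ISw c d) (@integrable_cst_fin _ _ nu _ M (mslab c d) (slab_fin c d)).
apply: le_integrable => //; first by apply/measurable_EFinP; exact: measurable_funTS.
move=> [y q] [/=]; rewrite in_itv /= => /andP[cy yd] _.
have y0 : y != 0 by apply: contraNneq cd0 => <-; rewrite cy.
have n0 : 0 < `|y| by rewrite normr_gt0.
have yM : `|y| <= M.
  rewrite ler_norml; apply/andP; split.
    apply: le_trans cy; rewrite opprD; have := ler_norm (- c); rewrite normrN => h; have := normr_ge0 d; lra.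
  by apply: le_trans yd _; have := ler_norm d; have := normr_ge0 c; rewrite /M; lra.
rewrite lee_fin; apply: le_trans (ler_norm _).
apply: (@le_trans _ _ (Vs (y, q) ^+ 2 * `|y|^-1 + `|y|)); last exact: lerD (lexx _) yM.
rewrite -(@real_normK _ (Vs (y, q))) ?num_real //.
move: (`|Vs _|) (normr_ge0 (Vs (y, q))) (`|y|) n0 => v v0 a a0.
have -> : v ^+ 2 / a + a = ((v - a) ^+ 2 + 2 * v * a) / a by field; rewrite gt_eqF.
rewrite ler_pdivlMr //; have := sqr_ge0 (v - a); have := mulr_ge0 v0 (ltW a0); lra.
Qed.

Section Coefficient.
Variables (k l : int) (b : bool).

Let F (yq : R * (R * R)) : R := trig b (k%:~R * yq.2.1 + l%:~R * yq.2.2) * Vs yq.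

(** A real Fourier coefficient of [V] at height [y], without normalization; it is meaningful at
    those [y] whose section is integrable. *)
Definition coef y := Rintegral leb2 Q (fun q => F (y, q)).

Let IF c d : ~~ (c <= 0 <= d) -> nu.-integrable (slab c d) (EFin \o F).
Proof.
move=> cd0; apply: (@integrable_mul_bounded _ _ _ nu _ _ _ 1 (mslab c d) _ _ (ISV cd0)).
  apply: measurable_funTS.
  exact: (measurableT_comp (@measurable_trig2 R b k%:~R l%:~R) (@measurable_snd _ _ mR mR2)).
by move=> yq _; exact: trig_le1.
Qed.

Lemma integrable_coef c d : ~~ (c <= 0 <= d) -> mu.-integrable `[c, d] (EFin \o coef).
Proof. by move=> cd0; apply: (integrable_section_Rintegral (mi c d) mQ (IF cd0)). Qed.

(** Integrates [|V| <= lam V^2 + 1 / lam] against [1 / |y|]. The first term is bounded independently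
    of the slab and the second grows with its logarithmic length; the free parameter [lam] does the
    work of Cauchy-Schwarz. *)
Lemma coef_bound c d (lam : R) : ~~ (c <= 0 <= d) -> 0 < lam ->
  \int[mu]_(y in `[c, d]) (`|y|^-1 * `|coef y|) <=
  lam * fine (\int[nu]_yq W (swap_xy yq)) + Rintegral leb2 Q (fun=> 1) / lam * \int[mu]_(y in `[c, d]) `|y|^-1.
Proof.
move=> cd0 l0.
have y0 y : `[c, d]%classic y -> y != 0.
  by rewrite /= in_itv /= => /andP[cy yd]; apply: contraNneq cd0 => <-; rewrite cy.
have [K HK] : exists K : R, forall y, `[c, d]%classic y -> 0 <= `|y|^-1 <= K.
  have [c0|c0] := ltP 0 c.
    exists c^-1 => y; rewrite /= in_itv /= => /andP[cy _].
    by rewrite invr_ge0 normr_ge0 lef_pV2 ?posrE ?normr_gt0 ?gt_eqF ?(lt_le_trans c0) // (le_trans cy) ?ler_norm.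
  have d0 : d < 0 by rewrite ltNge; apply: contra cd0 => ->; rewrite c0.
  exists (- d)^-1 => y; rewrite /= in_itv /= => /andP[_ yd].
  rewrite invr_ge0 normr_ge0 lef_pV2 ?posrE ?normr_gt0 ?oppr_gt0 //.
    by rewrite ler0_norm ?lerN2 // (le_trans yd) // ltW.
  by rewrite lt_eqF // (le_lt_trans yd).
have HK' y : `[c, d]%classic y -> `| `|y|^-1 | <= K.
  by move=> /HK/andP[h ?]; rewrite ger0_norm.
have mwi : measurable_fun (`[c, d]%classic : set mR) (fun y : R => `|y|^-1) by exact: measurable_funTS.
apply: le_trans (le_Rintegral_section (mi c d) mQ (IF cd0) mwi HK) _.
have I1 : nu.-integrable (slab c d) (EFin \o fun=> 1 : R).
  by apply: integrable_cst_fin; [exact: mslab|exact: slab_fin].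
have [_ E1] := Rintegral_section_mul (mi c d) mQ I1 mwi HK'.
have Iw : nu.-integrable (slab c d) (EFin \o (fun yq => `|yq.1|^-1 * 1)).
  apply: (@integrable_mul_bounded _ _ _ nu _ _ _ K (mslab c d) _ _ I1).
    by apply: measurable_funTS; exact: (measurableT_comp mw (@measurable_fst _ _ mR mR2)).
  by move=> [y q] [/HK'].
have Ia := integrableZl (mslab c d) lam (ISw c d).
have Ib := integrableZl (mslab c d) lam^-1 Iw.
apply: le_trans (_ : Rintegral nu (slab c d) (fun yq => lam * (Vs yq ^+ 2 * `|yq.1|^-1) + lam^-1 * (`|yq.1|^-1 * 1)) <= _).
  apply: le_Rintegral.
  - exact: mslab.
  - apply: (@integrable_mul_bounded _ _ _ nu _ _ _ K (mslab c d) _ _ (integrable_norm (IF cd0))).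
      by apply: measurable_funTS; exact: (measurableT_comp mw (@measurable_fst _ _ mR mR2)).
    by move=> [y q] [/HK'].
  - exact: (integrableD (mslab c d) Ia Ib).
  move=> [y q] [yi qQ] /=; rewrite mulr1 mulrA -mulrDl mulrC ler_wpM2r ?invr_ge0 //.
  rewrite /F normrM; apply: le_trans (ler_piMl (normr_ge0 _) (trig_le1 _ _)) _.
  rewrite -(@real_normK _ (Vs (y, q))) ?num_real //.
  move: (`|Vs _|) (normr_ge0 (Vs (y, q))) => v v0.
  have -> : lam * v ^+ 2 + lam^-1 = ((lam * v - 1) ^+ 2 + 2 * (lam * v)) / lam by field; rewrite gt_eqF.
  by rewrite ler_pdivlMr //; have := sqr_ge0 (lam * v - 1); have := mulr_ge0 (ltW l0) v0; lra.
rewrite RintegralD; [|exact: mslab|exact: Ia|exact: Ib].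
rewrite RintegralZl; [|exact: mslab|exact: ISw].
rewrite RintegralZl; [|exact: mslab|exact: Iw].
apply: lerD.
  apply: ler_wpM2l; first exact: ltW.
  rewrite /Rintegral; apply: fine_le.
  - exact: (integrable_fin_num (mslab c d) (ISw c d)).
  - exact: (integrable_fin_num measurableT IW).
  apply: (@le_trans _ _ (\int[nu]_(yq in slab c d) W (swap_xy yq))%E).
    by rewrite le_eqVlt; apply/orP; left; apply/eqP; apply: eq_integral => yq /WE ->.
  apply: ge0_subset_integral => //; first by case/integrableP : IW.
  move=> yq _; rewrite /W patchE; case: ifP => // _.
  by rewrite lee_fin mulr_ge0 ?sqr_ge0 ?wy_ge0.
have Iwi : mu.-integrable (`[c, d] : set mR) (EFin \o (fun y : R => `|y|^-1)).
  have fcd : (mu `[c, d] < +oo)%E by rewrite -ge0_fin_numE // lebesgue_measure_itv /=; case: ifP.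
  apply: eq_integrable (integrable_mul_bounded (mi c d) mwi HK' (@integrable_cst_fin _ _ mu _ 1 (mi c d) fcd)) => //.
  by move=> y _; rewrite /= mulr1.
rewrite -E1 (_ : \int[mu]_(y in `[c, d]) (`|y|^-1 * Rintegral leb2 Q (fun=> 1)) =
  Rintegral leb2 Q (fun=> 1) * \int[mu]_(y in `[c, d]) `|y|^-1).
  by rewrite mulrCA mulrA.
by rewrite -RintegralZl //; apply: eq_Rintegral => y _; rewrite mulrC.
Qed.

Hypothesis weakV : forall h h1 h2 : R -> R, smooth1 h -> off0_supported h ->
  (forall y : R, is_derive y 1 h (h1 y)) -> (forall y : R, is_derive y 1 h1 (h2 y)) ->
  cint (fun p => (h2 (yc p) - h1 (yc p) / yc p -
     ((k%:~R + l%:~R * (yc p ^+ 2 / 2)) ^+ 2 + 1) * h (yc p)) *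
     trig b (phase k%:~R l%:~R p) * V p * wy p) = 0.

Lemma derive_eq0_out (f f1 : R -> R) (c d : R) : (forall y : R, is_derive y 1 f (f1 y)) ->
  (forall t, t < c \/ d < t -> f t = 0) -> forall t, t < c \/ d < t -> f1 t = 0.
Proof.
move=> df f0 t tcd; rewrite -(@derive_val _ _ _ _ _ _ _ (df t)).
apply: derive_val; apply: near_eq_is_derive (is_derive_const t (1 : R) 0).
case: tcd => h; first by apply: filterS (lt_nbhsl h) => y yc; rewrite f0 //; left.
by apply: filterS (lt_nbhsr h) => y yc; rewrite f0 //; right.
Qed.

(** An instance of [weak_kernel1] with potential [q y = (k + l y^2 / 2)^2]. A test function on an
    interval avoiding [0] gives a mode supported off the singular set, and Fubini over the slab
    turns the weak identity for [V] into the one for its coefficient. *)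
Lemma coef_eq0 (s a c : R) : s = 1 \/ s = -1 -> a < c ->
  (forall y, y \in `[a, c] -> 0 < s * y) ->
  {ae mu, forall y, y \in `[a, c] -> coef y = 0}.
Proof.
move=> s1 ac sac; have s2 : s ^+ 2 = 1 by case: s1 => ->; rewrite ?sqrrN expr1n.
have norm_s y : 0 < s * y -> s * y = `|y|.
  case: s1 => ->; rewrite ?mul1r ?mulN1r => h; first by rewrite gtr0_norm.
  by rewrite ltr0_norm // -oppr_gt0.
have off c' d' : c' < d' -> (forall y, y \in `[c', d'] -> 0 < s * y) -> ~~ (c' <= 0 <= d').
  by move=> cd H; apply/negP => h; have := H 0; rewrite in_itv /= mulr0 ltxx => /(_ h).
pose q (y : R) := (k%:~R + l%:~R * (y ^+ 2 / 2)) ^+ 2 : R.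
have [r [dr _]] := @smooth1_sq R 1%N.
have cq : continuous q.
  have cp : continuous (fun y : R => k%:~R + l%:~R * (y ^+ 2 / 2) : R).
    by move=> y; exact: is_derive_continuous (is_derive_add (is_derive_const y 1 k%:~R) (is_derive_scale l%:~R (dr y))).
  by move=> y; rewrite /q; apply: cvgM; exact: cp.
have q0 y : 0 <= q y by exact: sqr_ge0.
apply: (@weak_kernel1 R s q coef s2 cq q0 (fine (\int[nu]_yq W (swap_xy yq))%E) (Rintegral leb2 Q (fun=> 1)) a c) => //.
- apply: fine_ge0; apply: integral_ge0 => yq _; rewrite /W patchE; case: ifP => // _.
  by rewrite lee_fin mulr_ge0 ?sqr_ge0 ?wy_ge0.
- by apply: Rintegral_ge0.
- by move=> c' d' cd scd; apply: integrable_coef; exact: off.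
- move=> c' d' lam cd scd l0; have := coef_bound (off _ _ cd scd) l0.
  have -> : \int[mu]_(y in `[c', d']) (`|y|^-1 * `|coef y|) = \int[mu]_(y in `[c', d']) (`|coef y| / (s * y)).
    by apply: eq_Rintegral => y; rewrite inE => yi; rewrite norm_s ?scd // mulrC.
  have -> // : \int[mu]_(y in `[c', d']) `|y|^-1 = \int[mu]_(y in `[c', d']) (s * y)^-1.
  by apply: eq_Rintegral => y; rewrite inE => yi; rewrite norm_s ?scd.
move=> c' d' eta eta1 eta2 cd scd [se [c0 [d0 [cc0 dd0 eta0]]]] de de1.
have cd0 := off _ _ cd scd.
have z0 t : t < c0 \/ d0 < t -> eta t = 0 by move=> h; apply: eta0; case: h => h; [left|right]; exact: ltW.
have z1 := derive_eq0_out de z0; have z2 := derive_eq0_out de1 z1.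
have inside t : ~~ (c' <= t <= d') -> t < c0 \/ d0 < t.
  by rewrite negb_and -!ltNge => /orP[h|h]; [left; exact: lt_trans cc0|right; exact: lt_trans h].
pose E (y : R) := eta2 y - eta1 y / y - (q y + 1) * eta y.
have ceta1 y : {for y, continuous eta1} by exact: is_derive_continuous (de1 y).
have ceta := smooth1_continuous se.
(* [eta1] and [eta2] are given only as derivatives; uniqueness identifies them with smooth
   functions, which provides the continuity of [eta2]. *)
have [e1 [de1' se1]] := (smooth1P eta).1 se; have [e2 [de2' se2]] := (smooth1P e1).1 se1.
have ee1 : e1 = eta1.
  by apply/funext => y; rewrite -(@derive_val _ _ _ _ _ _ _ (de y)) (@derive_val _ _ _ _ _ _ _ (de1' y)).
have ee2 : e2 = eta2.
  by apply/funext => y; rewrite -(@derive_val _ _ _ _ _ _ _ (de1 y)) -ee1 (@derive_val _ _ _ _ _ _ _ (de2' y)).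
have ceta2 : continuous eta2 by rewrite -ee2; exact: smooth1_continuous.
pose e (y : R) := E y * `|y|^-1.
have me : measurable_fun [set: mR] e.
  have cm := continuous_measurable_fun.
  apply: measurable_funM; last exact: mw.
  apply: measurable_funB; last first.
    apply: measurable_funM; last exact: cm.
    by apply: measurable_funD => //; exact: cm.
  apply: measurable_funB; first exact: cm.
  by apply: measurable_funM; [exact: cm|exact: measurable_invr].
have [K HK] : exists K : R, forall y, `[c', d']%classic y -> `|e y| <= K.
  have cE : {within `[c', d'], continuous e}.
    apply: continuous_in_subspaceT => y; rewrite inE /= => yi.
    have y0 : y != 0.
      by apply: contraNneq cd0 => <-; move: yi; rewrite in_itv.
    have ci : {for y, continuous (fun y : R => y^-1)} by apply: cvgV => //; exact: cvg_id.
    have cn : {for y, continuous (fun y : R => `|y|^-1)}.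
      by apply: cvgV; [rewrite normr_eq0|exact: norm_continuous].
    apply: cvgM; last exact: cn.
    apply: cvgB; last by apply: cvgM; [apply: cvgD; [exact: cq|exact: cvg_cst]|exact: ceta].
    by apply: cvgB; [exact: ceta2|apply: cvgM; [exact: ceta1|exact: ci]].
  have [M [Mr HM]] := compact_bounded (continuous_compact cE (@segment_compact _ c' d')).
  exists (M + 1) => y yi; apply: (HM (M + 1)); first by rewrite ltrDl.
  by exists y.
have mei : measurable_fun (`[c', d']%classic : set mR) e by exact: measurable_funTS.
have [_ EE] := Rintegral_section_mul (mi c' d') mQ (IF cd0) mei HK.
transitivity (\int[mu]_(y in `[c', d']) (e y * Rintegral leb2 Q (fun q => F (y, q)))).
  by apply: eq_Rintegral => y; rewrite inE => yi; rewrite /e norm_s ?scd.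
rewrite EE; have off_eta : off0_supported eta.
  exists (Num.min `|c'| `|d'|), (`|c'| + `|d'|); split.
    rewrite lt_min !normr_gt0; apply/andP; split.
      by apply: contraNneq cd0 => c00; move: cd; rewrite c00 lexx => /ltW.
    by apply: contraNneq cd0 => d00; move: cd; rewrite d00 lexx andbT => /ltW.
  move=> y ey; have /andP[cy yd] : c' <= y <= d'.
    by apply: contraNT ey => /inside/z0 ->.
  have sc : 0 < s * c' by apply: scd; rewrite in_itv /= lexx ltW.
  have sd : 0 < s * d' by apply: scd; rewrite in_itv /= lexx ltW.
  have sy : 0 < s * y by apply: scd; rewrite in_itv /= cy.
  rewrite -(norm_s _ sc) -(norm_s _ sd) -(norm_s _ sy) ge_min.
  case: s1 sc sd sy => ->; rewrite ?mul1r ?mulN1r => h1 h2 h3.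
    by rewrite cy /=; lra.
  by rewrite !lerN2 yd orbT /=; lra.
(* The integrand over M vanishes for [y] outside [[c', d']], so the integral over the cell is the
   one over the slab. *)
rewrite -(weakV se off_eta de de1) (@cint_slab _ c' d').
- by apply: eq_Rintegral => -[y r'] _; rewrite /F /e /E /q /phase /wy /yc /xc /zc /=; ring.
- have cm := continuous_measurable_fun.
  have myc : measurable_fun [set: mR3] (@yc R : mR3 -> R).
    by apply: continuous_measurable3; exact: continuous_yc.
  have mE : measurable_fun [set: mR] E.
    apply: measurable_funB; last first.
      apply: measurable_funM; last exact: cm.
      by apply: measurable_funD => //; exact: cm.
    apply: measurable_funB; first exact: cm.
    by apply: measurable_funM; [exact: cm|exact: measurable_invr].
  apply: measurable_funM; last exact: measurable_wy.
  apply: measurable_funM; last exact: mV.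
  apply: measurable_funM; first exact: (measurableT_comp mE myc).
  by apply: continuous_measurable3; exact: continuous_phase.
- move=> p; apply: contraNT => /inside h.
  by rewrite z0 // z1 // z2 // mul0r mulr0 !subr0 !mul0r.
Qed.

End Coefficient.
Hypothesis weakV : forall (k l : int) b (h h1 h2 : R -> R), smooth1 h -> off0_supported h ->
  (forall y : R, is_derive y 1 h (h1 y)) -> (forall y : R, is_derive y 1 h1 (h2 y)) ->
  cint (fun p => (h2 (yc p) - h1 (yc p) / yc p -
     ((k%:~R + l%:~R * (yc p ^+ 2 / 2)) ^+ 2 + 1) * h (yc p)) *
     trig b (phase k%:~R l%:~R p) * V p * wy p) = 0.

Lemma ae_section_eq0 (s a c : R) : s = 1 \/ s = -1 -> a < c ->
  (forall y, y \in `[a, c] -> 0 < s * y) ->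
  {ae mu, forall y, y \in `[a, c] -> (\int[leb2]_(q in Q) `|Vs (y, q)|%:E = 0)%E}.
Proof.
move=> s1 ac sac; have aeF := ae_filter_ringOfSetsType mu.
have ac0 : ~~ (a <= 0 <= c).
  by apply/negP => h; have := sac 0; rewrite in_itv /= mulr0 ltxx => /(_ h).
have H (i : int * int * bool) : {ae mu, forall y, y \in `[a, c] -> coef i.1.1 i.1.2 i.2 y = 0}.
  by apply: (coef_eq0 _ s1 ac sac) => h h1 h2; exact: weakV.
apply: filterS (filterI (ae_section_integrable (mi a c) mQ (ISV ac0)) (ae_forall_count H)) => y [Iy Hy] yi.
have /Iy {}Iy : y \in `[a, c]%classic by rewrite inE.
by apply: fourier_unique2 => // k l b; exact: (Hy (k, l, b) yi).
Qed.

(** The intervals [[lo n, hi n]] and their mirror images exhaust [y != 0], so almost every section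
    of [V] vanishes almost everywhere on the square. The plane [y = 0] contributes nothing, as the
    density is zero there. *)
Lemma weak_kernel3 : cint (fun p => V p ^+ 2 * wy p) = 0.
Proof.
have aeF := ae_filter_ringOfSetsType mu.
(* With [n + 2] above, and not [n + 1], the interval is nondegenerate already for [n = 0]. *)
pose lo n : R := n.+1%:R^-1; pose hi n : R := n.+2%:R.
have lo0 n : 0 < lo n by rewrite invr_gt0 ltr0n.
have lohi n : lo n < hi n.
  apply: (@le_lt_trans _ _ 1); first by rewrite invf_le1 ?ltr0n // ler1n.
  by rewrite ltr1n.
have H (i : nat * bool) : {ae mu, forall y : R, y \in (if i.2 then `[lo i.1, hi i.1] else `[- hi i.1, - lo i.1]) ->
    (\int[leb2]_(q in Q) `|Vs (y, q)|%:E = 0)%E}.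
  case: i => n [] /=.
    apply: (@ae_section_eq0 1) => //; first by left.
    by move=> y; rewrite in_itv /= mul1r => /andP[ly _]; exact: lt_le_trans (lo0 n) ly.
  apply: (@ae_section_eq0 (-1)) => //; [by right|by rewrite ltrN2|].
  move=> y; rewrite in_itv /= mulN1r oppr_gt0 => /andP[_ yl].
  by apply: le_lt_trans yl _; rewrite oppr_lt0.
have sec0 : {ae mu, forall y : R, (\int[leb2]_q W (swap_xy (y, q)) = 0)%E}.
  apply: filterS (ae_forall_count H) => y Hy.
  have [y0|y0] := eqVneq y 0.
    rewrite (eq_integral (cst 0%E)) ?integral0 // => q _; rewrite /W patchE; case: ifP => // _.
    by rewrite /= /wy /yc /= y0 normr0 invr0 mulr0.
  have VQ0 : (\int[leb2]_(q in Q) `|Vs (y, q)|%:E = 0)%E.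
    have [n _ Hn] : \forall n \near \oo, lo n <= `|y| /\ `|y| <= hi n.
      have y1 : 0 < `|y| by rewrite normr_gt0.
      near=> n; split.
        rewrite /lo invf_ple ?posrE ?ltr0n //.
        by apply: le_trans (_ : n%:R <= _); [near: n; exact: nbhs_infty_ger|rewrite ler_nat].
      by apply: le_trans (_ : n%:R <= _); [near: n; exact: nbhs_infty_ger|rewrite ler_nat leqW].
    have [h1 h2] := Hn n (leqnn n).
    have [yp|yn] := ltP 0 y.
      by apply: (Hy (n, true)); rewrite /= in_itv /= -(gtr0_norm yp) h1.
    by apply: (Hy (n, false)); rewrite /= in_itv /=; move: h1 h2; rewrite ler0_norm // => h1 h2; apply/andP; split; lra.
  have mVy : measurable_fun [set: mR2] (fun q : mR2 => Vs (y, q)) := measurableT_comp mVs (pair1_measurable y).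
  have mVQ : measurable_fun Q (fun q : mR2 => (Vs (y, q))%:E) by apply/measurable_EFinP; exact: measurable_funTS.
  have V0 := (ae_eq_integral_abs leb2 mQ mVQ).1 VQ0.
  rewrite (ae_eq_integral (cst 0%E)) ?integral0 //.
    exact: (measurableT_comp (measurableT_comp mW (@measurable_swap_xy R)) (pair1_measurable y)).
  have aeF2 := ae_filter_ringOfSetsType leb2.
  apply: filterS V0 => q Vq _; rewrite /W patchE; case: ifPn => // /set_mem [c1 c2].
  have /Vq [V00] : Q q by split; rewrite /= in_itv.
  by rewrite /= V00 expr0n mul0r.
rewrite /Rintegral integral_mkcond -/W integral_swap_xy //.
rewrite -(@integral12_prod_meas1 _ _ _ _ R mu leb2 _ IW).
rewrite (ae_eq_integral (cst 0%E)) ?integral0 //.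
- exact: (@measurable_fubini_F _ _ _ _ R mu leb2 _ IW).
- by apply: filterS sec0 => y h _.
Unshelve. all: by end_near. Qed.

End Kernel.

(** * Essential self-adjointness of the sub-Laplacian *)

Section Assembly.
Variable R : realType.
Let mR := measurableTypeR R.
Let mR3 := (mR * mR * mR)%type.
Implicit Types f g u v : R * R * R -> R[i].
Local Notation D := (Cc_smooth_off (@singular_set R)).
Local Notation A := (complexify (lap_sr (@X1 R) (@X2 R))).
Local Notation w := (@wy R).
Local Notation L := (L2 w).
Local Notation dot := (rdot w).
Local Notation lim := (lim_to (@lin R) dot).

Let mw := @measurable_wy R.
Let w0 := @wy_ge0 R.

Let linL (a : R) f g : L f -> L g -> L (lin a f g). Proof. exact: (L2_rlin mw). Qed.
Let dotC f g : L f -> L g -> dot f g = dot g f. Proof. by move=> _ _; exact: rdotC. Qed.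
Let dotl (a : R) f g h : L f -> L g -> L h -> dot (lin a f g) h = a * dot f h + dot g h.
Proof. exact: (rdot_lin mw w0). Qed.
Let dot0 f : L f -> 0 <= dot f f. Proof. by move=> _; exact: (rdot_ge0 w0). Qed.
Let complete := @L2_complete R w mw w0.

Lemma D_lin (a : R) f g : D f -> D g -> D (lin a f g). Proof. exact: D_clin. Qed.

Lemma A_lin (a : R) f g : D f -> D g -> A (lin a f g) = lin a (A f) (A g).
Proof. exact: A_clin. Qed.

Lemma Ccinf0 : Ccinf (fun=> 0 : R).
Proof. by have /CcinfP[] := @D0 R. Qed.

Lemma lapR0 p : lapR (fun=> 0 : R) p = 0.
Proof.
have E := etrans (lapR_lin (-1) p Ccinf0 Ccinf0) (etrans (congr1 (+%R^~ _) (mulN1r _)) (addNr _)).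
suff -> : (fun=> 0 : R) = (fun=> -1 * 0 + 0) :> (R * R * R -> R) by exact: E.
by apply/funext => q; rewrite mulr0 addr0.
Qed.

Lemma integrable_component (c : (R * R * R -> R[i]) -> R * R * R -> R) f :
  c = @cRe R \/ c = @cIm R -> L f ->
  (@leb3 R).-integrable (@cell R) (EFin \o (fun p => c f p ^+ 2 * wy p)).
Proof.
move=> cE Lf; have [_ m1 m2 _] := Lf.
have mcf : measurable_fun [set: mR3] (c f) by case: cE => ->.
apply: le_integrable (integrable_rprod_self mw w0 Lf); first exact: measurable_cell.
  apply/measurable_EFinP; apply: measurable_funTS; apply: measurable_funM; last exact: mw.
  exact: measurable_funX.
move=> p _; have p1 : 0 <= c f p ^+ 2 * wy p by rewrite mulr_ge0 ?sqr_ge0.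
rewrite lee_fin (ger0_norm p1) (ger0_norm (rprod_ge0 w0 f p)).
rewrite /rprod ler_wpM2r ?w0 // -!expr2.
by case: cE => ->; [rewrite lerDl sqr_ge0|rewrite lerDr sqr_ge0].
Qed.

(** The operator acts on real and imaginary parts separately, so testing with a mode placed in a
    single component isolates that component of [f] and yields the weak equation of
    [weak_kernel3]. *)
Lemma kernel_component (c : (R * R * R -> R[i]) -> R * R * R -> R) f :
  c = @cRe R \/ c = @cIm R -> L f ->
  (forall u, D u -> dot (lin (-1) u (A u)) f = 0) ->
  Rintegral (@leb3 R) (@cell R) (fun p => c f p ^+ 2 * wy p) = 0.
Proof.
move=> cE Lf H; have [_ m1 m2 _] := Lf.
have mcf : measurable_fun [set: mR3] (c f) by case: cE => ->.
apply: weak_kernel3 => //; first exact: integrable_component.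
move=> k l b h h1 h2 sh h0 dh dh1; pose m := mode h k%:~R l%:~R b.
have Cm : Ccinf m by exact: Ccinf_mode.
pose u : R * R * R -> R[i] := if asbool (c = @cRe R) then (fun p => Complex (m p) 0) else (fun p => Complex 0 (m p)).
have Du : D u.
  by apply/CcinfP; rewrite /u; case: asboolP => _; split => //; exact: Ccinf0.
rewrite -(H u Du) /rdot; apply: eq_Rintegral => p _; rewrite /rprod cRe_lin cIm_lin lapE //.
have -> : (h2 (yc p) - h1 (yc p) / yc p - ((k%:~R + l%:~R * (yc p ^+ 2 / 2)) ^+ 2 + 1) * h (yc p)) *
     trig b (phase k%:~R l%:~R p) = -1 * m p + lapR m p.
  by rewrite (lapR_mode k%:~R l%:~R b p dh dh1) /m /mode; ring.
rewrite /u; case: asboolP => [->|cN]; rewrite /cRe /cIm /=.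
  by rewrite lapR0 mulr0 addr0 mul0r addr0.
case: cE => // ->; rewrite /cIm.
by rewrite lapR0 mulr0 addr0 mul0r add0r.
Qed.

Lemma A_kernel f : L f -> (forall u, D u -> dot (lin (-1) u (A u)) f = 0) -> dot f f = 0.
Proof.
move=> Lf H.
have E1 := kernel_component (or_introl erefl) Lf H.
have E2 := kernel_component (or_intror erefl) Lf H.
have I1 := integrable_component (or_introl erefl) Lf.
have I2 := integrable_component (or_intror erefl) Lf.
rewrite /rdot -[RHS]addr0 -{1}E1 -E2 -RintegralD //; last exact: measurable_cell.
by apply: eq_Rintegral => p _; rewrite /rprod mulrDl !expr2.
Qed.

Let DL : D `<=` L. Proof. by move=> f; exact: D_L2. Qed.
Let Dne : D !=set0. Proof. by exists (fun=> 0); exact: D0. Qed.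
Let AL f : D f -> L (A f). Proof. by move=> Df; apply: D_L2; exact: D_A. Qed.

(** For [u] in the domain, [A u - u] is in the domain as well, so a vector orthogonal to the domain
    satisfies the hypothesis of [A_kernel]. *)
Lemma D_dense f : L f -> exists s, (forall n, D (s n)) /\ lim s f.
Proof.
apply: (dense_of_orthogonal linL dotC dotl dot0 complete Dne DL D_lin) => g Lg Hg.
exact: (A_kernel Lg (fun u Du => Hg _ (D_lin (-1) Du (D_A Du)))).
Qed.

Lemma lim_L2dist2 (s : nat -> R * R * R -> R[i]) f : (forall n, L (s n)) -> L f ->
  (fun n => L2dist2 w (s n) f) @ \oo --> (0 : \bar R)%E <-> lim s f.
Proof.
move=> Ls Lf; have -> : (fun n => L2dist2 w (s n) f) = EFin \o (fun n => sqdist (@lin R) dot (s n) f).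
  by apply/funext => n /=; rewrite (L2dist2E mw w0).
split => [h|h]; first exact: (fine_cvg h).
by apply: cvg_EFin => //; apply: nearW.
Qed.

(** Multiplication by [i]. The imaginary part of the product of [f] and [g] is the real product of
    [f] and [muli g], so commutation with [A] transfers real identities to imaginary parts. *)
Definition muli f : R * R * R -> R[i] := fun p => Complex 0 1 * f p.

Lemma D_muli f : D f -> D (muli f).
Proof.
move=> Df; have -> : muli f = (fun p => Complex 0 1 * f p + 0) by apply/funext => p; rewrite addr0.
exact: D_clin Df (@D0 R).
Qed.

Lemma A_muli f : D f -> A (muli f) = muli (A f).
Proof.
move=> Df; have {1}-> : muli f = (fun p => Complex 0 1 * f p + 0) by apply/funext => p; rewrite addr0.
rewrite (A_clin _ Df (@D0 R)); apply/funext => p; rewrite (lapE (@D0 R)) /=.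
have z : (cRe (fun=> 0) = (fun=> 0 : R)) /\ (cIm (fun=> 0) = (fun=> 0 : R)) by [].
by rewrite z.1 z.2 !lapR0 /muli -[RHS]addr0.
Qed.

Lemma rdot_muli f g : dot (muli f) (muli g) = dot f g.
Proof.
apply: eq_Rintegral => p _; rewrite /rprod /muli /cRe /cIm; case: (f p) (g p) => [a b] [c d] /=.
by ring.
Qed.

Lemma L2_muli f : L f -> L (muli f).
Proof.
move=> Lf; have -> : muli f = (fun p => Complex 0 1 * f p + 0) by apply/funext => p; rewrite addr0.
by have := L2_lin mw w0 (Complex 0 1) Lf (D_L2 (@D0 R)); apply.
Qed.

Lemma lim_muli s f : lim s f -> lim (fun n => muli (s n)) (muli f).
Proof.
rewrite /lim_to; have -> // : (fun n => sqdist (@lin R) dot (muli (s n)) (muli f)) =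
  (fun n => sqdist (@lin R) dot (s n) f).
apply/funext => n; rewrite /sqdist -[RHS]rdot_muli.
have -> // : lin (-1) (muli f) (muli (s n)) = muli (lin (-1) f (s n)).
by apply/funext => p; rewrite /lin /muli mulrDr mulrCA.
Qed.

Lemma L2dist2_refl f : L f -> L2dist2 w f f = 0%E.
Proof.
move=> Lf; rewrite (L2dist2E mw w0) // (sqdistE linL dotC dotl) //.
by congr (_%:E); ring.
Qed.

Lemma A_linear_operator : linear_operator w D A.
Proof.
split; [exact: D0|exact: D_clin|by move=> u Du; split; [exact: DL|exact: AL]| |].
  move=> u v Du Dv; have [Lu Lv] := (DL Du, DL Dv); have [LAu LAv] := (AL Du, AL Dv).
  rewrite !(L2dist2E mw w0) // => -[d0]; congr (_%:E).
  (* For a null [d = u - v], symmetry gives [|A d|^2 = <d, A (A d)>], which Cauchy-Schwarz bounds by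
     zero: the operator does not depend on the representative. *)
  have Dd := D_lin (-1) Dv Du; have Ld := DL Dd.
  have d0' : dot (lin (-1) v u) (lin (-1) v u) = 0 by exact: d0.
  rewrite /sqdist -(A_lin (-1) Dv Du); apply: etrans (A_sym Dd (D_A Dd)) _.
  have := cauchy_schwarz linL dotC dotl dot0 Ld (AL (D_A Dd)).
  by rewrite d0' mul0r real_exprn_even_le0 ?num_real //= => /eqP.
move=> c u v Du Dv; rewrite (A_clin c Du Dv); apply: L2dist2_refl.
by have := AL (D_clin c Du Dv); rewrite (A_clin c Du Dv).
Qed.

Lemma A_symmetric_op : symmetric_op w (op_graph D A).
Proof.
move=> u h v g [/= Du ->] [/= Dv ->]; rewrite !L2dotE (A_sym Du Dv).
exact: (congr1 (Complex _) (etrans (A_sym Du (D_muli Dv)) (congr1 (dot u) (A_muli Dv)))).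
Qed.

Lemma graph_in_closure u : D u -> op_closure w (op_graph D A) (u, A u).
Proof.
move=> Du; have [Lu LAu] := (DL Du, AL Du); split; [exact: Lu|exact: LAu|]; exists (fun=> (u, A u)).
split; first by move=> n; split; [exact: Du|].
  by rewrite (L2dist2_refl Lu); exact: cvg_cst.
by rewrite (L2dist2_refl LAu); exact: cvg_cst.
Qed.

Lemma closure_seq f g : op_closure w (op_graph D A) (f, g) ->
  exists s, [/\ forall n, D (s n), lim s f & lim (A \o s) g].
Proof.
move=> [/= Lf Lg [s [Ds s1 s2]]].
have Ds1 n : D (s n).1 by have [] := Ds n.
have Ds2 n : A (s n).1 = (s n).2 by have [] := Ds n.
exists (fun n => (s n).1); split; [exact: Ds1| |].
  exact: (lim_L2dist2 (fun n => DL (Ds1 n)) Lf).1 s1.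
apply: (lim_L2dist2 (fun n => AL (Ds1 n)) Lg).1.
suff -> : (fun n => L2dist2 w (A (s n).1) g) = (fun n => L2dist2 w (s n).2 g) by exact: s2.
by apply/funext => n; rewrite Ds2.
Qed.

(** That the adjoint is contained in the closure uses only the real part of the adjoint relation on
    test functions. The converse is the symmetry of the closure, whose imaginary part is the real
    statement for the pair multiplied by [i]. *)
Lemma closure_self_adjoint : self_adjoint w (op_closure w (op_graph D A)).
Proof.
split.
  move=> f Lf; have [s [Ds sf]] := D_dense Lf; exists s; split.
    by move=> n; exists (A (s n)); exact: graph_in_closure.
  exact: (lim_L2dist2 (fun n => DL (Ds n)) Lf).2 sf.
apply/seteqP; split => -[f g] /=.
  move=> [/= Lf Lg adj].
  have radj u : D u -> dot (A u) f = dot u g.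
    by move=> /graph_in_closure/adj; rewrite !L2dotE => -[].
  have [s [Ds sf sg]] := adjoint_in_closure linL dotC dotl dot0 complete Dne DL AL D_lin A_lin
    (@A_sym R) (@A_neg R) A_kernel Lf Lg radj.
  split; [exact: Lf|exact: Lg|]; exists (fun n => (s n, A (s n))); split.
  - by move=> n; split; [exact: Ds|].
  - exact: (lim_L2dist2 (fun n => DL (Ds n)) Lf).2 sf.
  - exact: (lim_L2dist2 (fun n => AL (Ds n)) Lg).2 sg.
move=> Cfg; have [s [Ds sf sg]] := closure_seq Cfg; have [/= Lf Lg _] := Cfg.
split; [exact: Lf|exact: Lg|] => u h Cuh; have [s' [Ds' su sh]] := closure_seq Cuh; have [/= Lu Lh _] := Cuh.
rewrite !L2dotE (closure_symmetric linL dotC dotl dot0 DL AL (@A_sym R) Ds' Ds Lu Lh Lf Lg su sh sf sg).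
apply: (congr1 (Complex _)).
apply: (closure_symmetric linL dotC dotl dot0 DL AL (@A_sym R) Ds' _ Lu Lh _ _ su sh (lim_muli sf)).
- by move=> n; exact: D_muli.
- exact: L2_muli.
- exact: L2_muli.
have -> : A \o (fun n => muli (s n)) = (fun n => muli (A (s n))).
  by apply/funext => n /=; exact: A_muli.
exact: (lim_muli sg).
Qed.

Lemma A_essentially_self_adjoint : essentially_self_adjoint w D A.
Proof.
split; [exact: A_linear_operator| |exact: A_symmetric_op|exact: closure_self_adjoint].
move=> f Lf; have [s [Ds sf]] := D_dense Lf; exists s; split.
  by move=> n; exists (A (s n)); split; [exact: Ds|].
exact: (lim_L2dist2 (fun n => DL (Ds n)) Lf).2 sf.
Qed.

End Assembly.

Theorem theorem3 (R : realType) :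
  [/\ (forall p : R * R * R, yc p != 0 ->
         popp (@X1 R) (@X2 R) p = 1 / `|yc p|),
      (forall f : R * R * R -> R,
         on_M f -> smooth_on (~` @singular_set R) f ->
         forall p : R * R * R, yc p != 0 ->
           lap_sr (@X1 R) (@X2 R) f p =
             vderiv (@X1 R) (vderiv (@X1 R) f) p
             + vderiv (@X2 R) (vderiv (@X2 R) f) p
             - 1 / yc p * vderiv (@X2 R) f p)
    & essentially_self_adjoint (popp (@X1 R) (@X2 R))
        (Cc_smooth_off (@singular_set R))
        (complexify (lap_sr (@X1 R) (@X2 R)))].
Proof.
split.
- by move=> p _; rewrite poppE div1r.
- move=> f _; rewrite off0E => Sf p p0.
  rewrite (lap_srE (Sf 2) p0) (vderivX1XE (@open_off0 R) (Sf 2) p0) div1r.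
  by rewrite (funext (vderivX2E f)) !vderivX2E.
- by rewrite (funext (@poppE R)); exact: A_essentially_self_adjoint.
Qed.
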